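(* Let $G\subset\mathbb{C}$ be an open set, let $f$ be a function meromorphic on an open set $G'\supset \mathrm{cl}(G)$, let $\epsilon\in(0,\infty)$, and let $\Lambda$ be a bounded connected component of the level set $E_{f,\epsilon}=\{z\in G' : |f(z)|=\epsilon\}$ with $\Lambda\subset G$. Then $\Lambda$ has one or more bounded faces and a single unbounded face, and each edge of $\Lambda$ is adjacent to two distinct faces of $\Lambda$.
   Context: The set $\Lambda$ is regarded as a planar graph (a finite graph embedded in the plane without edge crossings, loops and multiple edges allowed, a simple closed path also being counted as a planar graph): its vertices are the critical points of $f$ (zeros of $f'$) in $\Lambda$, and its edges are the paths in $\Lambda$ joining critical points, with no critical points in their interiors. If $\Lambda$ contains no critical points, it is a simple closed path, regarded as a single edge. A face of $\Lambda$ is a connected component of $\Lambda^c=\mathbb{C}\setminus\Lambda$. An edge is adjacent to a face if it is contained in the boundary of that face. *)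

(* Defs.v *)
From HB Require Import structures.
From mathcomp Require Import all_boot all_order all_algebra.
From mathcomp Require Export complex.
From mathcomp Require Import all_classical all_reals all_analysis.

Set Implicit Arguments.
Unset Strict Implicit.
Unset Printing Implicit Defensive.

Import Order.TTheory GRing.Theory Num.Theory.
Import numFieldNormedType.Exports.

Local Open Scope classical_set_scope.
Local Open Scope ring_scope.

(* The complex plane over [R], with the topology and the normed-module structure
   (over itself) that [^o] gives to a [numFieldType].  In particular
   [derivable f z 1] below is complex differentiability. *)
Notation Cplane R := (R[i]^o).

(* [f] is a total function: its value at a pole carries no information. *)
Definition is_pole (R : realType) (f : Cplane R -> Cplane R) (p : Cplane R) :
  Prop := `|f z| @[z --> p^'] --> +oo.

Definition meromorphic_on (R : realType) (U : set (Cplane R))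
    (f : Cplane R -> Cplane R) : Prop :=
  forall z, U z ->
    (\forall w \near z^', derivable f w 1) /\ (derivable f z 1 \/ is_pole f z).

(* Poles are left out because there [|f|] is infinite, whatever the total
   function [f] returns. *)
Definition level_set (R : realType) (U : set (Cplane R))
    (f : Cplane R -> Cplane R) (eps : R) : set (Cplane R) :=
  [set z | [/\ U z, ~ is_pole f z & `|f z| = (eps%:C)%C]].

Definition is_component (T : topologicalType) (A C : set T) : Prop :=
  exists2 x, A x & C = connected_component A x.

Definition critical_points (R : realType) (f : Cplane R -> Cplane R)
    (L : set (Cplane R)) : set (Cplane R) :=
  [set z | L z /\ 'D_1 f z = 0].

(* An edge is given by its point set, end points included.  The path may be a
   loop: [g 0 = g 1] is allowed.  Without critical points, the whole of [L] is
   the only edge. *)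
Definition is_edge (R : realType) (f : Cplane R -> Cplane R)
    (L E : set (Cplane R)) : Prop :=
  (exists g : R -> Cplane R,
    [/\ {within `[0, 1], continuous g} /\ {in `]0, 1[ &, injective g},
        E = g @` `[0, 1],
        E `<=` L,
        critical_points f L (g 0) /\ critical_points f L (g 1) &
        forall t : R, t \in `]0, 1[ -> ~ critical_points f L (g t)])
  \/ (critical_points f L = set0 /\ E = L).

Definition is_face (R : realType) (L F : set (Cplane R)) : Prop :=
  is_component (~` L) F.

Definition frontier (T : topologicalType) (A : set T) : set T :=
  closure A `\` A°.

Definition edge_adjacent (R : realType) (E F : set (Cplane R)) : Prop :=
  E `<=` frontier F.

(* Main.v *)
Require Import Defs.
From mathcomp Require Import all_boot all_order all_algebra.
From mathcomp Require Import all_classical all_reals all_analysis.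
From mathcomp Require Import ring lra.

Set Implicit Arguments.
Unset Strict Implicit.
Unset Printing Implicit Defensive.

Import Order.TTheory GRing.Theory Num.Theory.
Import numFieldNormedType.Exports.
Import Normc.

Local Open Scope classical_set_scope.
Local Open Scope ring_scope.

(** Let [u = |f| - eps].  At a point of [Lambda] where [f' <> 0] the function [u]
    is strictly monotone in the direction [f / f'], so there are exactly two
    local sides, [u < 0] and [u > 0], and the faces having the point in their
    closure are those containing these sides.  The two faces differ: otherwise
    a path in the common face, closed up by a short segment across [Lambda],
    would be a closed curve crossing the zero set of [u] near [Lambda] exactly
    once.  To exclude this, turn [u] into a map to the circle which is constant
    away from the part of the level set close to [Lambda]; on the plane it has a
    continuous argument, yet the argument would change by one turn along the
    closed curve.  The local picture rests on the Taylor expansion with remainder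
    of a holomorphic function, obtained from Goursat's lemma and the Cauchy
    formula on a circle.  If all points of [Lambda] were critical, [Lambda] would
    be a single point; the other components of the level set near it would bound
    faces contradicting the maximum and minimum principles, and without such
    components [u] would have a strict local extremum there. *)

(** * The norm and the topology of the complex plane *)

(** Three obstacles shape the development. Differentiability only means that a derivative exists, so
    its behaviour near a point must be earned through Cauchy's formula; this gives strict
    differentiability, hence the monotonicity of [u]. The branches of the level set at a critical
    point are never described, so [Lambda] is not shown to be isolated from the other components;
    instead, components and quasi-components of a compact set agree, which provides small
    neighbourhoods of [Lambda] whose boundary misses the level set. The map to the circle is built
    from such a neighbourhood and takes the place of the Jordan curve theorem. Finally, an edge may
    end at critical points, where the two-sided picture breaks down: lying in the closure of a given
    face is locally constant along the edge without its end points, and passes to the end points by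
    closure. That [f] is nowhere locally constant on [Lambda] is proved separately: otherwise the
    points of [Lambda] where it is would form an open and closed subset of the plane, hence the
    whole plane. *)

Section ComplexNorm.
Variable R : realType.
Local Notation C := (Cplane R).
Local Notation N := (@normc R).
Implicit Types (x y z : C) (a b t : R).

Lemma normc_ge0 x : 0 <= N x.
Proof. by case: x => a b /=; rewrite sqrtr_ge0. Qed.

Lemma normrE_normc x : `|x| = ((N x)%:C)%C.
Proof. by case: x. Qed.

Lemma normc_le_add x y : N (x + y) <= N x + N y.
Proof.
have := ler_normD x y.
by rewrite !normrE_normc -rmorphD /= lecE /= => /andP[].
Qed.

Lemma normc_opp x : N (- x) = N x.
Proof. by have /(congr1 (@complex.Re R)) := normrN x; rewrite !normrE_normc. Qed.

Lemma normc_distC x y : N (x - y) = N (y - x).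
Proof. by rewrite -normc_opp opprB. Qed.

Lemma normc_dist_add x y z : N (x - z) <= N (x - y) + N (y - z).
Proof. by apply: le_trans (normc_le_add _ _); rewrite addrA subrK. Qed.

Lemma normc_eq0P x : (N x == 0) = (x == 0).
Proof. by apply/eqP/eqP => [/eq0_normc //|->]; rewrite normc0. Qed.

Lemma normc_gt0P x : (0 < N x) = (x != 0).
Proof. by rewrite lt_neqAle normc_ge0 andbT eq_sym normc_eq0P. Qed.

Lemma normc_real a : N (a%:C)%C = `|a|.
Proof. by rewrite /= expr0n /= addr0 sqrtr_sqr. Qed.

Lemma normc_exp x n : N (x ^+ n) = N x ^+ n.
Proof. by elim: n => [|n IH]; rewrite ?expr0 ?normc1 // !exprS normcM IH. Qed.

Lemma abs_Re_le x : `|complex.Re x| <= N x.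
Proof.
case: x => a b /=; rewrite -sqrtr_sqr ler_sqrt ?addr_ge0 ?sqr_ge0 //.
by rewrite lerDl sqr_ge0.
Qed.

Lemma abs_Im_le x : `|complex.Im x| <= N x.
Proof.
case: x => a b /=; rewrite -sqrtr_sqr ler_sqrt ?addr_ge0 ?sqr_ge0 //.
by rewrite lerDr sqr_ge0.
Qed.

Lemma normc_le_ReIm x : N x <= `|complex.Re x| + `|complex.Im x|.
Proof.
case: x => a b /=.
have <- : Num.sqrt ((`|a| + `|b|) ^+ 2) = `|a| + `|b|.
  by rewrite sqrtr_sqr ger0_norm ?addr_ge0.
rewrite ler_sqrt ?sqr_ge0 // sqrrD !real_normK ?num_real //.
by rewrite -addrA lerD2l lerDr mulrn_wge0 // mulr_ge0.
Qed.

Lemma normc_sub_le x y : N x - N y <= N (x - y).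
Proof. by rewrite lerBlDr (le_trans _ (normc_le_add _ _)) // subrK. Qed.

Lemma normc_dist_le x y : `|N x - N y| <= N (x - y).
Proof.
rewrite ler_norml normc_sub_le andbT.
by have := normc_sub_le y x; rewrite normc_distC; lra.
Qed.

(** Radii of balls in [Cplane R] are elements of [R[i]], whose order makes an element positive only
    if its imaginary part vanishes; real radii therefore suffice. *)
Lemma nbhs_normcP z (A : set C) :
  nbhs z A <-> exists2 d : R, 0 < d & forall w, N (w - z) < d -> A w.
Proof.
split=> [/nbhs_ballP[e /= e0 eA]|[d d0 dA]].
  case: e e0 eA => a b; rewrite ltcE /= => /andP[/eqP b0 a0] eA.
  exists a => // w wa; apply: eA; rewrite /ball /= distrC.
  by rewrite normrE_normc ltcE /= wa b0 eqxx.
apply/nbhs_ballP; exists (d%:C)%C; first by rewrite /= ltcE /= eqxx.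
move=> w; rewrite /ball /= distrC normrE_normc ltcE /= => /andP[_ ?].
exact: dA.
Qed.

Lemma openN_ball z (d : R) : open [set w : C | N (w - z) < d].
Proof.
rewrite openE => w /= wd; apply/nbhs_normcP.
exists (d - N (w - z)); first by rewrite subr_gt0.
by move=> v vw /=; have := normc_dist_add v w z; lra.
Qed.

Lemma nbhsN_ball z (d : R) : 0 < d -> nbhs z [set w : C | N (w - z) < d].
Proof. by move=> d0; apply/nbhs_normcP; exists d. Qed.

Lemma closedN_ball z (d : R) : closed [set w : C | N (w - z) <= d].
Proof.
rewrite -[X in closed X]setCK; apply: open_closedC.
rewrite openE => w /= /negP; rewrite -ltNge => wd; apply/nbhs_normcP.
exists (N (w - z) - d); first by rewrite subr_gt0.
move=> v vw /=; apply/negP; rewrite -ltNge.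
have := normc_dist_add w v z; rewrite (normc_distC w v); lra.
Qed.

Lemma continuous_normcP (T : topologicalType) (f : T -> C) (t : T) :
  {for t, continuous f} <->
  forall e : R, 0 < e -> \forall s \near t, N (f s - f t) < e.
Proof.
split=> [cf e e0|H].
  exact: (cf _ (nbhsN_ball (f t) e0)).
move=> A /nbhs_normcP[d d0 dA]; apply: filterS (H _ d0) => s /=.
exact: dA.
Qed.

Lemma continuous_absP (T : topologicalType) (f : T -> R) (t : T) :
  {for t, continuous f} <->
  forall e : R, 0 < e -> \forall s \near t, `|f s - f t| < e.
Proof.
split=> [cf e e0|H].
  by move/cvgrPdist_lt : cf => /(_ _ e0); apply: filterS => s; rewrite distrC.
by apply/cvgrPdist_lt => e e0; apply: filterS (H _ e0) => s; rewrite distrC.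
Qed.

Lemma lipschitz_continuous (f : C -> R) :
  (forall z w, `|f w - f z| <= N (w - z)) -> continuous f.
Proof.
move=> Lf z; apply/continuous_absP => e e0; apply/nbhs_normcP; exists e => // w.
exact: le_lt_trans.
Qed.

Lemma normc_continuous : continuous (N : C -> R).
Proof. by apply: lipschitz_continuous => z w; exact: normc_dist_le. Qed.

Lemma Re_continuous : continuous (@complex.Re R : C -> R).
Proof.
by apply: lipschitz_continuous => z w; rewrite -raddfB; exact: abs_Re_le.
Qed.

Lemma Im_continuous : continuous (@complex.Im R : C -> R).
Proof.
by apply: lipschitz_continuous => z w; rewrite -raddfB; exact: abs_Im_le.
Qed.

Section PointwiseAlgebra.
Variables (T : topologicalType) (f g : T -> C) (t : T).
Hypotheses (cf : {for t, continuous f}) (cg : {for t, continuous g}).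

Lemma continuousC_add : {for t, continuous (fun s => f s + g s)}.
Proof. exact: (@continuousD _ _ _ f g t cf cg). Qed.

Lemma continuousC_sub : {for t, continuous (fun s => f s - g s)}.
Proof. exact: (@continuousB _ _ _ f g t cf cg). Qed.

Lemma continuousC_mul : {for t, continuous (fun s => f s * g s)}.
Proof. exact: (@continuousM _ _ f g t cf cg). Qed.

End PointwiseAlgebra.

Lemma continuousC_cst (T : topologicalType) (k : C) : continuous (fun _ : T => k).
Proof. by move=> t; exact: cvg_cst. Qed.

Lemma continuousC_affine (a b c : C) : continuous (fun z : C => a + b * (z - c)).
Proof.
move=> z; apply/continuous_normcP => e e0.
have b0 : 0 < N b + 1 by have := normc_ge0 b; lra.
apply/nbhs_normcP; exists (e / (N b + 1)) => [|w wz]; first by rewrite divr_gt0.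
have -> : a + b * (w - c) - (a + b * (z - c)) = b * (w - z) by ring.
rewrite normcM; apply: le_lt_trans (_ : (N b + 1) * N (w - z) < e).
  by rewrite ler_wpM2r ?normc_ge0 // lerDl.
by rewrite mulrC -ltr_pdivlMr.
Qed.

Lemma continuous_ReIm (T : topologicalType) (f g : T -> R) (t : T) :
  {for t, continuous f} -> {for t, continuous g} ->
  {for t, continuous (fun s => (f s +i* g s)%C : C)}.
Proof.
move=> /continuous_absP cf /continuous_absP cg; apply/continuous_normcP => e e0.
have e20 : 0 < e / 2 by lra.
apply: filterS2 (cf _ e20) (cg _ e20) => s fs gs.
apply: le_lt_trans (normc_le_ReIm _) _; rewrite [e]splitr.
exact: ltrD.
Qed.

End ComplexNorm.

(** * Derivatives of complex functions and of curves *)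

(** Multiplying the difference quotient by [h] turns the punctured limit into an estimate that also
    holds, trivially, at [h = 0]. *)
Lemma is_derive_nearP (K : numFieldType) (f : K^o -> K^o) (x d : K^o) :
  is_derive x 1 f d <->
  forall e : K, 0 < e -> \forall h \near (0 : K^o),
    `|f (x + h) - f x - d * h| <= e * `|h|.
Proof.
have aux (h : K^o) : h != 0 ->
    `|d - h^-1 *: ((f \o shift x) (h *: 1) - f x)| * `|h|
    = `|f (x + h) - f x - d * h|.
  move=> h0; rewrite -normrM mulrBl /=.
  have -> : h%:A = h :> K^o by rewrite /GRing.scale /= mulr1.
  rewrite /GRing.scale /= mulrAC mulVf // mul1r [h + x]addrC distrC.
  by congr `|_|.
split=> [[df dE] e e0|H].
- have cv : h^-1 *: ((f \o shift x) (h *: 1) - f x) @[h --> (0:K^o)^'] --> d.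
    by rewrite -dE; exact: df.
  have H : \forall h \near (0 : K^o), h != 0 ->
    `|d - h^-1 *: ((f \o shift x) (h *: 1) - f x)| <= e.
    by move/cvgrPdist_le : cv; apply.
  apply: filterS H => h hh; have [->|h0] := eqVneq h 0.
    by rewrite addr0 subrr mulr0 subr0 normr0 mulr0.
  by rewrite -aux // ler_pM2r ?normr_gt0 // hh.
- have cv : h^-1 *: ((f \o shift x) (h *: 1) - f x) @[h --> (0:K^o)^'] --> d.
    apply/cvgrPdist_le => e e0.
    suff: \forall h \near (0 : K^o), h != 0 ->
      `|d - h^-1 *: ((f \o shift x) (h *: 1) - f x)| <= e by [].
    apply: filterS (H _ e0) => h hh h0.
    by rewrite -(@ler_pM2r _ `|h|) ?normr_gt0 // aux.
  apply: DeriveDef; first by apply/cvg_ex; exists d.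
  by apply: cvg_lim cv; exact: norm_hausdorff.
Qed.

Section Derivative.
Variable R : realType.
Local Notation C := (Cplane R).
Local Notation N := (@normc R).

(* Covers complex derivatives ([j = id]) and derivatives of curves
   ([j = real_complex R]) at once. *)
Definition has_deriv (K : zmodType) (j : K -> C) (p : K -> C) (t : K) (d : C) :=
  forall e : R, 0 < e -> exists2 r : R, 0 < r &
    forall h, N (j h) < r -> N (p (t + h) - p t - d * j h) <= e * N (j h).

Section Rules.
Variables (K : zmodType) (j : K -> C).
Implicit Types (p q : K -> C) (t : K) (d : C).

Lemma has_deriv_ext p q t d : p =1 q -> has_deriv j p t d -> has_deriv j q t d.
Proof.
move=> pq H e e0; have [r r0 rP] := H e e0; exists r => // h /rP.
by rewrite !pq.
Qed.

Lemma has_deriv_near p q t d (r0 : R) : 0 < r0 ->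
  (forall h, N (j h) < r0 -> p (t + h) = q (t + h)) -> p t = q t ->
  has_deriv j p t d -> has_deriv j q t d.
Proof.
move=> r00 pq pqt H e e0; have [r rr0 rP] := H e e0.
exists (Num.min r r0) => [|h]; first by rewrite lt_min rr0.
by rewrite lt_min => /andP[/rP + /pq <-]; rewrite pqt.
Qed.

Lemma has_deriv_cst (c : C) t : has_deriv j (fun=> c) t 0.
Proof.
move=> e e0; exists 1 => // h _.
by rewrite subrr mul0r subr0 normc0 mulr_ge0 ?normc_ge0 // ltW.
Qed.

Lemma has_deriv_id t : (forall h, j (t + h) = j t + j h) -> has_deriv j j t 1.
Proof.
move=> jD e e0; exists 1 => // h _; rewrite jD.
have -> : j t + j h - j t - 1 * j h = 0 by ring.
by rewrite normc0 mulr_ge0 ?normc_ge0 // ltW.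
Qed.

Lemma has_derivD p q t d d' : has_deriv j p t d -> has_deriv j q t d' ->
  has_deriv j (fun s => p s + q s) t (d + d').
Proof.
move=> Hp Hq e e0; have e20 : 0 < e / 2 by lra.
have [r r0 rP] := Hp _ e20; have [r' r'0 rP'] := Hq _ e20.
exists (Num.min r r') => [|h]; first by rewrite lt_min r0.
rewrite lt_min => /andP[/rP h1 /rP' h2].
have -> : p (t + h) + q (t + h) - (p t + q t) - (d + d') * j h =
  (p (t + h) - p t - d * j h) + (q (t + h) - q t - d' * j h) by ring.
apply: le_trans (normc_le_add _ _) _; lra.
Qed.

Lemma has_deriv_bound p t d : has_deriv j p t d -> exists2 r : R, 0 < r &
  forall h, N (j h) < r -> N (p (t + h) - p t) <= (N d + 1) * N (j h).
Proof.
move=> /(_ 1 ltr01)[r r0 rP]; exists r => // h /rP {rP}H.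
have := normc_le_add (p (t + h) - p t - d * j h) (d * j h).
rewrite subrK normcM; lra.
Qed.

Lemma has_derivM p q t d d' : has_deriv j p t d -> has_deriv j q t d' ->
  has_deriv j (fun s => p s * q s) t (d * q t + p t * d').
Proof.
move=> Hp Hq e e0.
have [r1 r10 B1] := has_deriv_bound Hp; have [r2 r20 B2] := has_deriv_bound Hq.
(* Its summands match the three terms of the remainder of a product, each at most [e / A * n] times
   its summand; the final [1] keeps [A] positive. *)
set A := N (p t) + N (q t) + (N d + 1) * (N d' + 1) + 1.
have A0 : 0 < A.
  by rewrite /A ltr_wpDl // ?addr_ge0 ?mulr_ge0 ?addr_ge0 ?normc_ge0.
have eA0 : 0 < e / A by rewrite divr_gt0.
have [r r0 rP] := Hp _ eA0; have [r' r'0 rP'] := Hq _ eA0.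
exists (Num.min (Num.min r r') (Num.min (Num.min r1 r2) (e / A))) => [|h].
  by rewrite !lt_min r0 r'0 r10 r20 eA0.
rewrite !lt_min -!andbA => /and5P[/rP H1 /rP' H2 /B1 b1 /B2 b2 he].
have -> : p (t + h) * q (t + h) - p t * q t - (d * q t + p t * d') * j h =
  (p (t + h) - p t - d * j h) * q t + p t * (q (t + h) - q t - d' * j h) +
  (p (t + h) - p t) * (q (t + h) - q t) by ring.
apply: le_trans (normc_le_add _ _) _.
apply: le_trans (lerD (normc_le_add _ _) (lexx _)) _.
rewrite !normcM; set n := N (j h) in H1 H2 b1 b2 he *.
have n0 : 0 <= n by exact: normc_ge0.
have k1 := ler_wpM2r (normc_ge0 (q t)) H1.
have k2 := ler_wpM2l (normc_ge0 (p t)) H2.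
have k3 := ler_pM (normc_ge0 _) (normc_ge0 _) b1 b2.
apply: le_trans (lerD (lerD k1 k2) k3) _.
have k4 : (N d + 1) * n * ((N d' + 1) * n) <= (e / A) * n * ((N d + 1) * (N d' + 1)).
  rewrite [leLHS](_ : _ = n * n * ((N d + 1) * (N d' + 1))); last by ring.
  apply: ler_wpM2r; first by rewrite mulr_ge0 // addr_ge0 ?normc_ge0.
  by rewrite ler_wpM2r // ltW.
apply: le_trans (lerD (lexx _) k4) _.
have -> : e / A * n * N (q t) + N (p t) * (e / A * n) +
   e / A * n * ((N d + 1) * (N d' + 1)) = (e / A * n) * (A - 1) by rewrite /A; ring.
have -> : e * n = (e / A * n) * A by field; rewrite gt_eqF.
rewrite ler_wpM2l //; last lra.
by rewrite mulr_ge0 // ltW.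
Qed.

Lemma has_deriv_comp (F : C -> C) p t d d' :
  has_deriv j p t d -> has_deriv id F (p t) d' ->
  has_deriv j (F \o p) t (d' * d).
Proof.
move=> Hp HF e e0; have [r1 r10 B1] := has_deriv_bound Hp.
set A := N d' + (N d + 1) + 1.
have d0 : 0 < N d + 1 by have := normc_ge0 d; lra.
have A0 : 0 < A by rewrite /A; have := normc_ge0 d; have := normc_ge0 d'; lra.
have eA0 : 0 < e / A by rewrite divr_gt0.
have [r r0 rP] := Hp _ eA0; have [r' r'0 rP'] := HF _ eA0.
exists (Num.min (Num.min r r1) (r' / (N d + 1))) => [|h].
  by rewrite !lt_min r0 r10 divr_gt0.
rewrite !lt_min -!andbA => /and3P[/rP H1 /B1 b1 hr].
have kr : N (p (t + h) - p t) < r'.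
  by apply: le_lt_trans b1 _; rewrite mulrC -ltr_pdivlMr.
have /= := rP' _ kr; rewrite [p t + _]addrC subrK => H2.
have -> : F (p (t + h)) - F (p t) - d' * d * j h =
  (F (p (t + h)) - F (p t) - d' * (p (t + h) - p t)) +
  d' * (p (t + h) - p t - d * j h) by ring.
apply: le_trans (normc_le_add _ _) _; rewrite normcM.
set n := N (j h) in H1 b1 hr *.
have n0 : 0 <= n by exact: normc_ge0.
have k2 := ler_wpM2l (normc_ge0 d') H1.
have k1 := le_trans H2 (ler_wpM2l (ltW eA0) b1).
apply: le_trans (lerD k1 k2) _.
have -> : e / A * ((N d + 1) * n) + N d' * (e / A * n) = (e / A * n) * (A - 1).
  by rewrite /A; ring.
have -> : e * n = (e / A * n) * A by field; rewrite gt_eqF.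
rewrite ler_wpM2l //; last lra.
by rewrite mulr_ge0 // ltW.
Qed.

End Rules.

Lemma has_derivZ (K : zmodType) (j p : K -> C) t d (c : C) :
  has_deriv j p t d -> has_deriv j (fun s => c * p s) t (c * d).
Proof.
move=> H; have := has_derivM (has_deriv_cst j c t) H.
by rewrite mul0r add0r.
Qed.

Lemma has_derivB (K : zmodType) (j p q : K -> C) t d d' :
  has_deriv j p t d -> has_deriv j q t d' ->
  has_deriv j (fun s => p s - q s) t (d - d').
Proof.
move=> Hp Hq; rewrite -[- d']mulN1r.
apply: has_deriv_ext (has_derivD Hp (has_derivZ (-1) Hq)) => s.
by rewrite mulN1r.
Qed.

Lemma has_derivX (K : zmodType) (j p : K -> C) t d n :
  has_deriv j p t d ->
  has_deriv j (fun s => p s ^+ n) t (n%:R * p t ^+ n.-1 * d).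
Proof.
move=> Hp; elim: n => [|n IH].
  by rewrite !mul0r; exact: (has_deriv_ext _ (has_deriv_cst j 1 t)).
have := has_derivM Hp IH; move/has_deriv_ext => /(_ (fun s => p s ^+ n.+1)).
have -> : d * p t ^+ n + p t * (n%:R * p t ^+ n.-1 * d) =
          n.+1%:R * p t ^+ n.+1.-1 * d.
  by case: n {IH} => [|n] /=; rewrite ?exprS -?natr1; ring.
by apply => s; rewrite exprS.
Qed.

Lemma has_deriv_inv (z : C) : z != 0 -> has_deriv id (fun w => w^-1) z (- z^-2).
Proof.
move=> z0 e e0; have nz : 0 < N z by rewrite normc_gt0P.
exists (Num.min (N z / 2) (e * N z ^+ 3 / 2)) => [|h].
  by rewrite lt_min !divr_gt0 // mulr_gt0 // exprn_gt0.
rewrite lt_min => /andP[h1 h2].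
have zh : N z / 2 <= N (z + h).
  by have := normc_sub_le z (- h); rewrite normc_opp opprK; lra.
have zh0 : z + h != 0 by rewrite -normc_gt0P; lra.
have -> : (z + h)^-1 - z^-1 - - z^-2 * h = h ^+ 2 / (z ^+ 2 * (z + h)).
  by field; rewrite ?z0 ?zh0.
rewrite normcM normc_exp normcV normcM normc_exp.
rewrite ler_pdivrMr ?mulr_gt0 ?exprn_gt0 ?normc_gt0P //.
set n := N h in h1 h2 *; have n0 : 0 <= n by exact: normc_ge0.
rewrite expr2 [leRHS](_ : _ = n * (e * (N z ^+ 2 * N (z + h)))); last by ring.
rewrite ler_wpM2l //; apply: le_trans (ltW h2) _.
have -> : e * N z ^+ 3 / 2 = e * (N z ^+ 2 * (N z / 2)) by field.
by rewrite !ler_pM2l ?exprn_gt0.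
Qed.

Lemma is_derive_has_deriv (f : C -> C) (z d : C) :
  is_derive z 1 f d <-> has_deriv id f z d.
Proof.
split=> [/is_derive_nearP H e e0|H].
- have := H (e%:C)%C; rewrite ltcE /= eqxx => /(_ e0) /nbhs_normcP[r r0 rP].
  exists r => // h hr; have := rP h; rewrite subr0 => /(_ hr).
  by rewrite !normrE_normc -rmorphM /= lecE /= => /andP[].
- apply/is_derive_nearP => -[e e'].
  rewrite ltcE /= => /andP[/eqP-> e0].
  have [r r0 rP] := H e e0; apply/nbhs_normcP; exists r => // h.
  rewrite subr0 => /rP hP.
  rewrite !normrE_normc.
  by rewrite -[(e +i* 0)%C]/(e%:C)%C -rmorphM /= lecE /= eqxx hP.
Qed.

Lemma has_deriv_continuous (f : C -> C) (z d : C) :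
  has_deriv id f z d -> {for z, continuous f}.
Proof.
move=> /has_deriv_bound[r r0 rP]; apply/continuous_normcP => e e0.
have d0 : 0 < N d + 1 by have := normc_ge0 d; lra.
apply/nbhs_normcP; exists (Num.min r (e / (N d + 1))).
  by rewrite lt_min r0 divr_gt0.
move=> w; rewrite lt_min => /andP[/rP /= H h2].
move: H; rewrite [z + _]addrC subrK => H; apply: le_lt_trans H _.
by rewrite mulrC -ltr_pdivlMr.
Qed.

Lemma has_deriv_unique (f : C -> C) (z d d' : C) :
  has_deriv id f z d -> has_deriv id f z d' -> d = d'.
Proof.
by move=> /is_derive_has_deriv[_ <-] /is_derive_has_deriv[_ <-].
Qed.

End Derivative.

(** * Differentiable curves and the mean value inequality *)

Section Curves.
Variable R : realType.
Local Notation C := (Cplane R).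
Local Notation N := (@normc R).

Definition curve_deriv (p : R -> C) (t : R) (d : C) :=
  has_deriv (fun h : R => (h%:C)%C : C) p t d.

Lemma curve_derivP (p : R -> C) (t : R) (d : C) : curve_deriv p t d <->
  forall e : R, 0 < e -> exists2 r : R, 0 < r &
    forall h, `|h| < r -> N (p (t + h) - p t - d * (h%:C)%C) <= e * `|h|.
Proof.
by split=> H e /H[r r0 rP]; exists r => // h;
  have := rP h; rewrite -normc_real.
Qed.

Lemma is_derive_curve (p q : R -> R) (t d d' : R) :
  is_derive t 1 p d -> is_derive t 1 q d' ->
  curve_deriv (fun s => (p s +i* q s)%C) t (d +i* d')%C.
Proof.
move=> /is_derive_nearP Hp /is_derive_nearP Hq; apply/curve_derivP => e e0.
have e20 : 0 < e / 2 by lra.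
have /nbhs_ballP[r r0 rP] : nbhs (0 : R) [set h |
    `|p (t + h) - p t - d * h| <= e / 2 * `|h| /\
    `|q (t + h) - q t - d' * h| <= e / 2 * `|h|].
  by apply: filterS2 (Hp _ e20) (Hq _ e20) => h.
exists r; [exact: r0|move=> h hr].
have [|h1 h2] := rP h; first by rewrite /ball /= sub0r normrN.
apply: le_trans (normc_le_ReIm _) _.
have -> : complex.Re ((p (t + h) +i* q (t + h)) - (p t +i* q t)
    - (d +i* d') * h%:C)%C = p (t + h) - p t - d * h.
  by rewrite /= mulr0 subr0.
have -> : complex.Im ((p (t + h) +i* q (t + h)) - (p t +i* q t)
    - (d +i* d') * h%:C)%C = q (t + h) - q t - d' * h.
  by rewrite /= mulr0 add0r.
lra.
Qed.

Lemma curve_is_derive (p : R -> C) (t : R) (d : C) :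
  curve_deriv p t d -> is_derive t 1 (fun s => complex.Re (p s)) (complex.Re d).
Proof.
move=> /curve_derivP H; apply/is_derive_nearP => e e0.
have [r r0 rP] := H e e0.
apply/nbhs_ballP; exists r => // h; rewrite /ball /= sub0r normrN => hr.
have := rP h hr; apply: le_trans.
have := abs_Re_le (p (t + h) - p t - d * (h%:C)%C).
suff -> : complex.Re (p (t + h) - p t - d * (h%:C)%C) =
   complex.Re (p (t + h)) - complex.Re (p t) - complex.Re d * h by [].
by case: (p (t + h)) (p t) (d) => [? ?] [? ?] [? ?] /=; rewrite mulr0 subr0.
Qed.

(** The mean value theorem holds for real functions only, so it is applied to the projection of the
    curve on the direction of its chord [p b - p a]. *)
Lemma curve_mean_value (p p' : R -> C) (a b M : R) : a <= b ->
  (forall t, a <= t <= b -> curve_deriv p t (p' t)) ->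
  (forall t, a <= t <= b -> N (p' t) <= M) -> N (p b - p a) <= M * (b - a).
Proof.
move=> ab dp pM; set v : C := p b - p a.
have dq t : a <= t <= b -> is_derive t 1 (fun s => complex.Re (conjc v * p s))
    (complex.Re (conjc v * p' t)).
  move=> /dp H; exact: (curve_is_derive (has_derivZ (conjc v) H)).
have vv : complex.Re (conjc v * v) = N v ^+ 2.
  case: (v) => x y /=; rewrite sqr_sqrtr ?addr_ge0 ?sqr_ge0 //; ring.
have [c + E] : exists2 c, c \in `[a, b]%R &
    complex.Re (conjc v * p b) - complex.Re (conjc v * p a) =
    complex.Re (conjc v * p' c) * (b - a).
  apply: (MVT_segment (f := fun s => complex.Re (conjc v * p s))
           (df := fun s => complex.Re (conjc v * p' s)) ab) => [t|].
    by rewrite in_itv /= => /andP[? ?]; apply: dq; rewrite !ltW.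
  apply: derivable_within_continuous => t; rewrite in_itv /= => /dq[+ _].
  by [].
rewrite in_itv /= => cab.
have E2 : N v ^+ 2 <= N v * (M * (b - a)).
  rewrite -vv {2}/v mulrBr raddfB E mulrA ler_wpM2r ?subr_ge0 //.
  apply: le_trans (ler_norm _) _; apply: le_trans (abs_Re_le _) _.
  rewrite normcM.
  have -> : N (conjc v) = N v by case: (v) => x y /=; rewrite sqrrN.
  by rewrite ler_wpM2l ?normc_ge0 ?pM.
have [v0|v0] := eqVneq v 0.
  rewrite v0 normc0 mulr_ge0 ?subr_ge0 //.
  by apply: le_trans (normc_ge0 _) (pM c cab).
by move: E2; rewrite expr2 ler_pM2l // normc_gt0P.
Qed.

Lemma curve_mean_value_abs (p p' : R -> C) (a b M : R) :
  (forall t, Num.min a b <= t <= Num.max a b -> curve_deriv p t (p' t)) ->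
  (forall t, Num.min a b <= t <= Num.max a b -> N (p' t) <= M) ->
  N (p b - p a) <= M * `|b - a|.
Proof.
have [ab|/ltW ba] := leP a b => dp pM.
  by rewrite ger0_norm ?subr_ge0 //; exact: curve_mean_value dp pM.
rewrite normc_distC distrC ger0_norm ?subr_ge0 //.
exact: curve_mean_value ba dp pM.
Qed.

Lemma curve_deriv0_eq (p : R -> C) (a b : R) :
  (forall t, curve_deriv p t 0) -> p a = p b.
Proof.
move=> dp; apply/eqP; rewrite -subr_eq0 -normc_eq0P eq_le normc_ge0 andbT.
rewrite normc_distC -(mul0r `|b - a|).
by apply: (@curve_mean_value_abs p (fun=> 0)) => // t; rewrite normc0.
Qed.

End Curves.

(** * Integrals of curves *)

Section Integral.
Variable R : realType.
Local Notation C := (Cplane R).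
Local Notation N := (@normc R).

Lemma antiderivative_right (q : R -> R) : continuous q ->
  exists Q : R -> R, forall x : R, -1 < x -> is_derive x (1 : R) Q (q x).
Proof.
move=> cq.
exists (fun x => \int[lebesgue_measure]_(t in `[-1, x]) q t)%R => x x1.
have xu : x < x + 1 by rewrite ltrDl.
have iq : lebesgue_measure.-integrable `[-1, x + 1] (EFin \o q).
  apply: continuous_compact_integrable; first exact: segment_compact.
  by apply: continuous_subspaceT.
have [dF FE] := continuous_FTC1_closed xu iq x1 (cq x).
by apply: DeriveDef; [exact: dF|rewrite -derive1E; exact: FE].
Qed.

(** The integral with lower limit [-1] is differentiated only to the right of that limit. The left
    half comes from the reflected function; both halves are valid around [0], where they are glued
    after subtracting their values at [0]. *)
Lemma antiderivative_real (q : R -> R) : continuous q ->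
  exists Q : R -> R, forall x : R, is_derive x (1 : R) Q (q x).
Proof.
move=> cq; have [A dA] := antiderivative_right cq.
have cqn : continuous (fun x => q (- x)).
  by move=> x; apply: (continuous_comp (@oppr_continuous _ _ x) (cq (- x))).
have [B dB] := antiderivative_right cqn.
have dA' x : -1 < x -> forall e, 0 < e -> \forall h \near (0 : R),
    `|A (x + h) - A x - q x * h| <= e * `|h|.
  by move=> /dA /is_derive_nearP.
have dB' x : x < 1 -> forall e, 0 < e -> \forall h \near (0 : R),
    `|- B (- (x + h)) - - B (- x) - q x * h| <= e * `|h|.
  move=> x1 e e0; have x1' : -1 < - x by rewrite ltrN2.
  have /is_derive_nearP /(_ e e0) H := dB _ x1'.
  have /nbhs_ballP[r r0 rP] : nbhs (0 : R) [set h |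
      `|B (- x + h) - B (- x) - q (- - x) * h| <= e * `|h|] by exact: H.
  apply/nbhs_ballP; exists r => // h; rewrite /ball /= sub0r => hr.
  have := rP (- h); rewrite /ball /= sub0r normrN => /(_ hr).
  rewrite normrN opprK opprD => H1.
  have -> : - B (- x - h) - - B (- x) - q x * h =
    - (B (- x - h) - B (- x) - q x * - h) by ring.
  by rewrite normrN.
pose Q (x : R) := if 0 <= x then A x - A 0 else - B (- x) - - B (- 0).
exists Q => x; apply/is_derive_nearP => e e0.
have [x0|x0|x0] := ltgtP x 0.
- have x1 : x < 1 by lra.
  have : \forall h \near (0 : R), x + h < 0.
    have mx0 : 0 < - x by rewrite oppr_gt0.
    apply/nbhs_ballP; exists (- x) => // h.
    by rewrite /ball /= sub0r normrN ltr_norml => /andP[_]; lra.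
  apply: filterS2 (dB' _ x1 _ e0) => h hB xh.
  rewrite /Q [0 <= x]leNgt [0 <= x + h]leNgt x0 xh /=; apply: le_trans _ hB;
    rewrite le_eqVlt; apply/orP; left; apply/eqP; congr `|_|; ring.
- have x1 : -1 < x by lra.
  have : \forall h \near (0 : R), 0 < x + h.
    apply/nbhs_ballP; exists x => // h.
    by rewrite /ball /= sub0r normrN ltr_norml => /andP[]; lra.
  apply: filterS2 (dA' _ x1 _ e0) => h hA xh.
  rewrite /Q (ltW x0) (ltW xh); apply: le_trans _ hA;
    rewrite le_eqVlt; apply/orP; left; apply/eqP; congr `|_|; ring.
- rewrite x0; have a1 : (-1 : R) < 0 by lra. have a2 : (0 : R) < 1 by lra.
  apply: filterS2 (dA' _ a1 _ e0) (dB' _ a2 _ e0) => h hA hB.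
  rewrite /Q lexx; case: ifP => _.
    apply: le_trans _ hA; rewrite le_eqVlt; apply/orP; left; apply/eqP; congr `|_|; ring.
  apply: le_trans _ hB; rewrite le_eqVlt; apply/orP; left; apply/eqP; congr `|_|; ring.
Qed.

Lemma antiderivative_curve (p : R -> C) : continuous p ->
  exists P : R -> C, forall t, curve_deriv P t (p t).
Proof.
move=> cp.
have [A dA] : exists A : R -> R, forall x : R, is_derive x (1 : R) A (complex.Re (p x)).
  apply: antiderivative_real => t.
  exact: (continuous_comp (cp t) (@Re_continuous R (p t))).
have [B dB] : exists B : R -> R, forall x : R, is_derive x (1 : R) B (complex.Im (p x)).
  apply: antiderivative_real => t.
  exact: (continuous_comp (cp t) (@Im_continuous R (p t))).
exists (fun t => (A t +i* B t)%C) => t.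
have -> : p t = (complex.Re (p t) +i* complex.Im (p t))%C by case: (p t).
exact: is_derive_curve.
Qed.

(** Choosing an antiderivative on the whole line reduces linearity and bounds for [cint] to rules of
    differentiation. The default is reached only if there is no antiderivative; this is why later
    integrands are kept continuous on all of [R]. *)
Definition primitive (p : R -> C) : R -> C :=
  xget (fun=> 0) [set P | forall t, curve_deriv P t (p t)].

Definition cint (p : R -> C) (a b : R) : C := primitive p b - primitive p a.

Lemma primitiveP (p : R -> C) : continuous p ->
  forall t, curve_deriv (primitive p) t (p t).
Proof.
move=> cp; rewrite /primitive; case: xgetP => [P -> //|nP].
by have [P PP] := antiderivative_curve cp; case: (nP P).
Qed.

Lemma cint_FTC (p P : R -> C) (a b : R) : continuous p ->
  (forall t, curve_deriv P t (p t)) -> cint p a b = P b - P a.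
Proof.
move=> cp dP; apply/eqP; rewrite -subr_eq0; apply/eqP.
have E t : curve_deriv (fun s => primitive p s - P s) t 0.
  by rewrite -(subrr (p t)); exact: has_derivB (primitiveP cp t) (dP t).
have /= := curve_deriv0_eq b a E; rewrite /cint => H.
have -> : primitive p b - primitive p a - (P b - P a) =
  (primitive p b - P b) - (primitive p a - P a) by ring.
by rewrite H subrr.
Qed.

Lemma cint_chasles (p : R -> C) a b c : cint p a b + cint p b c = cint p a c.
Proof. by rewrite /cint; ring. Qed.

Lemma cint_refl (p : R -> C) a : cint p a a = 0.
Proof. by rewrite /cint subrr. Qed.

Lemma cintD (p q : R -> C) a b : continuous p -> continuous q ->
  cint (fun t => p t + q t) a b = cint p a b + cint q a b.
Proof.
move=> cp cq; rewrite (@cint_FTC _ (fun t => primitive p t + primitive q t)).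
- by rewrite /cint; ring.
- by move=> t; apply: continuousD; [exact: cp|exact: cq].
- by move=> t; apply: has_derivD; exact: primitiveP.
Qed.

Lemma cintZ (p : R -> C) (k : C) a b : continuous p ->
  cint (fun t => k * p t) a b = k * cint p a b.
Proof.
move=> cp; rewrite (@cint_FTC _ (fun t => k * primitive p t)).
- by rewrite /cint; ring.
- by move=> t; apply: continuousM; [exact: cvg_cst|exact: cp].
- by move=> t; apply: has_derivZ; exact: primitiveP.
Qed.

Lemma cintB (p q : R -> C) a b : continuous p -> continuous q ->
  cint (fun t => p t - q t) a b = cint p a b - cint q a b.
Proof.
move=> cp cq; rewrite (@cint_FTC _ (fun t => primitive p t - primitive q t)).
- by rewrite /cint; ring.
- by move=> t; apply: continuousB; [exact: cp|exact: cq].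
- by move=> t; apply: has_derivB; exact: primitiveP.
Qed.

Lemma cint_cst (k : C) a b : cint (fun=> k) a b = k * ((b - a)%:C)%C.
Proof.
rewrite (@cint_FTC _ (fun t => k * (t%:C)%C)).
- by rewrite -mulrBr rmorphB.
- by move=> t; exact: cvg_cst.
- move=> t; rewrite -[X in curve_deriv _ _ X]mulr1; apply: has_derivZ.
  by apply: has_deriv_id => h; rewrite rmorphD.
Qed.

Lemma cint_bound (p : R -> C) a b M : continuous p ->
  (forall t, Num.min a b <= t <= Num.max a b -> N (p t) <= M) ->
  N (cint p a b) <= M * `|b - a|.
Proof.
move=> cp pM; apply: (curve_mean_value_abs (p' := p)) => // t _.
exact: primitiveP.
Qed.

End Integral.

(** * Goursat's lemma *)

Section Goursat.
Variable R : realType.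
Local Notation C := (Cplane R).
Local Notation N := (@normc R).

(** The end points come in either order, since rectangles are later measured from a corner that may
    lie on any side. *)
Definition between (a b t : R) := Num.min a b <= t <= Num.max a b.

Lemma between_dist a b t u : between a b t -> between a b u ->
  `|t - u| <= `|b - a|.
Proof.
rewrite /between /Num.min /Num.max ler_norml.
case: ltP => ab; have := ler_norm (b - a); have := ler_norm (a - b);
  rewrite (distrC a b) => ? ? /andP[? ?] /andP[? ?]; apply/andP; split; lra.
Qed.

Lemma between_affine (x w a b c : R) : a <= c <= b ->
  between (x + w * a) (x + w * b) (x + w * c).
Proof.
move=> /andP[ac cb]; rewrite /between ge_min le_max !lerD2l.
have [w0|/ltW w0] := leP 0 w.
  by rewrite (ler_wpM2l w0 ac) (ler_wpM2l w0 cb) orbT.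
by rewrite (ler_wnM2l w0 ac) (ler_wnM2l w0 cb) orbT.
Qed.

Lemma between_l a b : between a b a.
Proof. by rewrite /between ge_min le_max lexx. Qed.

Lemma between_r a b : between a b b.
Proof. by rewrite /between ge_min le_max lexx !orbT. Qed.

Lemma exists_expn_lt (d : R) : 0 < d -> exists n, (2^-1) ^+ n < d.
Proof.
move=> d0; exists (Num.bound d^-1).
rewrite exprVn invf_plt ?posrE ?exprn_gt0 //.
apply: lt_le_trans (archi_boundP _) _; first by rewrite invr_ge0 ltW.
by rewrite -natrX ler_nat ltnW // ltn_expl.
Qed.

(** Nested squares: if [P 0 0 1] failed, one quarter would fail at each stage, and the failing
    squares would shrink to a point around which [P] holds. *)
Lemma square_bisection (P : R -> R -> R -> Prop) :
  (forall a b s, P a b (s / 2) -> P (a + s / 2) b (s / 2) ->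
     P a (b + s / 2) (s / 2) -> P (a + s / 2) (b + s / 2) (s / 2) ->
     P a b s) ->
  (forall c d, 0 <= c <= 1 -> 0 <= d <= 1 -> exists2 r : R, 0 < r &
     forall a b s, 0 < s < r -> a <= c <= a + s -> b <= d <= b + s -> P a b s) ->
  P 0 0 1.
Proof.
move=> Psplit Ploc; apply: contrapT => nP.
pose s n : R := (2^-1) ^+ n.
have s0 n : 0 < s n by rewrite exprn_gt0.
have sS n : s n.+1 = s n / 2 by rewrite /s exprSr.
pose child (x : R * R) (n : nat) (y : R * R) :=
  [/\ ~ P y.1 y.2 (s n.+1), x.1 <= y.1, y.1 + s n.+1 <= x.1 + s n,
   x.2 <= y.2 & y.2 + s n.+1 <= x.2 + s n].
have childP x n : ~ P x.1 x.2 (s n) -> exists y, child x n y.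
  move=> nPx; apply: contrapT => /forallNP H; apply: nPx.
  have sn := s0 n.
  by apply: Psplit; apply: contrapT => nQ;
    [apply: (H (x.1, x.2))|apply: (H (x.1 + s n / 2, x.2))
    |apply: (H (x.1, x.2 + s n / 2))|apply: (H (x.1 + s n / 2, x.2 + s n / 2))];
    rewrite /child /= sS; split => //; lra.
pose next x n := xget x [set y | child x n y].
pose st := fix st n := if n is m.+1 then next (st m) m else (0, 0) : R * R.
have stP n : ~ P (st n).1 (st n).2 (s n).
  elim: n => [|n IH]; first by rewrite /s expr0.
  rewrite /= /next; case: xgetP => [y -> []//|H].
  by have [y /H] := childP _ _ IH.
have stC n : child (st n) n (st n.+1).
  rewrite /= /next; case: xgetP => [y -> //|H].
  by have [y /H] := childP _ _ (stP n).
have mono n k : [/\ (st n).1 <= (st (n + k)%N).1,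
    (st (n + k)%N).1 + s (n + k)%N <= (st n).1 + s n,
    (st n).2 <= (st (n + k)%N).2 &
    (st (n + k)%N).2 + s (n + k)%N <= (st n).2 + s n].
  elim: k => [|k [h1 h2 h3 h4]]; first by rewrite addn0.
  have [_ g1 g2 g3 g4] := stC (n + k)%N; rewrite addnS.
  by split; [exact: le_trans g1|exact: le_trans h2|
             exact: le_trans g3|exact: le_trans h4].
(* Every lower end is below every upper end, so the suprema of the lower ends are the coordinates of
   a point common to all squares. *)
have cross n m : (st n).1 <= (st m).1 + s m /\ (st n).2 <= (st m).2 + s m.
  have [nm|mn] := leqP n m.
    have [+ _ + _] := mono n (m - n)%N; rewrite subnKC // => h1 h2.
    by have := s0 m; split; lra.
  have [_ + _ +] := mono m (n - m)%N; rewrite subnKC ?(ltnW mn) // => h1 h2.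
  by have := s0 n; split; lra.
pose A := [set (st n).1 | n in [set: nat]].
pose B := [set (st n).2 | n in [set: nat]].
have A0 : A !=set0 by exists (st 0).1; exists 0.
have B0 : B !=set0 by exists (st 0).2; exists 0.
have ubA m : ubound A ((st m).1 + s m) by move=> _ [n _ <-]; case: (cross n m).
have ubB m : ubound B ((st m).2 + s m) by move=> _ [n _ <-]; case: (cross n m).
have cA m : (st m).1 <= sup A <= (st m).1 + s m.
  rewrite ge_sup ?andbT //; apply: ub_le_sup; last by exists m.
  by exists ((st m).1 + s m); exact: ubA.
have cB m : (st m).2 <= sup B <= (st m).2 + s m.
  rewrite ge_sup ?andbT //; apply: ub_le_sup; last by exists m.
  by exists ((st m).2 + s m); exact: ubB.
have [||r r0 rP] := Ploc (sup A) (sup B).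
- by have := cA 0; rewrite /s expr0 add0r.
- by have := cB 0; rewrite /s expr0 add0r.
have [n nr] := exists_expn_lt r0.
by apply: (stP n); apply: rP => //; rewrite s0.
Qed.

(** Counterclockwise contour integral round the rectangle, the factor ['i] being that of [dz] on
    vertical sides. It is signed, so the corners may come in any order. *)
Definition rect_int (f : C -> C) (x1 x2 y1 y2 : R) : C :=
  cint (fun t => f (t +i* y1)%C) x1 x2 - cint (fun t => f (t +i* y2)%C) x1 x2 +
  'i%C * (cint (fun t => f (x2 +i* t)%C) y1 y2 -
          cint (fun t => f (x1 +i* t)%C) y1 y2).

Implicit Types (f g : C -> C).

Lemma continuous_hline f y : continuous f -> continuous (fun t : R => f (t +i* y)%C).
Proof.
move=> cf t; apply: (@continuous_comp _ _ _ (fun t : R => (t +i* y)%C : C) f);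
  last exact: cf.
by apply: continuous_ReIm; [exact: cvg_id|exact: cvg_cst].
Qed.

Lemma continuous_vline f x : continuous f -> continuous (fun t : R => f (x +i* t)%C).
Proof.
move=> cf t; apply: (@continuous_comp _ _ _ (fun t : R => (x +i* t)%C : C) f);
  last exact: cf.
by apply: continuous_ReIm; [exact: cvg_cst|exact: cvg_id].
Qed.

Lemma rect_int_hsplit f x1 x2 x3 y1 y2 :
  rect_int f x1 x3 y1 y2 = rect_int f x1 x2 y1 y2 + rect_int f x2 x3 y1 y2.
Proof.
rewrite /rect_int -(cint_chasles (fun t => f (t +i* y1)%C) x1 x2 x3).
by rewrite -(cint_chasles (fun t => f (t +i* y2)%C) x1 x2 x3); ring.
Qed.

Lemma rect_int_vsplit f x1 x2 y1 y2 y3 :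
  rect_int f x1 x2 y1 y3 = rect_int f x1 x2 y1 y2 + rect_int f x1 x2 y2 y3.
Proof.
rewrite /rect_int -(cint_chasles (fun t => f (x1 +i* t)%C) y1 y2 y3).
by rewrite -(cint_chasles (fun t => f (x2 +i* t)%C) y1 y2 y3); ring.
Qed.

Lemma rect_intB f g x1 x2 y1 y2 : continuous f -> continuous g ->
  rect_int (fun z => f z - g z) x1 x2 y1 y2 =
  rect_int f x1 x2 y1 y2 - rect_int g x1 x2 y1 y2.
Proof.
move=> cf cg; rewrite /rect_int !cintB; first by ring.
all: by [exact: continuous_hline|exact: continuous_vline].
Qed.

Lemma rect_intD f g x1 x2 y1 y2 : continuous f -> continuous g ->
  rect_int (fun z => f z + g z) x1 x2 y1 y2 =
  rect_int f x1 x2 y1 y2 + rect_int g x1 x2 y1 y2.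
Proof.
move=> cf cg; rewrite /rect_int !cintD; first by ring.
all: by [exact: continuous_hline|exact: continuous_vline].
Qed.

Lemma rect_intZ (k : C) f x1 x2 y1 y2 : continuous f ->
  rect_int (fun z => k * f z) x1 x2 y1 y2 = k * rect_int f x1 x2 y1 y2.
Proof.
move=> cf; rewrite /rect_int !cintZ; first by ring.
all: by [exact: continuous_hline|exact: continuous_vline].
Qed.

Lemma rect_int_cst (k : C) x1 x2 y1 y2 : rect_int (fun=> k) x1 x2 y1 y2 = 0.
Proof. by rewrite /rect_int !cint_cst; ring. Qed.

Lemma continuous_idC : continuous (fun z : C => z).
Proof. by move=> z; exact: cvg_id. Qed.

Lemma is_derive_sqr_half (t : R) : is_derive t (1 : R) (fun s : R => s ^+ 2 / 2) t.
Proof.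
apply/is_derive_nearP => e e0; apply/nbhs_ballP; exists e => // h.
rewrite /ball /= sub0r normrN => he.
have -> : (t + h) ^+ 2 / 2 - t ^+ 2 / 2 - t * h = h / 2 * h by field.
rewrite normrM ler_wpM2r // normrM (@ger0_norm _ (2^-1)) ?invr_ge0 //.
by have := normr_ge0 h; lra.
Qed.

Lemma is_derive_scal (k t : R) : is_derive t (1 : R) (fun s : R => k * s) k.
Proof.
have H : is_derive t (1 : R) (k \*: (id : R -> R)) k.
  by apply: is_derive_eq; rewrite /GRing.scale /= mulr1.
exact: H.
Qed.

Lemma rect_int_id x1 x2 y1 y2 : rect_int (fun z => z) x1 x2 y1 y2 = 0.
Proof.
have h y : cint (fun t : R => (t +i* y)%C : C) x1 x2 =
    ((x2 ^+ 2 / 2 - x1 ^+ 2 / 2) +i* (y * x2 - y * x1))%C.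
  rewrite (@cint_FTC _ _ (fun t => (t ^+ 2 / 2 +i* (y * t))%C)) //.
    exact: (continuous_hline continuous_idC).
  move=> t; apply: is_derive_curve; first exact: is_derive_sqr_half.
  exact: is_derive_scal.
have v x : cint (fun t : R => (x +i* t)%C : C) y1 y2 =
    ((x * y2 - x * y1) +i* (y2 ^+ 2 / 2 - y1 ^+ 2 / 2))%C.
  rewrite (@cint_FTC _ _ (fun t => (x * t +i* (t ^+ 2 / 2))%C)) //.
    exact: (continuous_vline continuous_idC).
  move=> t; apply: is_derive_curve; last exact: is_derive_sqr_half.
  exact: is_derive_scal.
rewrite /rect_int !h !v; apply/eqP; rewrite eq_complex /=.
by apply/andP; split; apply/eqP; ring.
Qed.

Lemma rect_int_bound f x1 x2 y1 y2 M : continuous f ->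
  (forall x y, between x1 x2 x -> between y1 y2 y -> N (f (x +i* y)%C) <= M) ->
  N (rect_int f x1 x2 y1 y2) <= 2 * M * (`|x2 - x1| + `|y2 - y1|).
Proof.
move=> cf fM; rewrite /rect_int.
apply: le_trans (normc_le_add _ _) _.
have i1 : N 'i%C = 1 by rewrite /= expr0n /= add0r expr1n sqrtr1.
rewrite normcM i1 mul1r.
have H1 y : between y1 y2 y ->
    N (cint (fun t => f (t +i* y)%C) x1 x2) <= M * `|x2 - x1|.
  by move=> yb; apply: cint_bound; [exact: continuous_hline|move=> t tb; exact: fM].
have H2 x : between x1 x2 x ->
    N (cint (fun t => f (x +i* t)%C) y1 y2) <= M * `|y2 - y1|.
  by move=> yb; apply: cint_bound; [exact: continuous_vline|move=> t tb; exact: fM].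
have := H1 y1 (between_l _ _); have := H1 y2 (between_r _ _).
have := H2 x1 (between_l _ _); have := H2 x2 (between_r _ _).
set a1 := cint _ _ _; set a2 := cint _ _ _; set a3 := cint _ _ _.
set a4 := cint _ _ _ => h1 h2 h3 h4.
have := normc_le_add a4 (- a3); have := normc_le_add a1 (- a2).
rewrite !normc_opp; lra.
Qed.

(** For every [e], the bound [e * s ^+ 2] on the subrectangle of parameter side [s] survives
    bisection, as [4 * (s / 2) ^+ 2 = s ^+ 2]. It holds near each point because the first-order
    expansion of [f] has contour integral zero. *)
Lemma goursat f x1 x2 y1 y2 : continuous f ->
  (forall x y, between x1 x2 x -> between y1 y2 y ->
     exists d, has_deriv id f (x +i* y)%C d) ->
  rect_int f x1 x2 y1 y2 = 0.
Proof.
move=> cf df; set w := x2 - x1; set h := y2 - y1.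
suff H e : 0 < e -> N (rect_int f x1 x2 y1 y2) <= e.
  apply/eqP; rewrite -normc_eq0P eq_le normc_ge0 andbT.
  by rewrite leNgt; apply/negP => n0; have := H (N (rect_int f x1 x2 y1 y2) / 2);
    lra.
move=> e0.
pose P a b s := N (rect_int f (x1 + w * a) (x1 + w * (a + s))
  (y1 + h * b) (y1 + h * (b + s))) <= e * s ^+ 2.
suff : P 0 0 1.
  by rewrite /P !mulr0 !addr0 !add0r !mulr1 expr1n mulr1 /w /h ![_ + (_ - _)]addrC
    !subrK.
apply: (@square_bisection P).
- move=> a b s; rewrite /P => P1 P2 P3 P4.
  rewrite (rect_int_hsplit f _ (x1 + w * (a + s / 2))).
  rewrite (rect_int_vsplit f _ _ _ (y1 + h * (b + s / 2))).
  rewrite [X in _ + X](rect_int_vsplit f _ _ _ (y1 + h * (b + s / 2))).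
  have as2 : a + s / 2 + s / 2 = a + s by field.
  have bs2 : b + s / 2 + s / 2 = b + s by field.
  rewrite as2 in P2 P4; rewrite bs2 in P3 P4.
  have -> : e * s ^+ 2 = e * (s / 2) ^+ 2 + e * (s / 2) ^+ 2 +
    (e * (s / 2) ^+ 2 + e * (s / 2) ^+ 2) by field.
  apply: le_trans (normc_le_add _ _) (lerD _ _).
    exact: le_trans (normc_le_add _ _) (lerD _ _).
  exact: le_trans (normc_le_add _ _) (lerD _ _).
- move=> c d c01 d01; set z0 : C := ((x1 + w * c) +i* (y1 + h * d))%C.
  have bx : between x1 x2 (x1 + w * c).
    have := between_affine x1 w c01; rewrite mulr0 addr0 mulr1 /w.
    by rewrite [X in between _ X _]addrC subrK.
  have by_ : between y1 y2 (y1 + h * d).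
    have := between_affine y1 h d01; rewrite mulr0 addr0 mulr1 /h.
    by rewrite [X in between _ X _]addrC subrK.
  have [d0 Hd] := df _ _ bx by_; set L := `|w| + `|h|.
  have L0 : 0 <= L by rewrite addr_ge0.
  (* An error [e' * (L * s)] on the boundary, multiplied by twice [L * s], gives
     [2 * L ^+ 2 * e' * s ^+ 2]; hence the choice [e' = e / (2 * L ^+ 2 + 1)]. *)
  have A0 : 0 < 2 * L ^+ 2 + 1 by rewrite ltr_wpDl // mulr_ge0 // sqr_ge0.
  have eA0 : 0 < e / (2 * L ^+ 2 + 1) by rewrite divr_gt0.
  have [r r0 rP] := Hd _ eA0.
  exists (r / (L + 1)); first by rewrite divr_gt0 // ltr_wpDl.
  move=> a b s /andP[s0 sr] ac bd; rewrite /P.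
  have caff := @continuousC_affine R (f z0) d0 z0.
  have aff0 u1 u2 v1 v2 : rect_int (fun z : C => f z0 + d0 * (z - z0)) u1 u2 v1 v2 = 0.
    have cc := @continuousC_cst R C (f z0 - d0 * z0).
    have cZ : continuous (fun z : C => d0 * z).
      move=> z; exact: (has_deriv_continuous (has_derivZ d0 (has_deriv_id _))).
    have -> : (fun z : C => f z0 + d0 * (z - z0)) =
              (fun z => (f z0 - d0 * z0) + d0 * z) by apply/funext => z; ring.
    rewrite (rect_intD _ _ _ _ cc cZ) (rect_intZ _ _ _ _ _ continuous_idC).
    by rewrite rect_int_cst rect_int_id mulr0 addr0.
  rewrite -[rect_int f _ _ _ _]subr0 -(aff0 (x1 + w * a) (x1 + w * (a + s))
    (y1 + h * b) (y1 + h * (b + s))) -rect_intB //.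
  have sE : e * s ^+ 2 = 2 * (e / (2 * L ^+ 2 + 1) * (L * s)) * (L * s) +
      e / (2 * L ^+ 2 + 1) * s ^+ 2.
    by field; rewrite gt_eqF.
  have lx : x1 + w * (a + s) - (x1 + w * a) = w * s by ring.
  have ly : y1 + h * (b + s) - (y1 + h * b) = h * s by ring.
  apply: (@le_trans _ _ (2 * (e / (2 * L ^+ 2 + 1) * (L * s)) * (L * s))); last first.
    by rewrite sE lerDl mulr_ge0 ?sqr_ge0 // ltW.
  have -> : L * s = `|w * s| + `|h * s|.
    by rewrite !normrM (gtr0_norm s0) -mulrDl.
  rewrite -{2}lx -{2}ly; apply: rect_int_bound.
    by move=> z; exact: (continuousC_sub (cf z) (caff z)).
  move=> x y xb yb; set z : C := (x +i* y)%C.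
  have zz : N (z - z0) <= `|w * s| + `|h * s|.
    apply: le_trans (normc_le_ReIm _) _; apply: lerD => /=.
      by rewrite -lx; apply: between_dist => //; exact: between_affine.
    by rewrite -ly; apply: between_dist => //; exact: between_affine.
  have zr : N (z - z0) < r.
    apply: le_lt_trans zz _; rewrite !normrM (gtr0_norm s0) -mulrDl -/L.
    move: sr; rewrite ltr_pdivlMr; last by rewrite ltr_wpDl.
    by apply: le_lt_trans; rewrite mulrC ler_wpM2l ?ltW // ltrDl.
  have := rP _ zr; rewrite [z0 + _]addrC subrK => H.
  have -> : f z - (f z0 + d0 * (z - z0)) = f z - f z0 - d0 * (z - z0) by ring.
  apply: le_trans H _; rewrite ler_wpM2l //; exact: ltW.
Qed.

End Goursat.

(** * Primitives on squares *)

Section CauchyTaylor.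
Variable R : realType.
Local Notation C := (Cplane R).
Local Notation N := (@normc R).
Implicit Types (f g G : C -> C).

Definition square (s : R) : set C :=
  [set z | `|complex.Re z| < s /\ `|complex.Im z| < s].

Lemma between_square (s x1 x2 x : R) : `|x1| < s -> `|x2| < s ->
  between x1 x2 x -> `|x| < s.
Proof.
rewrite /between /Num.min /Num.max !ltr_norml.
by case: (ltP x1 x2) => _ /andP[? ?] /andP[? ?] /andP[? ?]; apply/andP; split; lra.
Qed.

Lemma between_neq (c l x t : R) : 0 < l -> x != c ->
  between (c + l * (x - c)) x t -> t != c.
Proof.
move=> l0 xc; have [xc'|xc'|E] := ltgtP x c; last by rewrite E eqxx in xc.
- have h : l * (x - c) < 0 by rewrite pmulr_rlt0 // subr_lt0.
  rewrite /between /Num.max => /andP[_].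
  by case: ifP => _ tc; rewrite lt_eqF //; lra.
- have h : 0 < l * (x - c) by rewrite mulr_gt0 // subr_gt0.
  rewrite /between /Num.min => /andP[+ _].
  by case: ifP => _ tc; rewrite gt_eqF //; lra.
Qed.

(** The exceptional point [a], where only continuity is known, is a corner. Cutting off a corner
    rectangle scaled by [l] leaves two rectangles covered by Goursat's lemma, and the small one
    contributes at most [l] times a constant. *)
Lemma rect_int_corner f (s : R) (a : C) x y : continuous f -> square s a ->
  (forall z, square s z -> z != a -> exists d, has_deriv id f z d) ->
  `|x| < s -> `|y| < s ->
  rect_int f (complex.Re a) x (complex.Im a) y = 0.
Proof.
move=> cf [a1s a2s] df xs ys.
set a1 := complex.Re a in a1s *; set a2 := complex.Im a in a2s *.
have [->|xa] := eqVneq x a1.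
  by rewrite /rect_int !cint_refl !subrr mulr0 addr0.
have [->|ya] := eqVneq y a2.
  by rewrite /rect_int !cint_refl !subrr mulr0 addr0.
have aE : a = (a1 +i* a2)%C by rewrite /a1 /a2; case: (a).
have /continuous_normcP /(_ 1 ltr01) /nbhs_normcP[r r0 rP] := cf a.
set L := `|x - a1| + `|y - a2|.
have L0 : 0 < L by rewrite ltr_pwDl // normr_gt0 subr_eq0.
set M := N (f a) + 1; have M0 : 0 < M by rewrite ltr_wpDl // normc_ge0.
have key (l : R) : 0 < l -> l <= 1 -> l * L < r ->
    N (rect_int f a1 x a2 y) <= l * (2 * M * L).
  move=> l0 l1 lr; set x' := a1 + l * (x - a1); set y' := a2 + l * (y - a2).
  have x's : `|x'| < s.
    apply: (between_square a1s xs).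
    have := @between_affine _ a1 (x - a1) 0 1 l.
    by rewrite mulr0 addr0 mulr1 [a1 + (x - a1)]addrC subrK mulrC; apply;
      rewrite (ltW l0).
  have y's : `|y'| < s.
    apply: (between_square a2s ys).
    have := @between_affine _ a2 (y - a2) 0 1 l.
    by rewrite mulr0 addr0 mulr1 [a2 + (y - a2)]addrC subrK mulrC; apply;
      rewrite (ltW l0).
  rewrite (rect_int_hsplit f _ x') (rect_int_vsplit f _ _ _ y').
  rewrite [X in _ + X + _](_ : _ = 0); last first.
    apply: goursat => // u v ub vb; apply: df.
      by split; [exact: between_square ub|exact: between_square vb].
    rewrite aE eq_complex /= negb_and; apply/orP; right.
    exact: between_neq vb.
  rewrite [X in _ + X](_ : _ = 0); last first.
    apply: goursat => // u v ub vb; apply: df.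
      by split; [exact: between_square ub|exact: between_square vb].
    rewrite aE eq_complex /= negb_and; apply/orP; left.
    exact: between_neq ub.
  rewrite !addr0.
  have -> : l * (2 * M * L) = 2 * M * (`|x' - a1| + `|y' - a2|).
    have -> : x' - a1 = l * (x - a1) by rewrite /x'; ring.
    have -> : y' - a2 = l * (y - a2) by rewrite /y'; ring.
    by rewrite !normrM (gtr0_norm l0) /L; ring.
  apply: rect_int_bound => // u v ub vb.
  have : N ((u +i* v)%C - a) < r.
    apply: le_lt_trans lr; apply: le_trans (normc_le_ReIm _) _.
    rewrite aE /= mulrDr; apply: lerD.
      have := between_dist ub (between_l _ _).
      by rewrite /x' addrAC subrr add0r normrM (gtr0_norm l0).
    have := between_dist vb (between_l _ _).
    by rewrite /y' addrAC subrr add0r normrM (gtr0_norm l0).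
  move=> /rP /= H; have := normc_le_add (f (u +i* v)%C - f a) (f a).
  by rewrite subrK /M; lra.
apply/eqP; rewrite -normc_eq0P eq_le normc_ge0 andbT leNgt; apply/negP => n0.
set n := N _ in n0 key.
have K0 : 0 < 2 * M * L by rewrite !mulr_gt0.
(* The second entry keeps the small rectangle where [N (f z) <= M]; the third makes its integral at
   most [n / 2], although it should equal [n]. *)
set l := Num.min 1 (Num.min (r / (2 * L)) (n / (2 * (2 * M * L)))).
have l0 : 0 < l by rewrite !lt_min ltr01 !divr_gt0 // mulr_gt0.
have l1 : l <= 1 by rewrite ge_min lexx.
have lr : l * L < r.
  apply: le_lt_trans (_ : r / (2 * L) * L < r).
    by rewrite ler_pM2r // /l !ge_min lexx orbT.
  have -> : r / (2 * L) * L = r / 2 by field; rewrite gt_eqF.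
  lra.
have := key _ l0 l1 lr.
have : l * (2 * M * L) <= n / (2 * (2 * M * L)) * (2 * M * L).
  by rewrite ler_pM2r // /l !ge_min lexx !orbT.
have -> : n / (2 * (2 * M * L)) * (2 * M * L) = n / 2.
  by field; rewrite !gt_eqF.
lra.
Qed.

(** Inclusion-exclusion over the four signed rectangles with a corner at [a]. *)
Lemma rect_int_except f (s : R) (a : C) x1 x2 y1 y2 : continuous f ->
  square s a ->
  (forall z, square s z -> z != a -> exists d, has_deriv id f z d) ->
  `|x1| < s -> `|x2| < s -> `|y1| < s -> `|y2| < s ->
  rect_int f x1 x2 y1 y2 = 0.
Proof.
move=> cf sa df x1s x2s y1s y2s.
have K x y : `|x| < s -> `|y| < s ->
    rect_int f (complex.Re a) x (complex.Im a) y = 0.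
  by move=> xs ys; exact: rect_int_corner sa df xs ys.
have H : rect_int f x1 x2 y1 y2 =
    rect_int f (complex.Re a) x2 (complex.Im a) y2
    - rect_int f (complex.Re a) x1 (complex.Im a) y2
    - rect_int f (complex.Re a) x2 (complex.Im a) y1
    + rect_int f (complex.Re a) x1 (complex.Im a) y1.
  rewrite (rect_int_hsplit f (complex.Re a) x1 x2 (complex.Im a) y2).
  rewrite (rect_int_hsplit f (complex.Re a) x1 x2 (complex.Im a) y1).
  rewrite (rect_int_vsplit f x1 x2 (complex.Im a) y1 y2).
  ring.
by rewrite H !K // !subr0 addr0.
Qed.

(** The primitive integrates along the real axis, then vertically. As the rectangle between that
    axis and height [y] has integral zero, an increment is an integral over two short segments
    starting at [z]. *)
Lemma primitive_square f (s : R) : continuous f ->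
  (forall x1 x2 y1 y2, `|x1| < s -> `|x2| < s -> `|y1| < s -> `|y2| < s ->
    rect_int f x1 x2 y1 y2 = 0) ->
  exists G, forall z, square s z -> has_deriv id G z (f z).
Proof.
move=> cf f0.
pose G (z : C) : C := cint (fun t => f (t +i* 0)%C) 0 (complex.Re z) +
  'i%C * cint (fun t => f (complex.Re z +i* t)%C) 0 (complex.Im z).
exists G => -[x y] [/= xs ys] e e0; have e20 : 0 < e / 2 by lra.
have s0 : 0 < s by exact: le_lt_trans (normr_ge0 _) xs.
have /continuous_normcP /(_ _ e20) /nbhs_normcP[r r0 rP] := cf (x +i* y)%C.
exists (Num.min (r / 2) (s - `|x|)) => [|[h1 h2]].
  by rewrite lt_min subr_gt0 xs divr_gt0.
rewrite lt_min => /andP[hr hs].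
have h1N := abs_Re_le (h1 +i* h2)%C; have h2N := abs_Im_le (h1 +i* h2)%C.
rewrite [complex.Re _]/= in h1N; rewrite [complex.Im _]/= in h2N.
have x's : `|x + h1| < s by have := ler_normD x h1; lra.
have := f0 x (x + h1) 0 y xs x's; rewrite normr0 => /(_ s0 ys) E0.
have -> : G ((x +i* y) + (h1 +i* h2))%C - G (x +i* y)%C
      - f (x +i* y)%C * (h1 +i* h2)%C =
    cint (fun t => f (t +i* y)%C - f (x +i* y)%C) x (x + h1) +
    'i%C * cint (fun t => f ((x + h1) +i* t)%C - f (x +i* y)%C) y (y + h2).
  rewrite !cintB; first last.
  - exact: continuousC_cst.
  - exact: continuous_hline.
  - exact: continuousC_cst.
  - exact: continuous_vline.
  rewrite !cint_cst /G /=.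
  rewrite -(cint_chasles (fun t => f (t +i* 0)%C) 0 x (x + h1)).
  rewrite -(cint_chasles (fun t => f ((x + h1) +i* t)%C) 0 y (y + h2)).
  have -> : x + h1 - x = h1 by ring.
  have -> : y + h2 - y = h2 by ring.
  have -> : (h1 +i* h2)%C = (h1%:C)%C + 'i%C * (h2%:C)%C :> C.
    by apply/eqP; rewrite eq_complex /=; apply/andP; split; apply/eqP; ring.
  move: E0; rewrite /rect_int.
  set u1 := cint _ _ _; set u2 := cint _ _ _; set u3 := cint _ _ _.
  set u4 := cint _ _ _; set u5 := cint _ _ _; set u6 := cint _ _ _ => E0.
  have -> : u2 = u1 + 'i%C * (u3 - u4).
    by apply/eqP; rewrite -subr_eq0 -oppr_eq0 -E0; apply/eqP; ring.
  ring.
have i1 : N 'i%C = 1 by rewrite /= expr0n /= add0r expr1n sqrtr1.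
have near1 t : between x (x + h1) t -> N (f (t +i* y)%C - f (x +i* y)%C) <= e / 2.
  move=> tb; apply/ltW/rP; apply: le_lt_trans (normc_le_ReIm _) _ => /=.
  rewrite subrr normr0 addr0.
  have := between_dist tb (between_l _ _); rewrite addrAC subrr add0r; lra.
have near2 t : between y (y + h2) t ->
    N (f ((x + h1) +i* t)%C - f (x +i* y)%C) <= e / 2.
  move=> tb; apply/ltW/rP; apply: le_lt_trans (normc_le_ReIm _) _ => /=.
  have -> : x + h1 - x = h1 by ring.
  have := between_dist tb (between_l _ _).
  have -> : y + h2 - y = h2 by ring.
  lra.
apply: le_trans (normc_le_add _ _) _; rewrite normcM i1 mul1r.
have b1 : N (cint (fun t => f (t +i* y)%C - f (x +i* y)%C) x (x + h1)) <=
    e / 2 * `|h1|.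
  have -> : `|h1| = `|x + h1 - x| by congr `|_|; ring.
  apply: cint_bound => // t.
  exact: (continuousC_sub (@continuous_hline R f y cf t) (@continuousC_cst R _ _ t)).
have b2 : N (cint (fun t => f ((x + h1) +i* t)%C - f (x +i* y)%C) y (y + h2)) <=
    e / 2 * `|h2|.
  have -> : `|h2| = `|y + h2 - y| by congr `|_|; ring.
  apply: cint_bound => // t.
  exact: (continuousC_sub (@continuous_vline R f _ cf t) (@continuousC_cst R _ _ t)).
apply: le_trans (lerD b1 b2) _.
have -> : e * N (h1 +i* h2)%C = e / 2 * N (h1 +i* h2)%C + e / 2 * N (h1 +i* h2)%C.
  by rewrite -mulrDl -splitr.
by apply: lerD; rewrite ler_pM2l.
Qed.

End CauchyTaylor.

(** * Cauchy formula and Taylor expansion *)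

Section Taylor.
Variable R : realType.
Local Notation C := (Cplane R).
Local Notation N := (@normc R).
Implicit Types (f g G : C -> C).

Lemma curve_continuous (p : R -> C) (t : R) (d : C) :
  curve_deriv p t d -> {for t, continuous p}.
Proof.
move=> /has_deriv_bound[r r0 rP]; apply/continuous_normcP => e e0.
have d0 : 0 < N d + 1 by have := normc_ge0 d; lra.
have m0 : 0 < Num.min r (e / (N d + 1)) by rewrite lt_min r0 divr_gt0.
apply/nbhs_ballP; exists (Num.min r (e / (N d + 1))) => // s.
rewrite /ball /= distrC lt_min => /andP[h1 h2].
have := rP (s - t); rewrite normc_real => /(_ h1).
rewrite [t + _]addrC subrK => H; apply: le_lt_trans H _.
by rewrite mulrC -ltr_pdivlMr.
Qed.

Definition circle (r t : R) : C := ((r * cos t) +i* (r * sin t))%C.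

Lemma circle_deriv r t : curve_deriv (circle r) t ('i%C * circle r t).
Proof.
have -> : 'i%C * circle r t = ((r * - sin t) +i* (r * cos t))%C.
  by apply/eqP; rewrite eq_complex /= !mul0r !mul1r sub0r add0r mulrN !eqxx.
exact: is_derive_curve (is_deriveZ r (is_derive_cos t))
  (is_deriveZ r (is_derive_sin t)).
Qed.

Lemma circle_continuous r : continuous (circle r).
Proof. by move=> t; exact: curve_continuous (circle_deriv r t). Qed.

Lemma circle_norm r t : 0 <= r -> N (circle r t) = r.
Proof.
move=> r0; rewrite /circle /= !exprMn -mulrDr cos2Dsin2 mulr1 sqrtr_sqr.
exact: ger0_norm.
Qed.

Lemma circle_neq0 r t : 0 < r -> circle r t != 0.
Proof. by move=> r0; rewrite -normc_gt0P circle_norm // ltW. Qed.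

Lemma circle_2pi r : circle r (2 * pi) = circle r 0.
Proof. by rewrite /circle mulr2n mulrDl mul1r -mulr2n cos2pi cos0 sin2pi sin0. Qed.

Lemma circle_square r s t : 0 < r -> r < s -> square s (circle r t).
Proof.
move=> r0 rs; rewrite -(circle_norm t (ltW r0)) in rs.
split; apply: le_lt_trans rs; [exact: abs_Re_le|exact: abs_Im_le].
Qed.

(** Since [circle] has derivative ['i * circle], the integrand is the derivative of [- 'i * G] along
    the circle, which takes equal values at [0] and [2 * pi]. *)
Lemma cint_circle_primitive g G r s : 0 < r -> r < s -> continuous g ->
  (forall z, square s z -> has_deriv id G z (g z)) ->
  cint (fun t => g (circle r t) * circle r t) 0 (2 * pi) = 0.
Proof.
move=> r0 rs cg dG.
rewrite (@cint_FTC _ _ (fun t => - 'i%C * G (circle r t))).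
- by rewrite circle_2pi subrr.
- move=> t; apply: (continuousC_mul (f := fun t => g (circle r t))).
    exact: continuous_comp (@circle_continuous r t) (cg _).
  exact: circle_continuous.
- move=> t; have H := dG _ (circle_square t r0 rs).
  have := has_derivZ (- 'i%C) (has_deriv_comp (circle_deriv r t) H).
  suff -> : - 'i%C * (g (circle r t) * ('i%C * circle r t)) =
    g (circle r t) * circle r t by [].
  have ii : 'i%C * 'i%C = -1 :> C.
    by apply/eqP; rewrite eq_complex /=; apply/andP; split; apply/eqP; ring.
  transitivity (- ('i%C * 'i%C) * (g (circle r t) * circle r t)); first by ring.
  by rewrite ii opprK mul1r.
Qed.

Definition circle_inv (r t : R) : C := (circle r t)^-1.

Lemma circle_inv_deriv r t : 0 < r ->
  curve_deriv (circle_inv r) t (- 'i%C * circle_inv r t).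
Proof.
move=> r0; have := has_deriv_comp (circle_deriv r t)
  (has_deriv_inv (circle_neq0 t r0)).
suff -> : - (circle r t) ^- 2 * ('i%C * circle r t) = - 'i%C * circle_inv r t by [].
by rewrite /circle_inv; field; exact: circle_neq0.
Qed.

Lemma circle_inv_continuous r : 0 < r -> continuous (circle_inv r).
Proof. by move=> r0 t; exact: curve_continuous (circle_inv_deriv t r0). Qed.

Lemma continuousC_scale (T : topologicalType) (k : C) (p : T -> C) (t : T) :
  {for t, continuous p} -> {for t, continuous (fun s => k * p s)}.
Proof. by move=> cp; exact: (continuousC_mul (@continuousC_cst R T k t) cp). Qed.

Lemma continuousC_exp (T : topologicalType) (p : T -> C) n (t : T) :
  {for t, continuous p} -> {for t, continuous (fun s => p s ^+ n)}.
Proof.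
move=> cp; elim: n => [|n IH].
  have -> : (fun s => p s ^+ 0) = (fun=> 1) by apply/funext => s; rewrite expr0.
  exact: continuousC_cst.
have -> : (fun s => p s ^+ n.+1) = (fun s => p s * p s ^+ n).
  by apply/funext => s; rewrite exprS.
exact: (continuousC_mul cp IH).
Qed.

(** For [k > 0] the power is a multiple of its own derivative, so it has a periodic primitive. *)
Lemma cint_circle_inv r k : 0 < r -> (0 < k)%N ->
  cint (fun t => circle_inv r t ^+ k) 0 (2 * pi) = 0.
Proof.
move=> r0 k0; have i0 : 'i%C != 0 :> C.
  by rewrite -normc_gt0P /= expr0n /= add0r expr1n sqrtr1.
have kn0 : k%:R != 0 :> C by rewrite pnatr_eq0 -lt0n.
have d0 : - 'i%C * k%:R != 0 :> C by rewrite mulf_eq0 oppr_eq0 negb_or i0.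
rewrite (@cint_FTC _ _ (fun t => (- 'i%C * k%:R)^-1 * circle_inv r t ^+ k)).
- by rewrite /circle_inv circle_2pi subrr.
- by move=> t; apply: continuousC_exp; exact: circle_inv_continuous.
- move=> t; have := has_derivZ (- 'i%C * k%:R)^-1
    (has_derivX k (circle_inv_deriv t r0)).
  suff -> : (- 'i%C * k%:R)^-1 *
    (k%:R * circle_inv r t ^+ k.-1 * (- 'i%C * circle_inv r t)) =
    circle_inv r t ^+ k by [].
  rewrite -[X in _ = _ ^+ X](prednK k0) exprSr.
  set q := _ ^+ k.-1; field.
  by rewrite i0 kn0.
Qed.

Section Kernel.
Variables (r : R) (a : C).
Hypotheses (r0 : 0 < r) (ar : N a < r).

(** On the circle, [dz / (z - a)] is ['i] times this kernel times [dt]. *)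
Definition cauchy_kernel (t : R) : C := circle r t / (circle r t - a).

Lemma circle_sub_norm t : r - N a <= N (circle r t - a).
Proof. by have := normc_sub_le (circle r t) a; rewrite (circle_norm _ (ltW r0)). Qed.

Lemma circle_sub_neq0 t : circle r t - a != 0.
Proof. by rewrite -normc_gt0P; have := circle_sub_norm t; move: ar; lra. Qed.

Lemma cauchy_kernelS t :
  cauchy_kernel t = 1 + (a * circle_inv r t) * cauchy_kernel t.
Proof.
rewrite /cauchy_kernel /circle_inv; field.
by rewrite circle_sub_neq0 circle_neq0.
Qed.

Lemma cauchy_kernel_continuous : continuous cauchy_kernel.
Proof.
move=> t; apply: (continuousC_mul (f := circle r)); first exact: circle_continuous.
have H : {for t, continuous (fun s => circle r s - a)}.
  exact: (continuousC_sub (@circle_continuous r t) (@continuousC_cst R _ a t)).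
apply: (continuous_comp H).
exact: has_deriv_continuous (has_deriv_inv (circle_sub_neq0 t)).
Qed.

Lemma cauchy_kernel_bound t : N (cauchy_kernel t) <= r / (r - N a).
Proof.
have h : 0 < r - N a by rewrite subr_gt0.
have h2 := circle_sub_norm t.
rewrite /cauchy_kernel normcM normcV (circle_norm _ (ltW r0)).
by rewrite ler_pM2l // lef_pV2 ?posrE //; lra.
Qed.

(** The geometric series in [a / circle], one step of which is [cauchy_kernelS]; a finite sum with
    remainder avoids exchanging a series and an integral. *)
Lemma cint_kernel_expansion (p : R -> C) n : continuous p ->
  cint (fun t => p t * cauchy_kernel t) 0 (2 * pi) =
  \sum_(k < n) a ^+ k * cint (fun t => p t * circle_inv r t ^+ k) 0 (2 * pi) +
  cint (fun t => (p t * (a * circle_inv r t) ^+ n) * cauchy_kernel t) 0 (2 * pi).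
Proof.
move=> cp; elim: n => [|n IH].
  rewrite big_ord0 add0r; congr (cint _ _ _); apply/funext => t.
  by rewrite expr0 mulr1.
have ck := cauchy_kernel_continuous.
have cq m : continuous (fun t => p t * (a * circle_inv r t) ^+ m).
  move=> t; apply: (continuousC_mul (cp t)); apply: continuousC_exp.
  by apply: continuousC_scale; exact: circle_inv_continuous.
have cpe m : continuous (fun t => p t * circle_inv r t ^+ m).
  move=> t; apply: (continuousC_mul (cp t)); apply: continuousC_exp.
  exact: circle_inv_continuous.
have cpa m : continuous (fun t => a ^+ m * (p t * circle_inv r t ^+ m)).
  by move=> t; exact: (@continuousC_scale R (a ^+ m) _ t (cpe m t)).
rewrite IH big_ord_recr /= -addrA; congr (_ + _).
rewrite -(cintZ (a ^+ n) _ _ (cpe n)) -cintD.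
- congr (cint _ _ _); apply/funext => t; rewrite {1}cauchy_kernelS exprS exprMn.
  by ring.
- exact: cpa.
- by move=> t; apply: (continuousC_mul (cq _ t)); exact: ck.
Qed.

Lemma cint_kernel_remainder (p : R -> C) n M : continuous p ->
  (forall t, N (p t) <= M) ->
  N (cint (fun t => (p t * (a * circle_inv r t) ^+ n) * cauchy_kernel t) 0 (2 * pi))
  <= M * (N a / r) ^+ n * (r / (r - N a)) * (2 * pi).
Proof.
move=> cp pM; have pi0 : 0 <= 2 * pi :> R by rewrite mulr_ge0 // pi_ge0.
rewrite [leRHS](_ : _ = M * (N a / r) ^+ n * (r / (r - N a)) * `|2 * pi - 0|);
  last by rewrite subr0 ger0_norm.
apply: cint_bound => [t|t _].
  apply: (continuousC_mul (f := fun t => p t * (a * circle_inv r t) ^+ n)).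
    apply: (continuousC_mul (cp t)); apply: continuousC_exp.
    by apply: continuousC_scale; exact: circle_inv_continuous.
  exact: cauchy_kernel_continuous.
have q0 : 0 <= (N a / r) ^+ n by rewrite exprn_ge0 // divr_ge0 ?normc_ge0 // ltW.
have qE : N ((a * circle_inv r t) ^+ n) = (N a / r) ^+ n.
  by rewrite normc_exp normcM /circle_inv normcV (circle_norm _ (ltW r0)).
rewrite normcM; apply: ler_pM; rewrite ?normc_ge0 //.
  by rewrite normcM qE; exact: ler_wpM2r q0 _ _ (pM t).
exact: cauchy_kernel_bound.
Qed.

(** In the expansion for [p = 1] only index [0] survives, because positive powers of [circle_inv]
    integrate to zero, and the remainder tends to [0] as [N a / r < 1]. *)
Lemma cint_kernel : cint cauchy_kernel 0 (2 * pi) = ((2 * pi)%:C)%C.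
Proof.
have pi0 : 0 < 2 * pi :> R by rewrite mulr_gt0 // pi_gt0.
set K := (r / (r - N a)) * (2 * pi).
have K0 : 0 < K by rewrite mulr_gt0 // divr_gt0 // subr_gt0.
have key n : N (cint cauchy_kernel 0 (2 * pi) - ((2 * pi)%:C)%C) <=
    (N a / r) ^+ n.+1 * K.
  have c1 : continuous (fun _ : R => 1 : C) by exact: continuousC_cst.
  have := cint_kernel_expansion n.+1 c1.
  have -> : (fun t => 1 * cauchy_kernel t) = cauchy_kernel.
    by apply/funext => t; rewrite mul1r.
  move=> ->; rewrite big_ord_recl big1 => [|i _]; last first.
    rewrite [X in cint X](_ : _ = fun t => circle_inv r t ^+ lift ord0 i).
      by rewrite cint_circle_inv // mulr0.
    by apply/funext => t; rewrite mul1r.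
  rewrite addr0 expr0 mul1r [X in cint X](_ : _ = fun=> 1); last first.
    by apply/funext => t; rewrite expr0 mulr1.
  rewrite cint_cst mul1r subr0 addrAC subrr add0r.
  have H1 : forall t : R, N (1 : C) <= 1 by move=> _; rewrite normc1.
  apply: le_trans (cint_kernel_remainder n.+1 c1 H1) _.
  by rewrite mul1r /K -!mulrA.
apply/eqP; rewrite -subr_eq0 -normc_eq0P eq_le normc_ge0 andbT leNgt.
apply/negP => d0; set d := N _ in d0 key.
have q1 : N a / r < 1 by rewrite ltr_pdivrMr // mul1r.
have q0 : 0 <= N a / r by rewrite divr_ge0 ?normc_ge0 // ltW.
have cq : (fun n => (N a / r) ^+ n) @ \oo --> 0.
  by apply: cvg_expr; rewrite ger0_norm.
have dK : 0 < d / K by rewrite divr_gt0.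
move/cvgrPdist_lt : cq => /(_ _ dK)[n _ /(_ n.+1) /=].
rewrite leqnSn sub0r normrN ger0_norm ?exprn_ge0 // => /(_ isT).
by rewrite ltr_pdivlMr // ltNge key.
Qed.

End Kernel.

(** Integrating the difference quotient at [a] round the circle gives Cauchy's formula; expanding
    its kernel gives coefficients independent of [a]. The factor [2] bounds [r / (r - N a)] when
    [N a <= r / 2]. *)
Lemma cauchy_taylor_square f (s r : R) (M : R) : continuous f -> 0 < r -> r < s ->
  (forall z, square s z -> exists d, has_deriv id f z d) ->
  (forall z, N z <= r -> N (f z) <= M) ->
  exists c : nat -> C, forall n a, N a <= r / 2 ->
    N (f a - \sum_(k < n) c k * a ^+ k) <= 2 * M * (N a / r) ^+ n.
Proof.
move=> cf r0 rs df fM.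
have pi0 : 0 < 2 * pi :> R by rewrite mulr_gt0 // pi_gt0.
have tpi0 : ((2 * pi)%:C)%C != 0 :> C.
  by rewrite -normc_gt0P normc_real gtr0_norm.
have M0 : 0 <= M by apply: le_trans (normc_ge0 (f 0)) (fM 0 _); rewrite normc0 ltW.
pose p t := f (circle r t).
have cp : continuous p.
  by move=> t; exact: continuous_comp (@circle_continuous r t) (cf _).
have pM t : N (p t) <= M by apply: fM; rewrite circle_norm // ltW.
pose cc k := cint (fun t => p t * circle_inv r t ^+ k) 0 (2 * pi) /
   ((2 * pi)%:C)%C.
exists cc => n a ar2.
have ar : N a < r by move: r0 ar2; lra.
have sa : square s a.
  split; apply: le_lt_trans (lt_trans ar rs); [exact: abs_Re_le|exact: abs_Im_le].
have [d dfa] := df _ sa.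
(* Completed by the derivative, the quotient is continuous at [a] and differentiable at the other
   points of the square: exactly what [rect_int_except] tolerates. *)
pose g (z : C) : C := if z == a then d else (f z - f a) / (z - a).
have dg z : square s z -> z != a -> exists d, has_deriv id g z d.
  move=> sz za; have [d' dfz] := df _ sz.
  have za0 : z - a != 0 by rewrite subr_eq0.
  have H1 := has_derivB dfz (@has_deriv_cst R _ id (f a) z).
  have idD : has_deriv id (fun z : C => z) z 1 by exact: has_deriv_id.
  have H2 := has_deriv_comp (has_derivB idD (@has_deriv_cst R _ id a z))
    (has_deriv_inv za0).
  have H3 := has_derivM H1 H2; eexists.
  apply: (has_deriv_near (r0 := N (z - a)) _ _ _ H3).
  - by rewrite normc_gt0P.
  - move=> h hz; rewrite /g ifF //; apply/negP => /eqP E.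
    move: hz; rewrite /= -E opprD addrA subrr sub0r normc_opp.
    by rewrite ltxx.
  - by rewrite /g ifN.
have cg : continuous g.
  move=> z; have [->|za] := eqVneq z a.
    apply/continuous_normcP => e e0; have e20 : 0 < e / 2 by lra.
    have [r1 r10 rP] := dfa _ e20.
    apply/nbhs_normcP; exists r1 => // w wa.
    rewrite {2}/g eqxx /g; case: eqVneq => [_|wna]; first by rewrite subrr normc0.
    have wa0 : w - a != 0 by rewrite subr_eq0.
    have -> : (f w - f a) / (w - a) - d = (f w - f a - d * (w - a)) / (w - a).
      by field.
    rewrite normcM normcV ltr_pdivrMr ?normc_gt0P //.
    have := rP _ wa; rewrite /= [a + _]addrC subrK.
    have : 0 < e / 2 * N (w - a) by rewrite mulr_gt0 // normc_gt0P subr_eq0.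
    lra.
  have za0 : z - a != 0 by rewrite subr_eq0.
  have H0 : {for z, continuous (fun w : C => w - a)}.
    exact: (continuousC_sub (@continuous_idC R z) (@continuousC_cst R _ a z)).
  have H1 := continuous_comp H0
    (has_deriv_continuous (has_deriv_inv za0)).
  have H2 : {for z, continuous (fun w => f w - f a)}.
    exact: (continuousC_sub (cf z) (@continuousC_cst R _ (f a) z)).
  have H3 := continuousC_mul H2 H1.
  apply/continuous_normcP => e e0; move/continuous_normcP : H3 => /(_ e e0) H3.
  apply: filterS2 H3 (nbhsN_ball z (_ : 0 < N (z - a))).
    move=> w /= H3 wz; rewrite /g (negbTE za); case: eqVneq => [wa|_]; last exact: H3.
    by move: wz; rewrite wa normc_distC ltxx.
  by rewrite normc_gt0P.
have [G dG] : exists G, forall z, square s z -> has_deriv id G z (g z).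
  apply: primitive_square => // x1 x2 y1 y2 *.
  exact: rect_int_except sa dg _ _ _ _.
have := cint_circle_primitive r0 rs cg dG.
have ck := @cauchy_kernel_continuous r a r0 ar.
have -> : (fun t => g (circle r t) * circle r t) =
    (fun t => p t * cauchy_kernel r a t - f a * cauchy_kernel r a t).
  apply/funext => t; have h := circle_sub_neq0 r0 ar t.
  have -> : g (circle r t) = (f (circle r t) - f a) / (circle r t - a).
    by rewrite /g; case: eqVneq => // E; rewrite E subrr eqxx in h.
  rewrite /cauchy_kernel /p; move: (circle r t) (f _) (f a) h => x u v h.
  by field.
rewrite cintB; first last.
- by move=> t; apply: continuousC_scale; exact: ck.
- by move=> t; exact: (continuousC_mul (cp t) (ck t)).
rewrite cintZ // cint_kernel // (cint_kernel_expansion r0 ar n cp) => /eqP.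
rewrite subr_eq0 => /eqP E.
have := cint_kernel_remainder r0 ar n cp pM.
set rem := cint _ _ _ in E * => rB.
have -> : f a - \sum_(k < n) cc k * a ^+ k = rem / ((2 * pi)%:C)%C.
  apply: (mulIf tpi0); rewrite mulrBl -E divfK // mulr_suml.
  have -> : \sum_(k < n) a ^+ k * cint (fun t => p t * circle_inv r t ^+ k) 0 (2 * pi)
     = \sum_(i < n) cc i * a ^+ i * ((2 * pi)%:C)%C.
    apply: eq_bigr => k _; by rewrite /cc mulrAC divfK // mulrC.
  by rewrite addrAC subrr add0r.
rewrite normcM normcV normc_real (gtr0_norm pi0) ler_pdivrMr //.
apply: le_trans rB _; rewrite ler_pM2r //.
have qn : 0 <= (N a / r) ^+ n by rewrite exprn_ge0 // divr_ge0 ?normc_ge0 // ltW.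
have h2 : r / (r - N a) <= 2.
  by rewrite ler_pdivrMr ?subr_gt0 //; move: ar2; lra.
rewrite -[2 * M * _]mulrA [2 * _]mulrC; apply: ler_wpM2l => //.
exact: mulr_ge0.
Qed.

(** Retraction onto [[- s, s]]. Composing with it extends a function given near a point to a
    continuous one on the whole plane, as [cint] requires, without changing it on the open
    square. *)
Definition clampR (s x : R) : R := Num.max (- s) (Num.min s x).

Lemma clampR_norm s x : 0 <= s -> `|clampR s x| <= s.
Proof.
move=> s0; rewrite /clampR /Num.max /Num.min ler_norml.
by case: (ltP s x) => sx; case: ltP => ?; apply/andP; split; lra.
Qed.

Lemma clampR_id s x : `|x| < s -> clampR s x = x.
Proof.
rewrite ltr_norml => /andP[h1 h2]; rewrite /clampR.
by rewrite min_r ?max_r // ltW.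
Qed.

Lemma clampR_lip s x y : `|clampR s x - clampR s y| <= `|x - y|.
Proof.
rewrite /clampR /Num.max /Num.min ler_norml.
have := ler_norm (x - y); have := ler_norm (y - x); rewrite (distrC y x) => h1 h2.
case: (ltP s x) => sx; case: (ltP s y) => sy; do 2 case: ltP => ?;
  apply/andP; split; lra.
Qed.

(** The square of half-side [rho / 3] fits in the disc of radius [rho], the circle of radius
    [rho / 4] fits in the square, and [rho / 8] is half the radius of that circle. *)
Theorem cauchy_taylor f (z0 : C) (rho M : R) : 0 < rho ->
  (forall z, N (z - z0) < rho -> exists d, has_deriv id f z d) ->
  (forall z, N (z - z0) < rho -> N (f z) <= M) ->
  exists c : nat -> C, forall n a, N a <= rho / 8 ->
    N (f (z0 + a) - \sum_(k < n) c k * a ^+ k) <= 2 * M * (N a / (rho / 4)) ^+ n.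
Proof.
move=> rho0 df fM; set s := rho / 3.
have s0 : 0 < s by rewrite divr_gt0.
pose cl (z : C) : C := (clampR s (complex.Re z) +i* clampR s (complex.Im z))%C.
have cl_lip z w : N (cl z - cl w) <= 2 * N (z - w).
  apply: le_trans (normc_le_ReIm _) _ => /=.
  have := clampR_lip s (complex.Re z) (complex.Re w).
  have := clampR_lip s (complex.Im z) (complex.Im w).
  have := abs_Re_le (z - w); have := abs_Im_le (z - w); rewrite !raddfB /=.
  lra.
have clB z : N (z0 + cl z - z0) < rho.
  rewrite addrAC subrr add0r; apply: le_lt_trans (normc_le_ReIm _) _ => /=.
  have := clampR_norm (complex.Re z) (ltW s0).
  have := clampR_norm (complex.Im z) (ltW s0); rewrite /s; lra.
have clid z : square s z -> cl z = z.
  by case: z => x y [/= h1 h2]; rewrite /cl /= !clampR_id.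
pose F z := f (z0 + cl z).
have cF : continuous F.
  move=> z; have [d /has_deriv_continuous /continuous_normcP H] := df _ (clB z).
  apply/continuous_normcP => e e0.
  have /nbhs_normcP[r r0 rP] := H _ e0.
  apply/nbhs_normcP; exists (r / 2) => [|w wz]; first by rewrite divr_gt0.
  apply: rP; have -> : z0 + cl w - (z0 + cl z) = cl w - cl z by ring.
  by have := cl_lip w z; lra.
have dF z : square s z -> exists d, has_deriv id F z d.
  move=> sz; have [d Hd] := df _ (clB z); exists d.
  rewrite (clid _ sz) in Hd.
  have idD : has_deriv id (fun z : C => z) z 1 by exact: has_deriv_id.
  have H1 := has_derivD (@has_deriv_cst R _ id z0 z) idD.
  have H := has_deriv_comp H1 Hd; rewrite add0r mulr1 in H.
  have [h1 h2] := sz.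
  set m := Num.min (s - `|complex.Re z|) (s - `|complex.Im z|).
  have m0 : 0 < m by rewrite lt_min !subr_gt0 h1.
  apply: (has_deriv_near m0 _ _ H); last by rewrite /F clid.
  move=> h; rewrite lt_min => /andP[m1 m2]; rewrite /F clid //.
  have := abs_Re_le h; have := abs_Im_le h => k2 k1.
  split; rewrite raddfD /=.
    by have := ler_normD (complex.Re z) (complex.Re h); lra.
  by have := ler_normD (complex.Im z) (complex.Im h); lra.
have r40 : 0 < rho / 4 by rewrite divr_gt0.
have r4s : rho / 4 < s by rewrite /s; lra.
have [c cP] := cauchy_taylor_square cF r40 r4s dF (fun z _ => fM _ (clB z)).
exists c => n a ar; have ar' : N a <= rho / 4 / 2 by lra.
have sa : square s a.
  by split; [have := abs_Re_le a|have := abs_Im_le a]; rewrite /s; lra.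
by have := cP n a ar'; rewrite /F clid.
Qed.

End Taylor.

(** * Local behaviour of holomorphic functions *)

Section LocalBehaviour.
Variable R : realType.
Local Notation C := (Cplane R).
Local Notation N := (@normc R).
Implicit Types (f : C -> C) (z : C).

Definition holo_ball f z0 (rho : R) :=
  forall z, N (z - z0) < rho -> exists d, has_deriv id f z d.

Lemma holo_ball_bounded f z0 rho : 0 < rho -> holo_ball f z0 rho ->
  exists r M, [/\ 0 < r, r <= rho & forall z, N (z - z0) < r -> N (f z) <= M].
Proof.
move=> rho0 hf; have [|d /has_deriv_continuous] := hf z0.
  by rewrite subrr normc0.
move=> /continuous_normcP /(_ 1 ltr01) /nbhs_normcP[r r0 rP].
exists (Num.min r rho), (N (f z0) + 1); split.
- by rewrite lt_min r0.
- by rewrite ge_min lexx orbT.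
move=> z; rewrite lt_min => /andP[/rP /= h _].
by have := normc_le_add (f z - f z0) (f z0); rewrite subrK; lra.
Qed.

(** Cauchy's estimate, read off the expansion with one term, whose remainder at [h] is
    [2 * M * (N h / (rho / 4))]. *)
Lemma deriv_bound f z0 rho M d : 0 < rho -> holo_ball f z0 rho ->
  (forall z, N (z - z0) < rho -> N (f z) <= M) ->
  has_deriv id f z0 d -> N d <= 8 * M / rho.
Proof.
move=> rho0 hf fM df; have [c cP] := cauchy_taylor rho0 hf fM.
have r80 : 0 <= rho / 8 by rewrite divr_ge0 // ltW.
have c0 : f z0 = c 0.
  have := cP 1 0; rewrite normc0 => /(_ r80).
  rewrite addr0 big_ord1 expr0 mulr1 mul0r expr1 mulr0 => H.
  by apply/eqP; rewrite -subr_eq0 -normc_eq0P eq_le H normc_ge0.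
rewrite leNgt; apply/negP => dM.
set e := (N d - 8 * M / rho) / 2; have e0 : 0 < e by rewrite divr_gt0 // subr_gt0.
have [r r0 rP] := df _ e0.
set h := Num.min (r / 2) (rho / 8).
have h0 : 0 < h by rewrite lt_min !divr_gt0.
have hN : N (h%:C)%C = h by rewrite normc_real gtr0_norm.
have h1 : N (h%:C)%C < r.
  rewrite hN; apply: le_lt_trans (_ : r / 2 < r); last lra.
  by rewrite ge_min lexx.
have h2 : N (h%:C)%C <= rho / 8 by rewrite hN ge_min lexx orbT.
have k2 : N (f (z0 + (h%:C)%C) - f z0 - d * (h%:C)%C) <= e * N (h%:C)%C.
  exact: rP h1.
have := cP 1 _ h2; rewrite big_ord1 expr0 mulr1 expr1 -c0 => k1.
set u := f _ - f z0 in k1 k2 *.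
have := normc_le_add (- (u - d * (h%:C)%C)) u.
rewrite opprB subrK (normc_distC _ u) normcM => k3.
move: k1 k2 k3; rewrite hN => k1 k2 k3.
have : N d * h <= (e + 8 * M / rho) * h.
  have -> : (e + 8 * M / rho) * h = e * h + 2 * M * (h / (rho / 4)).
    by field; rewrite gt_eqF.
  lra.
rewrite ler_pM2r // /e; lra.
Qed.

(** Leading terms of [f - f z0] and of the derivative of [f]. The second bound is recorded because
    an estimate on [f] cannot simply be differentiated. *)
Definition has_order f z0 (m : nat) (c : C) (K r : R) :=
  (forall a, N a < r -> N (f (z0 + a) - f z0 - c * a ^+ m) <= K * N a ^+ m.+1) /\
  (forall a d, N a < r -> has_deriv id f (z0 + a) d ->
     N (d - m%:R * c * a ^+ m.-1) <= K * N a ^+ m).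

(** [m] is the first positive index with a nonzero Taylor coefficient; if there is none, the
    remainders force [f] to be constant on a disc. The bound on the derivative is Cauchy's estimate
    for [f] minus its leading terms, on the disc of radius [N a / 2] about [z0 + a]. *)
Lemma local_form f z0 rho : 0 < rho -> holo_ball f z0 rho ->
  (exists2 r : R, 0 < r & forall z, N (z - z0) < r -> f z = f z0) \/
  exists m c K r, [/\ (0 < m)%N, c != 0, 0 <= K, 0 < r <= rho &
    has_order f z0 m c K r].
Proof.
move=> rho0 hf0; have [s [M [s0 srho fM]]] := holo_ball_bounded rho0 hf0.
have hf : holo_ball f z0 s by move=> z zs; apply: hf0; exact: lt_le_trans srho.
have [c cP] := cauchy_taylor s0 hf fM.
have M0 : 0 <= M.
  by apply: le_trans (normc_ge0 (f z0)) (fM z0 _); rewrite subrr normc0.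
have c0 : f z0 = c 0.
  have := cP 1 0; rewrite normc0 => /(_ (ltW (divr_gt0 s0 _))).
  rewrite addr0 big_ord1 expr0 mulr1 mul0r expr1 mulr0 ltr0n => /(_ isT) H.
  by apply/eqP; rewrite -subr_eq0 -normc_eq0P eq_le H normc_ge0.
have [H|] := pselect (forall k, c k.+1 = 0).
  left; exists (s / 8) => [|z zs]; first by rewrite divr_gt0.
  have q0 : 0 <= N (z - z0) / (s / 4).
    by rewrite divr_ge0 ?normc_ge0 // divr_ge0 // ltW.
  have q1 : N (z - z0) / (s / 4) <= 2^-1.
    rewrite ler_pdivrMr ?divr_gt0 //; lra.
  apply/eqP; rewrite -subr_eq0 -normc_eq0P eq_le normc_ge0 andbT leNgt.
  apply/negP; set d := N _ => d0.
  have K0 : 0 < 2 * M + 1 by lra.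
  have dK0 : 0 < d / (2 * M + 1) by rewrite divr_gt0.
  have [n nP] := exists_expn_lt dK0.
  have := cP n.+1 _ (ltW zs); rewrite big_ord_recl big1 => [|k _]; last first.
    by rewrite H mul0r.
  rewrite expr0 mulr1 addr0 -c0 [z0 + _]addrC subrK -/d => E.
  have E2 : (N (z - z0) / (s / 4)) ^+ n.+1 <= (2^-1) ^+ n.
    apply: le_trans (_ : (2^-1) ^+ n.+1 <= _).
      by apply: lerXn2r; rewrite ?nnegrE ?invr_ge0.
    by rewrite exprS ler_piMl // ?exprn_ge0 // ?invf_le1 ?ler1n.
  have : 2 * M * (N (z - z0) / (s / 4)) ^+ n.+1 <= 2 * M * (2^-1) ^+ n.
    by rewrite ler_wpM2l // mulr_ge0.
  move: nP; rewrite ltr_pdivlMr // => nP.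
  have : 0 <= (2^-1 : R) ^+ n by rewrite exprn_ge0.
  lra.
move/existsNP => /= Hex.
have exm : exists k, c k.+1 != 0 by case: Hex => k /eqP ?; exists k.
case: (ex_minnP exm) => m' cm' mmin; right.
set m := m'.+1; set K1 := 2 * M / (s / 4) ^+ m.+1.
have K10 : 0 <= K1.
  by apply: divr_ge0; [exact: mulr_ge0|rewrite exprn_ge0 // divr_ge0 // ltW].
pose h z := f z - f z0 - c m * (z - z0) ^+ m.
have hB a : N a <= s / 8 -> N (h (z0 + a)) <= K1 * N a ^+ m.+1.
  move=> a8; have := cP m.+1 a a8; rewrite big_ord_recl big_ord_recr big1 /=.
    rewrite add0r expr0 mulr1 -c0 /bump /= add1n -/m opprD addrA.
    have -> : h (z0 + a) = f (z0 + a) - f z0 - c m * a ^+ m.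
      by rewrite /h [z0 + a]addrC addrK.
    move/le_trans; apply; rewrite /K1 expr_div_n.
    by rewrite le_eqVlt; apply/orP; left; apply/eqP; ring.
  move=> i _; rewrite /bump /= add1n.
  have [->|/mmin] := eqVneq (c i.+1) 0; first by rewrite mul0r.
  by rewrite leqNgt ltn_ord.
have dh z d : has_deriv id f z d ->
    has_deriv id h z (d - m%:R * c m * (z - z0) ^+ m').
  move=> df; have H1 := has_derivB df (@has_deriv_cst R _ id (f z0) z).
  have idD : has_deriv id (fun z : C => z) z 1 by exact: has_deriv_id.
  have H2 := has_derivX m (has_derivB idD (@has_deriv_cst R _ id z0 z)).
  have H3 := has_derivB H1 (has_derivZ (c m) H2).
  have -> : d - m%:R * c m * (z - z0) ^+ m' =
    d - 0 - c m * (m%:R * (z - z0) ^+ m.-1 * (1 - 0)) by rewrite /m /=; ring.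
  exact: H3.
(* Points of the disc of radius [N a / 2] about [z0 + a] are within [3 / 2 * N a] of [z0], and [8]
   divided by half of [N a] gives [16]. The radius [s / 12] below makes [3 / 2 * N a] at most
   [s / 8]. *)
pose K := Num.max K1 (16 * K1 * (3 / 2) ^+ m.+1).
have K0 : 0 <= K by rewrite le_max K10.
exists m, (c m), K, (s / 12); split => //.
  by rewrite divr_gt0 //=; lra.
split=> [a a12|a d a12 df].
  have a8 : N a <= s / 8 by lra.
  have := hB _ a8; rewrite /h [z0 + a]addrC addrK => /le_trans; apply.
  by rewrite ler_wpM2r ?exprn_ge0 ?normc_ge0 // le_max lexx.
have := dh _ _ df; have -> : z0 + a - z0 = a by ring.
set dd := d - _ => Hdd; rewrite -[X in N X]/dd.
(* At [a = 0] the auxiliary disc degenerates, but there [h] vanishes to order at least [2], so its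
   derivative is [0]. *)
have [a0|a0] := eqVneq a 0.
  suff -> : dd = 0 by rewrite normc0 mulr_ge0 // exprn_ge0 // normc_ge0.
  rewrite a0 addr0 in Hdd; apply: has_deriv_unique Hdd _ => e e0.
  have K11 : 0 < K1 + 1 by lra.
  exists (Num.min (s / 8) (Num.min 1 (e / (K1 + 1)))) => [|b].
    by rewrite !lt_min ltr01 !divr_gt0.
  rewrite !lt_min => /and3P[b8 b1 be].
  have h0 : h z0 = 0 by rewrite /h !subrr expr0n /= mulr0 subrr.
  rewrite h0 mul0r !subr0; apply: le_trans (hB _ (ltW b8)) _.
  rewrite exprSr mulrA; apply: ler_wpM2r; first exact: normc_ge0.
  apply: le_trans (_ : (K1 + 1) * N b <= _); last first.
    by rewrite mulrC -ler_pdivlMr // ltW.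
  apply: ler_pM => //; first by rewrite exprn_ge0 // normc_ge0.
    by rewrite lerDl.
  by rewrite /m exprS ler_piMr ?normc_ge0 // exprn_ile1 ?normc_ge0 // ltW.
have Na0 : 0 < N a by rewrite normc_gt0P.
have inb z : N (z - (z0 + a)) < N a / 2 -> N (z - z0) <= 3 / 2 * N a.
  move=> zb; have := normc_dist_add z (z0 + a) z0.
  have -> : z0 + a - z0 = a by ring.
  lra.
have hol : holo_ball h (z0 + a) (N a / 2).
  move=> z /inb zb; have [|d' Hd'] := hf z; first by move: a12; lra.
  by eexists; exact: dh Hd'.
have hM z : N (z - (z0 + a)) < N a / 2 ->
    N (h z) <= K1 * (3 / 2 * N a) ^+ m.+1.
  move=> /inb zb; have -> : z = z0 + (z - z0) by ring.
  apply: le_trans (hB _ _) _; first by move: a12; lra.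
  apply: ler_wpM2l => //; apply: lerXn2r => //.
    by rewrite nnegrE normc_ge0.
  by rewrite nnegrE mulr_ge0 // normc_ge0.
have := deriv_bound (divr_gt0 Na0 (ltr0Sn _ 1)) hol hM Hdd.
move=> /le_trans; apply.
have -> : 8 * (K1 * (3 / 2 * N a) ^+ m.+1) / (N a / 2) =
    16 * K1 * (3 / 2) ^+ m.+1 * N a ^+ m.
  have alg (k u v n : R) : n != 0 ->
    8 * (k * (u * (n * v))) / (n / 2) = 16 * k * u * v by move=> ?; field.
  by rewrite exprMn [N a ^+ m.+1]exprS alg // lt0r_neq0.
by rewrite ler_wpM2r ?exprn_ge0 ?normc_ge0 // le_max lexx orbT.
Qed.

(** The leading term [m * c * a ^+ m.-1] of the derivative exceeds its error [K * N a ^+ m] once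
    [N a < N c / (K + 1)]. *)
Lemma zeros_deriv_isolated f z0 m c K r : (0 < m)%N -> c != 0 -> 0 < r ->
  0 <= K -> has_order f z0 m c K r ->
  exists2 r' : R, 0 < r' & forall z d, 0 < N (z - z0) < r' ->
    has_deriv id f z d -> d != 0.
Proof.
move=> m0 c0 r0 K0 [_ H]; exists (Num.min r (N c / (K + 1))).
  by rewrite lt_min r0 divr_gt0 ?normc_gt0P // ltr_wpDl.
move=> z d; rewrite lt_min => /and3P[z0' zr zK] df; apply/eqP => d0.
have zE : z = z0 + (z - z0) by ring.
rewrite zE in df; have := H _ _ zr df; rewrite d0 sub0r normc_opp.
rewrite !normcM normc_exp -[in N _ ^+ m](prednK m0) exprS mulrA.
rewrite ler_pM2r ?exprn_gt0 //.
have : 1 <= N (m%:R : C).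
  have -> : m%:R = ((m%:R : R)%:C)%C :> C by rewrite rmorph_nat.
  by rewrite normc_real ger0_norm ?ler1n.
move: zK; rewrite ltr_pdivlMr ?ltr_wpDl // => h1 h2 h3.
have : N c <= N (m%:R : C) * N c by rewrite ler_peMl ?normc_ge0.
have : 0 <= N (z - z0) by exact: normc_ge0.
have : N (z - z0) * (K + 1) = K * N (z - z0) + N (z - z0) by ring.
lra.
Qed.

Lemma exists_root (m : nat) (w : C) : (0 < m)%N -> exists a : C, a ^+ m = w.
Proof. by move=> m0; exists (m.-root (w : R[i])); exact: rootCK. Qed.

(** With [c * w ^+ m = s * f z0] for [s] equal to [1] or [-1], the leading term at [u * w] is
    [s * u ^+ m * f z0]: the value moves radially outwards or inwards, up to a remainder of higher
    order in [u]. *)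
Lemma no_local_extremum f z0 m c K r : (0 < m)%N -> c != 0 -> 0 < r ->
  0 <= K -> has_order f z0 m c K r -> f z0 != 0 -> forall e : R, 0 < e ->
  (exists2 z, N (z - z0) < e & N (f z0) < N (f z)) /\
  (exists2 z, N (z - z0) < e & N (f z) < N (f z0)).
Proof.
move=> m0 c0 r0 K0 [H _] f0 e e0.
have nf0 : 0 < N (f z0) by rewrite normc_gt0P.
have key (s : R) : s ^+ 2 = 1 -> exists t z : _, [/\ 0 < t, t < 1, N (z - z0) < e &
    N (f z - f z0 * ((1 + s * t)%:C)%C) < t * N (f z0)].
  move=> s2; have [w wE] := exists_root (f z0 / c * (s%:C)%C) m0.
  have w0 : w != 0.
    apply/eqP => w0; move: wE; rewrite w0 expr0n eqn0Ngt m0 /= => /esym/eqP.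
    rewrite !mulf_eq0 invr_eq0 (negbTE f0) (negbTE c0) /= -normc_eq0P normc_real.
    by rewrite normr_eq0 => /eqP s0; move: s2; rewrite s0 expr0n /= => /eqP;
      rewrite eq_sym oner_eq0.
  have W0 : 0 < N w by rewrite normc_gt0P.
  set B := K * N w ^+ m.+1 + 1.
  have B0 : 0 < B by rewrite ltr_wpDl // mulr_ge0 // exprn_ge0 // ltW.
  (* The entries keep, in order, [t = u ^+ m] below [1], the remainder below [t * N (f z0)], and the
     point in the discs of radius [r] and [e]. *)
  set u := Num.min (Num.min (1 / 2) (N (f z0) / B))
     (Num.min (r / (2 * N w)) (e / (2 * N w))).
  have u0 : 0 < u by rewrite !lt_min !divr_gt0 // mulr_gt0.
  have u1 : u < 1.
    by apply: le_lt_trans (_ : 1 / 2 < 1); [rewrite !ge_min lexx|lra].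
  have ub : u <= N (f z0) / B by rewrite !ge_min lexx !orbT.
  have ur : u * N w < r.
    apply: le_lt_trans (_ : r / (2 * N w) * N w < r).
      by rewrite ler_pM2r // !ge_min lexx !orbT.
    have -> : r / (2 * N w) * N w = r / 2 by field; rewrite gt_eqF.
    lra.
  have ue : u * N w < e.
    apply: le_lt_trans (_ : e / (2 * N w) * N w < e).
      by rewrite ler_pM2r // !ge_min lexx !orbT.
    have -> : e / (2 * N w) * N w = e / 2 by field; rewrite gt_eqF.
    lra.
  have NaE : N ((u%:C)%C * w) = u * N w by rewrite normcM normc_real gtr0_norm.
  exists (u ^+ m), (z0 + (u%:C)%C * w); split.
  - by rewrite exprn_gt0.
  - by rewrite exprn_ilt1 ?ltW // -lt0n.
  - by rewrite addrAC subrr add0r NaE.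
  have := H ((u%:C)%C * w); rewrite NaE => /(_ ur).
  have -> : c * ((u%:C)%C * w) ^+ m = f z0 * ((s * u ^+ m)%:C)%C.
    rewrite exprMn wE rmorphM rmorphXn /=.
    move: ((u%:C)%C ^+ m) ((s%:C)%C) => x y; field; exact: c0.
  rewrite rmorphD /= rmorph1 mulrDr mulr1 opprD addrA.
  move/le_lt_trans; apply.
  rewrite exprMn exprS.
  have -> : K * (u * u ^+ m * N w ^+ m.+1) = u ^+ m * (u * (K * N w ^+ m.+1)) by ring.
  rewrite ltr_pM2l ?exprn_gt0 //.
  move: ub; rewrite ler_pdivlMr // /B mulrDr mulr1; lra.
split.
- have [|t [z [t0 t1 ze hz]]] := key 1; first by rewrite expr1n.
  exists z => //; have := normc_sub_le (f z0 * ((1 + 1 * t)%:C)%C) (f z).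
  rewrite normc_distC normcM normc_real mul1r ger0_norm; last lra.
  rewrite mulrDr mulr1; move: hz; rewrite mul1r mulrC; lra.
- have [|t [z [t0 t1 ze hz]]] := key (-1); first by rewrite sqrrN expr1n.
  exists z => //; have := normc_sub_le (f z) (f z0 * ((1 + -1 * t)%:C)%C).
  rewrite normcM normc_real mulN1r ger0_norm; last lra.
  rewrite mulrDr mulr1 mulrN; move: hz; rewrite mulN1r mulrC; lra.
Qed.

(** A nonzero derivative forces order one, so the derivative stays within [e] of [d] near [z0]. The
    mean value inequality for [f - d * id] along a segment then compares two arbitrary nearby
    points, as monotonicity requires. *)
Lemma strict_deriv f z0 rho d : 0 < rho -> holo_ball f z0 rho ->
  has_deriv id f z0 d -> d != 0 -> forall e : R, 0 < e ->
  exists2 r : R, 0 < r <= rho & forall z w, N (z - z0) < r -> N (w - z0) < r ->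
    N (f z - f w - d * (z - w)) <= e * N (z - w).
Proof.
move=> rho0 hf df d0 e e0.
have [[r r0 rP]|[m [c [K [r [m0 c0 K0 /andP[r0 rrho] [_ H]]]]]]] :=
  local_form rho0 hf.
  case/negP: d0; apply/eqP.
  have : has_deriv id f z0 0.
    apply: (has_deriv_near r0 _ _ (@has_deriv_cst R _ id (f z0) z0)) => // h hr.
    by rewrite rP // addrAC subrr add0r.
  exact: has_deriv_unique df.
have := H 0 d; rewrite normc0 addr0 => /(_ r0 df).
rewrite [0 ^+ m]expr0n eqn0Ngt m0 mulr0 => H0.
have dE : d = m%:R * c * 0 ^+ m.-1.
  by apply/eqP; rewrite -subr_eq0 -normc_eq0P eq_le normc_ge0 H0.
(* The power [0 ^+ m.-1] is nonzero for [m = 1] only. *)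
have m1 : m = 1%N.
  case: m m0 dE {H H0} => [|[|m]] // _; rewrite expr0n /= mulr0 => /eqP.
  by rewrite (negbTE d0).
have {}dE : d = c by rewrite dE m1 -[1.-1]/0%N expr0 mulr1 mul1r.
rewrite m1 -[1.-1]/0%N -dE in H.
set s := Num.min r (e / (K + 1)).
have K1 : 0 < K + 1 by lra.
have s0 : 0 < s by rewrite lt_min r0 divr_gt0.
exists s; first by rewrite s0 ge_min rrho.
move=> z w zs ws.
pose q (t : R) : C := w + (t%:C)%C * (z - w).
have qs t : 0 <= t <= 1 -> N (q t - z0) < s.
  move=> /andP[t0 t1].
  have -> : q t - z0 = ((1 - t)%:C)%C * (w - z0) + (t%:C)%C * (z - z0).
    by rewrite /q rmorphB rmorph1; ring.
  apply: le_lt_trans (normc_le_add _ _) _; rewrite !normcM !normc_real.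
  rewrite !ger0_norm ?subr_ge0 //.
  have [t00|t00] := eqVneq t 0.
    by rewrite t00 subr0 mul1r mul0r addr0.
  have : t * N (z - z0) < t * s by rewrite ltr_pM2l // lt_neqAle eq_sym t00.
  have : (1 - t) * N (w - z0) <= (1 - t) * s by rewrite ler_wpM2l ?subr_ge0 // ltW.
  have -> : (1 - t) * s = s - t * s by ring.
  lra.
have dq t : curve_deriv q t (z - w).
  have idD : curve_deriv (fun t : R => (t%:C)%C) t 1.
    by apply: has_deriv_id => h; rewrite rmorphD.
  have := has_derivD (@has_deriv_cst R R _ w t)
    (has_derivM idD (@has_deriv_cst R R _ (z - w) t)).
  by rewrite add0r mul1r mulr0 addr0.
pose p (t : R) : C := f (q t) - d * q t.
pose f' (v : C) : C := xget 0 [set d' | has_deriv id f v d'].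
have f'P v : N (v - z0) < s -> has_deriv id f v (f' v).
  move=> vs; rewrite /f'; case: xgetP => [//|nH].
  have [|d' Hd'] := hf v; last by case: (nH d').
  by apply: lt_le_trans vs _; rewrite ge_min rrho.
have dp t : 0 <= t <= 1 -> curve_deriv p t ((f' (q t) - d) * (z - w)).
  move=> t01; have h1 := has_deriv_comp (dq t) (f'P _ (qs _ t01)).
  by rewrite mulrBl; exact: has_derivB h1 (has_derivZ d (dq t)).
have pb t : 0 <= t <= 1 -> N ((f' (q t) - d) * (z - w)) <= e * N (z - w).
  move=> t01; rewrite normcM ler_wpM2r ?normc_ge0 //.
  have qts := qs _ t01; have qE : q t = z0 + (q t - z0) by ring.
  have Hq := f'P _ qts; rewrite {1}qE in Hq.
  have := H (q t - z0) _ _ Hq; rewrite expr0 mul1r mulr1 expr1.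
  have := qts; rewrite lt_min => /andP[qr qe] /(_ qr) /le_trans; apply.
  move: qe; rewrite ltr_pdivlMr //.
  have := normc_ge0 (q t - z0); rewrite mulrDr mulr1 [_ * K]mulrC; lra.
have := curve_mean_value ler01 dp pb.
rewrite subr0 mulr1 /p /q mul1r mul0r addr0.
suff -> : f (w + (z - w)) - d * (w + (z - w)) - (f w - d * w) =
  f z - f w - d * (z - w) by [].
have -> : w + (z - w) = z by ring.
ring.
Qed.

End LocalBehaviour.

(** * Compactness in the plane and the circle-valued argument *)

Section PlaneTopology.
Variable R : realType.
Local Notation C := (Cplane R).
Local Notation N := (@normc R).

(** Carrying a small [e] as a second parameter lets one covering argument yield the Lebesgue number,
    lower bounds and boundedness. *)
Lemma compact_uniform (K : set C) (P : R -> C -> Prop) : compact K ->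
  (forall z, K z -> exists2 d : R, 0 < d &
     forall w e, N (w - z) < d -> 0 < e < d -> P e w) ->
  exists2 d : R, 0 < d & forall e w, 0 < e < d -> K w -> P e w.
Proof.
move=> /compact_near_coveringP cK H.
have [d /= d0 dP] : \forall e \near (0 : R)^'+, K `<=` P e.
  apply: cK => z /H[d d0 dP].
  exists ([set w | N (w - z) < d], [set e | 0 < e < d]) => /=.
    split; first exact: nbhsN_ball.
    exists d => //= e; rewrite /ball /= sub0r normrN => ed e0.
    by rewrite e0 (le_lt_trans (ler_norm _) ed).
  by move=> [w e] /= [wz e0]; exact: dP.
exists d => // e w /andP[e0 ed] Kw; apply: dP => //=.
by rewrite /ball /= sub0r normrN gtr0_norm.
Qed.

Lemma lebesgue_number (K : set C) (T : C -> C -> Prop) : compact K ->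
  (forall z, K z -> exists2 d : R, 0 < d &
     forall w w', N (w - z) < d -> N (w' - z) < d -> T w w') ->
  exists2 d : R, 0 < d & forall w w', K w -> N (w' - w) < d -> T w w'.
Proof.
move=> cK H.
have [|d d0 dP] := @compact_uniform K
    (fun e w => forall w', N (w' - w) < e -> T w w') cK.
  move=> z /H[d d0 dP]; exists (d / 2) => [|w e wz /andP[e0 ed] w' ww'].
    by rewrite divr_gt0.
  apply: dP; first lra.
  by have := normc_dist_add w' w z; lra.
exists (d / 2) => [|w w' Kw ww']; first by rewrite divr_gt0.
apply: (dP (d / 2) w _ Kw w' ww'); apply/andP; split; lra.
Qed.

Lemma compact_away_zero (K : set C) (v : C -> R) : compact K ->
  (forall z, K z -> {for z, continuous v}) -> (forall z, K z -> v z != 0) ->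
  exists2 d : R, 0 < d & forall z, K z -> d <= `|v z|.
Proof.
move=> cK cv v0.
have [|d d0 dP] := @compact_uniform K (fun e w => e <= `|v w|) cK.
  move=> z Kz; have vz : 0 < `|v z| / 2 by rewrite divr_gt0 // normr_gt0 v0.
  have /continuous_absP /(_ _ vz) /nbhs_normcP[r r0 rP] := cv _ Kz.
  exists (Num.min r (`|v z| / 2)) => [|w e]; first by rewrite lt_min r0.
  rewrite !lt_min => /andP[wr _] /and3P[e0 _ ev].
  have := rP _ wr; have := ler_distD (v w) (v z) 0; rewrite !subr0.
  by rewrite (distrC (v z)); lra.
exists (d / 2) => [|z Kz]; first by rewrite divr_gt0.
by apply: dP => //; apply/andP; split; lra.
Qed.

(** The form in which connectedness is used for continuation: [P] will be membership in a set, a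
    sign, or an equality of two numbers. *)
Lemma connected_locally_constant (A : set C) (P : C -> Prop) : connected A ->
  (forall z, A z -> \forall w \near z, A w -> (P w <-> P z)) ->
  forall a b, A a -> A b -> P a -> P b.
Proof.
move=> cA lP a b Aa Ab Pa.
pose O : set C := [set z : C | \forall w \near z, A w -> P w].
pose O' : set C := [set z : C | \forall w \near z, A w -> ~ P w].
have oO (Q : C -> Prop) : open [set z : C | \forall w \near z, A w -> Q w].
  rewrite openE => z /= /nbhs_normcP[r r0 rP].
  apply/nbhs_normcP; exists (r / 2) => [|w wz /=]; first by rewrite divr_gt0.
  apply/nbhs_normcP; exists (r / 2) => [|v vw]; first by rewrite divr_gt0.
  by apply: rP; have := normc_dist_add v w z; lra.
have self (Q : C -> Prop) (z : C) : (\forall w \near z, Q w) -> Q z by exact: nbhs_singleton.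
have AO z : A z -> (P z <-> O z).
  move=> Az; split=> [Pz|/self]; last exact.
  by move: (lP _ Az); apply: filterS => w H /H ->.
have AO' z : A z -> (~ P z <-> O' z).
  move=> Az; split=> [Pz|/self]; last exact.
  by move: (lP _ Az); apply: filterS => w H /H ->.
have AE : A `&` [set z | P z] = A.
  apply: cA; first by exists a.
  - exists O; first exact: oO.
    by apply/seteqP; split=> z [Az Pz]; split=> //; apply/AO.
  - exists (~` O'); first by apply: open_closedC; exact: oO.
    apply/seteqP; split=> z [Az Pz]; split=> //.
      by move=> /(AO' _ Az).
    by apply: contrapT => /(AO' _ Az).
have [_ Pb] : (A `&` [set z | P z]) b by rewrite AE.
exact: Pb.
Qed.

Lemma compactN_ball (z : C) (rho : R) : compact [set w : C | N (w - z) <= rho].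
Proof.
pose f (p : R * R) : C := (p.1 +i* p.2)%C.
have cf : continuous f.
  by move=> p; apply: continuous_ReIm; [exact: cvg_fst|exact: cvg_snd].
case: z => x y.
pose K := `[x - rho, x + rho]%classic `*` `[y - rho, y + rho]%classic : set (R * R).
have cK : compact (f @` K).
  apply: continuous_compact; first exact: continuous_subspaceT.
  by apply: compact_setX; exact: segment_compact.
apply: (subclosed_compact _ cK); first exact: closedN_ball.
move=> [u v] /= uv; exists (u, v) => //.
have := le_trans (abs_Re_le ((u +i* v) - (x +i* y))%C) uv.
have := le_trans (abs_Im_le ((u +i* v) - (x +i* y))%C) uv.
rewrite /= !ler_norml => /andP[? ?] /andP[? ?].
by split; rewrite /= in_itv /=; apply/andP; split; lra.
Qed.

Lemma compact_closed_bounded (A : set C) (z : C) (rho : R) : closed A ->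
  A `<=` [set w : C | N (w - z) <= rho] -> compact A.
Proof. by move=> clA; apply: subclosed_compact => //; exact: compactN_ball. Qed.

Lemma compactC_closed (A : set C) : compact A -> closed A.
Proof. by apply: compact_closed; exact: norm_hausdorff. Qed.

Lemma compactC_bounded (A : set C) : compact A ->
  exists2 r : R, 0 < r & forall z, A z -> N z < r.
Proof.
move=> cA.
have [|d d0 dP] := @compact_uniform A (fun e w => N w < e^-1) cA.
  move=> z _; have n0 : 0 < N z + 1 by rewrite ltr_wpDl // normc_ge0.
  exists (Num.min 1 (N z + 1)^-1) => [|w e]; first by rewrite lt_min ltr01 invr_gt0.
  rewrite !lt_min => /andP[w1 _] /and3P[e0 _ ez].
  have : N z + 1 < e^-1 by rewrite -[N z + 1]invrK ltf_pV2 ?posrE // invr_gt0.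
  by have := normc_le_add (w - z) z; rewrite subrK; lra.
exists (d / 2)^-1 => [|z Az]; first by rewrite invr_gt0 divr_gt0.
by apply: dP => //; apply/andP; split; lra.
Qed.

Definition thicken (K : set C) (d : R) : set C :=
  [set z | exists2 k, K k & N (z - k) < d].

Lemma thicken_open K d : open (thicken K d).
Proof.
rewrite openE => z [k Kk zk]; apply/nbhs_normcP; exists (d - N (z - k)).
  by rewrite subr_gt0.
by move=> w wz; exists k => //; have := normc_dist_add w z k; lra.
Qed.

Lemma closure_normcP (A : set C) (z : C) :
  closure A z <-> forall e : R, 0 < e -> exists2 w, A w & N (w - z) < e.
Proof.
split=> [clz e e0|H B /nbhs_normcP[e e0 eB]].
  by have [w [Aw wz]] := clz _ (nbhsN_ball z e0); exists w.
by have [w Aw wz] := H _ e0; exists w; split => //; exact: eB.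
Qed.

Lemma thicken_closure K d e z : d < e -> closure (thicken K d) z -> thicken K e z.
Proof.
move=> de /closure_normcP /(_ (e - d)); rewrite subr_gt0 => /(_ de)[w [k Kk wk] wz].
exists k => //; have := normc_dist_add z w k.
by rewrite (normc_distC z w); lra.
Qed.

Lemma compact_thicken (K O : set C) : compact K -> open O -> K `<=` O ->
  exists2 d : R, 0 < d & thicken K d `<=` O.
Proof.
move=> cK oO KO; have [|d d0 dP] := @lebesgue_number K (fun _ w => O w) cK.
  move=> z /KO Oz; have /nbhs_normcP[r r0 rP] : nbhs z O by exact: open_nbhs_nbhs.
  by exists r => // w w' _; exact: rP.
by exists d => // z [k Kk]; exact: dP.
Qed.

End PlaneTopology.

(** * The circle-valued argument and the exclusion of a single crossing *)

Section NoReturn.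
Variable R : realType.
Local Notation C := (Cplane R).
Local Notation N := (@normc R).

(** Representative modulo [1] nearest to [0]: a small increment of an argument measured in turns. *)
Definition centered_frac (x : R) : R := x - (Num.floor (x + 1 / 2))%:~R.

Lemma centered_fracP (x : R) (m : int) : `|x - m%:~R| < 1 / 2 ->
  centered_frac x = x - m%:~R.
Proof.
move=> xm; rewrite /centered_frac; congr (_ - _%:~R).
apply: floor_def; move: xm; rewrite ltr_norml => /andP[h1 h2].
rewrite intrD; apply/andP; split; lra.
Qed.

Lemma int_small_eq0 (m : int) : `|m%:~R : R| < 1 -> m%:~R = 0 :> R.
Proof.
rewrite -intr_norm -[1](mulr1z 1) ltr_int => h.
suff -> : m = 0 by [].
by apply/eqP; rewrite -normr_eq0; move: h; case: `|m| (normr_ge0 m) => [[|n]|n].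
Qed.

Section AngleLift.
Variables (H : C -> R) (rho d : R).
Hypotheses (rho0 : 0 < rho) (d0 : 0 < d).
Hypothesis Hd : forall w w', N w <= rho -> N w' <= rho -> N (w - w') < d ->
  exists m : int, `|H w - H w' - m%:~R| < 1 / 8.

(* The lift sums the small increments of [H] along the radius. *)
Lemma angle_lift : exists theta : C -> R,
  forall z z', N z <= rho -> N z' <= rho -> N (z - z') < d ->
    theta z - theta z' = centered_frac (H z - H z').
Proof.
pose D w w' := centered_frac (H w - H w').
have DP w w' : N w <= rho -> N w' <= rho -> N (w - w') < d ->
    `|D w w'| < 1 / 8 /\ exists m : int, H w - H w' = D w w' + m%:~R.
  move=> wr wr' /(Hd wr wr')[m hm].
  have E : D w w' = H w - H w' - m%:~R by apply: centered_fracP; lra.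
  by split; [rewrite E|exists m; rewrite E; ring].
have [n nP] : exists n : nat, rho / n.+1%:R < d.
  exists (Num.bound (rho / d)); rewrite ltr_pdivrMr ?ltr0n //.
  have := archi_boundP (divr_ge0 (ltW rho0) (ltW d0)).
  rewrite ltr_pdivrMr // => h; apply: lt_trans h _.
  by rewrite mulrC ltr_pM2l // ltr_nat.
pose s (k : nat) : R := k%:R / n.+1%:R.
have s01 k : (k <= n.+1)%N -> 0 <= s k <= 1.
  by move=> kn; rewrite /s divr_ge0 //= ler_pdivrMr ?ltr0n // mul1r ler_nat.
pose pt k (z : C) : C := ((s k)%:C)%C * z.
have ptN k z : (k <= n.+1)%N -> N z <= rho -> N (pt k z) <= rho.
  move=> /s01/andP[sk0 sk1] zr; rewrite normcM normc_real ger0_norm //.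
  by apply: le_trans zr; rewrite ler_piMl // normc_ge0.
have pt_step k z : N z <= rho -> N (pt k.+1 z - pt k z) < d.
  move=> zr; rewrite /pt -mulrBl -rmorphB normcM normc_real.
  have -> : s k.+1 - s k = n.+1%:R^-1 by rewrite /s -natr1; ring.
  rewrite ger0_norm ?invr_ge0 //; apply: le_lt_trans nP.
  by rewrite mulrC ler_pM2r ?invr_gt0 ?ltr0n.
have pt_near k z z' : (k <= n.+1)%N -> N (z - z') < d -> N (pt k z - pt k z') < d.
  move=> /s01/andP[sk0 sk1] zz; rewrite /pt -mulrBr normcM normc_real ger0_norm //.
  by apply: le_lt_trans zz; rewrite ler_piMl // normc_ge0.
exists (fun z => \sum_(k < n.+1) D (pt k.+1 z) (pt k z)) => z z' zr zr' zz.
(* Induction over the quadrilaterals between the radii of [z] and [z']: the four increments round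
   each one, of size below [1 / 8], add up to an integer, hence to [0]. At [k = n.+1] the sample
   points are [z] and [z'] themselves. *)
have key k : (k <= n.+1)%N ->
    \sum_(j < k) D (pt j.+1 z) (pt j z) - \sum_(j < k) D (pt j.+1 z') (pt j z') =
    D (pt k z) (pt k z').
  elim: k => [_|k IH kn].
    rewrite !big_ord0 subrr /pt /s mul0r !mul0r /D subrr.
    by rewrite (@centered_fracP 0 0) ?subr0 ?normr0 ?divr_gt0.
  have kn' : (k <= n.+1)%N by exact: ltnW.
  rewrite !big_ord_recr /=.
  have [d1 [m1 e1]] := DP _ _ (ptN _ _ kn zr) (ptN _ _ kn' zr) (pt_step k _ zr).
  have [d2 [m2 e2]] := DP _ _ (ptN _ _ kn zr') (ptN _ _ kn' zr') (pt_step k _ zr').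
  have [d3 [m3 e3]] := DP _ _ (ptN _ _ kn zr) (ptN _ _ kn zr') (pt_near _ _ _ kn zz).
  have [d4 [m4 e4]] := DP _ _ (ptN _ _ kn' zr) (ptN _ _ kn' zr') (pt_near _ _ _ kn' zz).
  move: (IH kn').
  set S1 := \sum_(_ < _) _; set S2 := \sum_(_ < _) _ => IH'.
  set D1 := D _ _ in d1 e1 *; set D2 := D _ _ in d2 e2 *.
  set D3 := D _ _ in d3 e3 *; set D4 := D _ _ in d4 e4 IH' *.
  have E : D1 - D2 + D4 - D3 = (m2 + m3 - m1 - m4)%:~R.
    by rewrite !(intrD, intrB, intrN); lra.
  have small : `|(m2 + m3 - m1 - m4)%:~R : R| < 1.
    rewrite -E; move: d1 d2 d3 d4; rewrite !ltr_norml.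
    by move=> /andP[? ?] /andP[? ?] /andP[? ?] /andP[? ?]; apply/andP; split; lra.
  have := int_small_eq0 small; rewrite -E; lra.
rewrite key // /pt /s divff ?pnatr_eq0 // !mul1r.
by [].
Qed.

End AngleLift.

(** Affine from [0] to [1] on [[- e, e]] and an integer outside, so that modulo [1] it sees only the
    zone where [|x| < e]. *)
Definition ramp (e x : R) : R := Num.max 0 (Num.min 1 ((x + e) / (2 * e))).

Lemma ramp_lip e x y : 0 < e -> `|ramp e x - ramp e y| <= `|x - y| / (2 * e).
Proof.
move=> e0; have e20 : 0 < 2 * e by rewrite mulr_gt0.
have -> : `|x - y| / (2 * e) = `|(x + e) / (2 * e) - (y + e) / (2 * e)|.
  rewrite -mulrBl normrM [`|(2 * e)^-1|]gtr0_norm ?invr_gt0 //.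
  by congr (`|_| / _); ring.
rewrite /ramp /Num.max /Num.min; move: (_ / _) (_ / _) => u v; rewrite ler_norml.
have := ler_norm (u - v); have := ler_norm (v - u); rewrite (distrC v u) => h1 h2.
by case: (ltP 1 u) => su; case: (ltP 1 v) => sv; do 2 case: ltP => ?;
  apply/andP; split; lra.
Qed.

Lemma ramp_ge e x : 0 < e -> e <= x -> ramp e x = 1.
Proof.
move=> e0 ex; rewrite /ramp min_l ?max_r //.
by rewrite ler_pdivlMr ?mulr_gt0 //; lra.
Qed.

Lemma ramp_le e x : 0 < e -> x <= - e -> ramp e x = 0.
Proof.
move=> e0 ex; rewrite /ramp max_l // ge_min; apply/orP; right.
by rewrite ler_pdivrMr ?mulr_gt0 // mul0r; lra.
Qed.

Lemma ramp_int e x : 0 < e -> e <= `|x| -> exists m : int, ramp e x = m%:~R.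
Proof.
move=> e0; rewrite ler_normr => /orP[ex|ex].
  by exists 1; rewrite ramp_ge.
by exists 0; rewrite ramp_le //; lra.
Qed.

(* A closed curve [P `|` S] cannot cross the zero set of [u] exactly once:
   [exp (2 i pi (ramp e u))], extended by [1] outside [U], has a continuous
   argument, which would change by one turn along [S] and be constant on [P]. *)
Lemma no_single_crossing (u : C -> R) (U P S : set C) (p q : C) (rho : R) :
  open U -> (forall z, closure U z -> N z <= rho) ->
  (forall z, closure U z -> {for z, continuous u}) ->
  (forall z, closure U z -> ~ U z -> u z != 0) ->
  connected P -> (forall z, P z -> N z < rho) -> P `&` U = set0 ->
  connected S -> compact S -> (forall z, S z -> N z < rho) ->
  (forall z, S z -> {for z, continuous u}) ->
  (forall z, S z -> ~ U z -> u z != 0) ->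
  P p -> P q -> S p -> S q -> u p < 0 -> 0 < u q -> False.
Proof.
move=> oU Ub cu u0 coP Pb PU coS cS Sb cuS u0S Pp Pq Sp Sq up uq.
have rho0 : 0 < rho by exact: le_lt_trans (normc_ge0 p) (Pb _ Pp).
have clbd : closed (closure U `\` U).
  by rewrite setDE; apply: closedI; [exact: closed_closure|exact: open_closedC].
have cbd : compact (closure U `\` U).
  apply: (@compact_closed_bounded _ _ 0 rho clbd) => z [/Ub zr _] /=.
  by rewrite subr0.
have cSU : compact (S `\` U).
  apply: (subclosed_compact _ cS); last by move=> z [].
  rewrite setDE; apply: closedI; [exact: compactC_closed cS|exact: open_closedC].
have [e1 e10 e1P] : exists2 d : R, 0 < d & forall z, (closure U `\` U) z -> d <= `|u z|.
  apply: compact_away_zero => // z [zU nU]; [exact: cu|exact: u0].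
have [e2 e20 e2P] : exists2 d : R, 0 < d & forall z, (S `\` U) z -> d <= `|u z|.
  apply: compact_away_zero => // z [zU nU]; [exact: cuS|exact: u0S].
(* Half a lower bound of [|u|] on the boundary of [U] and on [S] outside [U]: even after moving [u]
   by less than [e], the ramp is an integer there. *)
set e := Num.min e1 e2 / 2.
have e0 : 0 < e by rewrite divr_gt0 // lt_min e10.
have e2p : 0 < 2 * e by lra.
have eE : 2 * e = Num.min e1 e2 by rewrite /e; field.
have ee1 : 2 * e <= e1 by rewrite eE ge_min lexx.
have ee2 : 2 * e <= e2 by rewrite eE ge_min lexx orbT.
pose H (z : C) : R := if pselect (U z) then ramp e (u z) else 0.
have HU z : U z -> H z = ramp e (u z) by rewrite /H; case: pselect.
have HnU z : ~ U z -> H z = 0 by rewrite /H; case: pselect.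
have near_ramp (z : C) : {for z, continuous u} ->
    exists2 r : R, 0 < r & forall w w', N (w - z) < r -> N (w' - z) < r ->
      `|ramp e (u w) - ramp e (u w')| < 1 / 8.
  move=> cz; have e80 : 0 < e / 8 by rewrite divr_gt0.
  move/continuous_absP : cz => /(_ _ e80) /nbhs_normcP[r r0 rP].
  exists r => // w w' /rP h1 /rP h2; apply: le_lt_trans (ramp_lip _ _ e0) _.
  rewrite (ltr_pdivrMr _ _ e2p).
  have := ler_distD (u z) (u w) (u w'); rewrite (distrC (u z)); lra.
(* Modulo [1], [H] is continuous: inside [U] by continuity of [u], off the closure because it
   vanishes, and on the boundary because both definitions give integers. *)
have Hloc (z : C) : N z <= rho -> exists2 r : R, 0 < r &
    forall w w', N (w - z) < r -> N (w' - z) < r ->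
      exists m : int, `|H w - H w' - m%:~R| < 1 / 8.
  move=> zr; have [Uz|nUz] := pselect (U z).
    have [r r0 rP] := near_ramp _ (cu _ (subset_closure Uz)).
    have /nbhs_normcP[r' r'0 r'P] : nbhs z U by exact: open_nbhs_nbhs.
    exists (Num.min r r') => [|w w']; first by rewrite lt_min r0.
    rewrite !lt_min => /andP[h1 /r'P Uw] /andP[h2 /r'P Uw'].
    by exists 0; rewrite subr0 !HU // rP.
  have [clz|nclz] := pselect (closure U z).
    have uz : 2 * e <= `|u z| by exact: (le_trans ee1 (e1P z (conj clz nUz))).
    move/continuous_absP : (cu _ clz) => /(_ _ e0) /nbhs_normcP[r r0 rP].
    exists r => // w w' /rP h1 /rP h2.
    have Hint v : `|u v - u z| < e -> exists m : int, H v = m%:~R.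
      move=> hv; rewrite /H; case: pselect => ?; last by exists 0.
      apply: ramp_int => //; have := ler_distD (u v) (u z) 0.
      by rewrite !subr0 (distrC (u z)); lra.
    have [m ->] := Hint _ h1; have [m' ->] := Hint _ h2; exists (m - m').
    by rewrite intrB subrr normr0 divr_gt0.
  have oc : open (~` closure U) by apply: closed_openC; exact: closed_closure.
  have /nbhs_normcP[r r0 rP] : nbhs z (~` closure U) by exact: open_nbhs_nbhs.
  have notU v : N (v - z) < r -> H v = 0.
    by move=> /rP nv; apply: HnU => Uv; apply: nv; exact: subset_closure.
  exists r; [exact: r0|move=> w w' h1 h2; exists 0].
  by rewrite !notU // !subr0 normr0 divr_gt0.
have [d d0 dP] := lebesgue_number (@compactN_ball R 0 rho)
  (T := fun w w' => exists m : int, `|H w - H w' - m%:~R| < 1 / 8)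
  (fun z zr => Hloc z (eq_ind _ (fun v => N v <= rho) zr _ (subr0 z))).
have [theta thetaP] : exists theta : C -> R,
  forall z z', N z <= rho -> N z' <= rho -> N (z - z') < d ->
    theta z - theta z' = centered_frac (H z - H z').
  apply: angle_lift => // w w' wr wr' ww'; apply: dP; first by rewrite /= subr0.
  by rewrite normc_distC.
have cf0 (m : int) : centered_frac m%:~R = 0.
  by rewrite (@centered_fracP _ m) ?subrr // normr0 divr_gt0.
(* [P] avoids [U], so [H] vanishes on it and the argument is constant there. *)
have thetaPQ : theta q = theta p.
  have HP z : P z -> H z = 0.
    by move=> Pz; apply: HnU => Uz; have : (P `&` U) z by []; rewrite PU.
  apply: (connected_locally_constant (P := fun z => theta z = theta p) coP) Pp Pq _ => //.
  move=> z Pz; apply/nbhs_normcP; exists d => // w wz Pw.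
  have := thetaP w z (ltW (Pb _ Pw)) (ltW (Pb _ Pz)) wz.
  rewrite !HP // subrr (cf0 0) => /eqP; rewrite subr_eq0 => /eqP ->.
  by [].
(* Up to integers the extension by [0] is still the ramp on [S], so along [S] the argument follows
   [ramp e (u z)]. *)
have HS z : S z -> exists m : int, H z = ramp e (u z) + m%:~R.
  move=> Sz; have [Uz|nUz] := pselect (U z).
    by exists 0; rewrite HU // addr0.
  have [|m mE] := @ramp_int e (u z) e0.
    have := e2P z (conj Sz nUz); lra.
  by exists (- m); rewrite HnU // mE intrN subrr.
have thetaS : theta q - ramp e (u q) = theta p - ramp e (u p).
  apply: (connected_locally_constant
    (P := fun z => theta z - ramp e (u z) = theta p - ramp e (u p)) coS) Sp Sq _ => //.
  move=> z Sz; have [r r0 rP] := near_ramp _ (cuS _ Sz).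
  apply/nbhs_normcP; exists (Num.min d r) => [|w]; first by rewrite lt_min d0.
  rewrite lt_min => /andP[wd wr] Sw.
  have := thetaP w z (ltW (Sb _ Sw)) (ltW (Sb _ Sz)) wd.
  have [m1 ->] := HS _ Sw; have [m2 ->] := HS _ Sz.
  have zz : N (z - z) < r by rewrite subrr normc0.
  have := rP w z wr zz.
  move: (ramp e (u w)) (ramp e (u z)) => x y xy.
  rewrite (@centered_fracP _ (m1 - m2)); last first.
    have -> : x + m1%:~R - (y + m2%:~R) - (m1 - m2)%:~R = x - y.
      by rewrite intrB; ring.
    lra.
  by rewrite intrB => E; split; lra.
(* Both end points lie in [P], hence off [U], where [|u|] is at least [e]: the ramp is [0] at [p]
   and [1] at [q]. *)
have uP z : P z -> S z -> e <= `|u z|.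
  move=> Pz Sz; have nUz : ~ U z.
    by move=> Uz; have : (P `&` U) z by []; rewrite PU.
  by have := e2P z (conj Sz nUz); lra.
have := uP _ Pp Sp; have := uP _ Pq Sq.
rewrite (ltr0_norm up) (gtr0_norm uq) => eq ep.
move: thetaS; rewrite thetaPQ (ramp_ge e0 eq) ramp_le //; lra.
Qed.

End NoReturn.

(** * Segments, convex sets and components *)

Section Components.
Variable R : realType.
Local Notation C := (Cplane R).
Local Notation N := (@normc R).

Definition seg (z w : C) : set C :=
  [set z + (t%:C)%C * (w - z) | t in `[0, 1]%classic].

Lemma seg_l z w : seg z w z.
Proof. by exists 0; rewrite /= ?in_itv /= ?lexx ?ler01 // mul0r addr0. Qed.

Lemma seg_r z w : seg z w w.
Proof.
exists 1; rewrite /= ?in_itv /= ?lexx ?ler01 // rmorph1 mul1r.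
by rewrite addrC subrK.
Qed.

Lemma seg_continuous z w : continuous (fun t : R => z + (t%:C)%C * (w - z) : C).
Proof.
move=> t; have idD : curve_deriv (fun t : R => (t%:C)%C : C) t 1.
  by apply: has_deriv_id => h; rewrite rmorphD.
apply: (curve_continuous (has_derivD (has_deriv_cst _ z t)
  (has_derivM idD (has_deriv_cst _ (w - z) t)))).
Qed.

Lemma seg_connected z w : connected (seg z w).
Proof.
apply: connected_continuous_connected; first exact: segment_connected.
by apply: continuous_subspaceT; exact: seg_continuous.
Qed.

Lemma seg_compact z w : compact (seg z w).
Proof.
apply: continuous_compact; last exact: segment_compact.
by apply: continuous_subspaceT; exact: seg_continuous.
Qed.

Definition convexC (A : set C) := forall z w, A z -> A w -> seg z w `<=` A.

Lemma convexC_connected A : convexC A -> connected A.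
Proof.
move=> cvA; have [->|/set0P[z Az]] := eqVneq A set0; first exact: connected0.
have -> : A = \bigcup_(w in A) seg z w.
  apply/seteqP; split=> [w Aw|v [w Aw]]; first by exists w => //; exact: seg_r.
  exact: cvA.
apply: bigcup_connected; last by move=> w _; exact: seg_connected.
by exists z => w _; exact: seg_l.
Qed.

Lemma convexC_ball (z : C) (d : R) : convexC [set w : C | N (w - z) < d].
Proof.
move=> u v /= uz vz x [t /=]; rewrite in_itv /= => /andP[t0 t1] <-.
have -> : u + (t%:C)%C * (v - u) - z =
    ((1 - t)%:C)%C * (u - z) + (t%:C)%C * (v - z).
  by rewrite rmorphB rmorph1; ring.
apply: le_lt_trans (normc_le_add _ _) _; rewrite !normcM !normc_real.
rewrite !ger0_norm ?subr_ge0 //.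
have [->|t00] := eqVneq t 0; first by rewrite subr0 mul1r mul0r addr0.
have : t * N (v - z) < t * d by rewrite ltr_pM2l // lt_neqAle eq_sym t00.
have : (1 - t) * N (u - z) <= (1 - t) * d by rewrite ler_wpM2l ?subr_ge0 // ltW.
have -> : (1 - t) * d = d - t * d by ring.
lra.
Qed.

Lemma convexC_setI A B : convexC A -> convexC B -> convexC (A `&` B).
Proof. by move=> cA cB z w [? ?] [? ?] v vs; split; [exact: cA vs|exact: cB vs]. Qed.

Lemma convexC_halfplane (k a : R) (u : R) :
  convexC [set z : C | u < k * complex.Re z + a * complex.Im z].
Proof.
move=> [x y] [x' y'] /= h h' v [t /=]; rewrite in_itv /= => /andP[t0 t1] <-.
rewrite /= mul0r subr0 mul0r addr0.
have -> : k * (x + t * (x' - x)) + a * (y + t * (y' - y)) =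
  (1 - t) * (k * x + a * y) + t * (k * x' + a * y') by ring.
have [->|t00] := eqVneq t 0; first by rewrite subr0 mul1r mul0r addr0.
have : t * u < t * (k * x' + a * y') by rewrite ltr_pM2l // lt_neqAle eq_sym t00.
have : (1 - t) * u <= (1 - t) * (k * x + a * y).
  by rewrite ler_wpM2l ?subr_ge0 // ltW.
have -> : (1 - t) * u = u - t * u by ring.
lra.
Qed.

(* Both complements of large squares ([D = setT]) and punctured discs ([s = 0])
   are cyclic unions of four overlapping convex pieces. *)
Lemma connected_outside_square (D : set C) (s r : R) : convexC D -> s < r ->
  (forall e e', `|e| = 1 -> `|e'| = 1 -> D ((e * r) +i* (e' * r))%C) ->
  connected (D `&` [set z : C | s < `|complex.Re z| \/ s < `|complex.Im z|]).
Proof.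
move=> cD sr corner.
pose H (k a : R) := D `&` [set z : C | s < k * complex.Re z + a * complex.Im z].
have cH k a : connected (H k a).
  by apply: convexC_connected; apply: convexC_setI => //; exact: convexC_halfplane.
have n1 : `|1 : R| = 1 by exact: normr1.
have nN1 : `|-1 : R| = 1 by rewrite normrN1.
have -> : D `&` [set z : C | s < `|complex.Re z| \/ s < `|complex.Im z|] =
    (((H 1 0 `|` H 0 1) `|` H (-1) 0) `|` H 0 (-1)).
  apply/seteqP; split=> [z [Dz]|z] /=.
    rewrite !ltr_normr => -[/orP[]|/orP[]] h.
    + by left; left; left; split => //=; lra.
    + by left; right; split => //=; lra.
    + by left; left; right; split => //=; lra.
    + by right; split => //=; lra.
  move=> [[[[Dz h]|[Dz h]]|[Dz h]]|[Dz h]]; split=> //; move: h => /= h.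
  + by left; rewrite ltr_normr; apply/orP; left; lra.
  + by right; rewrite ltr_normr; apply/orP; left; lra.
  + by left; rewrite ltr_normr; apply/orP; right; lra.
  + by right; rewrite ltr_normr; apply/orP; right; lra.
apply: connectedU;
  [|apply: connectedU; [|apply: connectedU; [|exact: cH|exact: cH]|exact: cH]|exact: cH].
- exists ((1 * r) +i* (-1 * r))%C; split; last first.
    by split; [exact: corner|rewrite /=; lra].
  by left; left; split; [exact: corner|rewrite /=; lra].
- exists ((-1 * r) +i* (1 * r))%C; split; last first.
    by split; [exact: corner|rewrite /=; lra].
  by right; split; [exact: corner|rewrite /=; lra].
- exists ((1 * r) +i* (1 * r))%C; split.
    by split; [exact: corner|rewrite /=; lra].
  by split; [exact: corner|rewrite /=; lra].
Qed.

Lemma connected_exterior (s : R) : 0 <= s ->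
  connected [set z : C | s < `|complex.Re z| \/ s < `|complex.Im z|].
Proof.
move=> s0; rewrite -[X in connected X]setTI.
by apply: (@connected_outside_square _ s (s + 1)) => //; rewrite ltrDl.
Qed.

Lemma connected_punctured_ball (z0 : C) (r : R) : 0 < r ->
  connected [set z : C | N (z - z0) < r /\ z != z0].
Proof.
move=> r0.
pose f (z : C) : C := z + z0.
have cf : continuous f.
  by move=> z; exact: (continuousC_add (@continuous_idC R z) (@continuousC_cst R _ z0 z)).
have -> : [set z : C | N (z - z0) < r /\ z != z0] =
   f @` ([set z : C | N (z - 0) < r] `&`
         [set z : C | 0 < `|complex.Re z| \/ 0 < `|complex.Im z|]).
  apply/seteqP; split=> [z /= [zr zz]|_ [z [/= zr zz] <-]] /=.
    exists (z - z0); last by rewrite /f subrK.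
    split; rewrite /= ?subr0 // !normr_gt0.
    move: zz; rewrite -subr_eq0; case: (z - z0) => x y.
    by rewrite eq_complex /= negb_and => /orP[]; [left|right].
  rewrite /f addrK -{1}(subr0 z); split=> //.
  rewrite -subr_eq0 addrK; apply/eqP => z00.
  by move: zz; rewrite z00 /= normr0 ltxx => -[].
apply: connected_continuous_connected; last exact: continuous_subspaceT.
apply: (@connected_outside_square _ 0 (r / 3)); first exact: convexC_ball.
  by rewrite divr_gt0.
move=> e e' e1 e'1; set x : C := (_ +i* _)%C.
suff : N x < r by rewrite -{1}(subr0 x).
have r3 : `|r / 3| = r / 3 by rewrite gtr0_norm ?divr_gt0.
apply: le_lt_trans (normc_le_ReIm x) _.
by rewrite /= (normrM e) (normrM e') e1 e'1 !mul1r r3; lra.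
Qed.

Lemma component_open (K : set C) (x : C) : closed K ->
  open (connected_component (~` K) x).
Proof.
move=> clK; rewrite openE => z Fz; have nKz : (~` K) z.
  exact: connected_component_sub Fz.
have oK : open (~` K) by apply: closed_openC.
have /nbhs_normcP[r r0 rP] : nbhs z (~` K) by exact: open_nbhs_nbhs.
apply/nbhs_normcP; exists r => // w wz.
apply: (connected_component_trans Fz).
exists [set w | N (w - z) < r]; last exact: wz.
split => //=; first by rewrite subrr normc0.
by apply: convexC_connected; exact: convexC_ball.
Qed.

(** Stands in for a path from [p] to [q]; reachability is propagated by segments. Compactness of [P]
    later leaves room for a neighbourhood of the level component that avoids it. *)
Lemma connected_open_compact (F : set C) (p q : C) : open F -> connected F ->
  F p -> F q -> exists P, [/\ compact P, connected P, P `<=` F, P p & P q].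
Proof.
move=> oF cF Fp Fq.
pose Q z := exists P, [/\ compact P, connected P, P `<=` F, P p & P z].
apply: (connected_locally_constant (P := Q) cF _ Fp Fq); last first.
  exists [set p]; split => //; [exact: compact_set1|exact: connected1|].
  by move=> _ ->.
move=> z Fz; have /nbhs_normcP[r r0 rP] : nbhs z F by exact: open_nbhs_nbhs.
have step a b : N (a - z) < r -> N (b - z) < r -> Q a -> Q b.
  move=> ar br [P [cP coP PF Pp Pa]]; exists (P `|` seg a b); split.
  - by apply: compactU => //; exact: seg_compact.
  - apply: connectedU => //; last exact: seg_connected.
    by exists a; split => //; exact: seg_l.
  - by rewrite subUset; split => // v /(convexC_ball ar br) /rP.
  - by left.
  - by right; exact: seg_r.
have zz : N (z - z) < r by rewrite subrr normc0.
by apply/nbhs_normcP; exists r => // w wz _; split; exact: step.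
Qed.

(* The intersection of the clopen neighbourhoods of [z0] in [X] is connected. *)
Lemma component_clopen_nbhs (X W : set C) (z0 : C) : compact X -> X z0 ->
  open W -> connected_component X z0 `<=` W ->
  exists K, [/\ K `<=` X, closed K, closed (X `\` K), K z0 & K `<=` W].
Proof.
move=> cX Xz0 oW LW; have clX := compactC_closed cX.
pose clopen D := [/\ D `<=` X, closed D, closed (X `\` D) & D z0].
have clopenX : clopen X.
  by split => //; rewrite setDv; exact: closed0.
have clopenI D E : clopen D -> clopen E -> clopen (D `&` E).
  move=> [DX cD cD' Dz] [EX cE cE' Ez]; split => //.
  - by move=> z [/DX].
  - exact: closedI.
  - by rewrite setDIr; exact: closedU.
pose Q := \bigcap_(D in clopen) D.
have QX : Q `<=` X by move=> z; apply.
(* If every clopen set left [U], the parts outside [U] would generate a filter with a cluster point,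
   lying in [Q] but not in [U]. *)
have fip U : open U -> Q `<=` U -> exists2 D, clopen D & D `<=` U.
  move=> oU QU; apply: contrapT => /forall2NP nD.
  have D0 D : clopen D -> (D `\` U) !=set0.
    move=> cD; have [//|] := nD D.
    by move=> /existsNP[z /not_implyP[Dz nUz]]; exists z.
  have FF : ProperFilter (filter_from clopen (fun D => D `\` U)).
    apply: filter_from_proper => //; apply: filter_from_filter.
      by exists X.
    move=> D E cD cE; exists (D `&` E); first exact: clopenI.
    by move=> z [[Dz Ez] nUz].
  have [|p [Xp clp]] := cX _ FF; first by exists X => // z [].
  have Qp : Q p.
    move=> D cD; have [_ clD _ _] := cD; apply: clD => B nB.
    have [|z [[Dz _] Bz]] := clp (D `\` U) B _ nB; first by exists D.
    by exists z.
  have nU : nbhs p U by apply: open_nbhs_nbhs; split => //; exact: QU.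
  have [|z [[_ nUz] Uz]] := clp (X `\` U) U _ nU; first by exists X.
  exact: nUz Uz.
have clQ : closed Q by apply: closed_bigI => D [].
have cQ : compact Q by exact: (subclosed_compact clQ cX QX).
have Qz0 : Q z0 by move=> D [].
(* A splitting of [Q] is separated by two disjoint open thickenings. A clopen set inside their union
   is cut by them into clopen pieces, so [Q] lies in the one that contains [z0]. *)
have Qco : connected Q.
  move=> B B0 [G oG BG] [F clF BF].
  pose Q1 := Q `&` F; pose Q2 := Q `\` G.
  have Q12 z : Q1 z -> ~ Q2 z.
    by rewrite /Q1 -BF BG => -[_ Gz] [_ nGz].
  have clQ1 : closed Q1 by exact: closedI.
  have clQ2 : closed Q2 by rewrite /Q2 setDE; apply: closedI => //; exact: open_closedC.
  have cQ1 : compact Q1 by apply: (subclosed_compact clQ1 cQ) => z [].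
  have [|d d0 dP] := lebesgue_number (T := fun _ w' => ~ Q2 w') cQ1.
    move=> z /Q12 nQ2; have oc : open (~` Q2) by exact: closed_openC.
    have /nbhs_normcP[r r0 rP] : nbhs z (~` Q2) by exact: open_nbhs_nbhs.
    by exists r => // w w' _; exact: rP.
  have d20 : 0 < d / 2 by rewrite divr_gt0.
  pose U1 := thicken Q1 (d / 2); pose U2 := thicken Q2 (d / 2).
  have sub_th (A : set C) : A `<=` thicken A (d / 2).
    by move=> z Az; exists z => //; rewrite subrr normc0.
  have oU1 : open U1 by exact: thicken_open.
  have oU2 : open U2 by exact: thicken_open.
  have U12 z : U1 z -> ~ U2 z.
    move=> [a Q1a za] [b Q2b zb]; apply: dP Q1a _ Q2b.
    by have := normc_dist_add b z a; rewrite (normc_distC b z); lra.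
  have QU : Q `<=` U1 `|` U2.
    move=> z Qz; have [Gz|nGz] := pselect (G z); last by right; exact: sub_th.
    by left; apply: sub_th; rewrite /Q1 -BF BG.
  have [D cD DU] := fip _ (openU oU1 oU2) QU.
  have [DX clD clD' Dz0] := cD.
  have sub1 (V V' : set C) : open V -> open V' -> (forall z, V z -> ~ V' z) ->
      D `<=` V `|` V' -> V z0 -> Q `<=` V.
    move=> oV oV' VV' DV Vz0 z Qz.
    have DE : D `&` V = D `\` V'.
      apply/seteqP; split=> v [Dv Vv]; split => //; first exact: VV'.
      by case: (DV _ Dv).
    suff : clopen (D `&` V) by move=> /Qz[].
    split => //.
    - by move=> v [/DX].
    - by rewrite DE setDE; apply: closedI => //; exact: open_closedC.
    - have -> : X `\` (D `&` V) = (X `\` D) `|` (D `\` V).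
        apply/seteqP; split=> v.
          move=> [Xv nDV]; have [Dv|nDv] := pselect (D v); last by left.
          by right; split => // Vv; exact: nDV.
        by move=> [[Xv nDv]|[Dv nVv]]; split => //; [case|exact: DX|case].
      apply: closedU => //; rewrite setDE; apply: closedI => //.
      exact: open_closedC.
  have [Uz|Uz] := DU _ Dz0.
    have QU1 := sub1 _ _ oU1 oU2 U12 DU Uz.
    rewrite BG; apply/seteqP; split=> z; first by case.
    move=> Qz; split => //; apply: contrapT => nGz.
    by apply: (U12 z); [exact: QU1|exact: sub_th].
  have QU2 : Q `<=` U2.
    apply: sub1 oU2 oU1 _ _ Uz; first by move=> z U2z /U12.
    by rewrite setUC.
  have [z Bz] := B0; exfalso; apply: (U12 z); last first.
    by apply: QU2; move: Bz; rewrite BG => -[].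
  by apply: sub_th; rewrite /Q1 -BF.
have [|D [DX clD clD' Dz0] DW] := fip W oW.
  by apply: subset_trans LW; exact: connected_component_max.
by exists D.
Qed.

End Components.

(** * Level sets near noncritical points *)

Section LevelSet.
Variable R : realType.
Local Notation C := (Cplane R).
Local Notation N := (@normc R).
Variables (f : C -> C) (eps : R) (X G : set C).
Hypotheses (eps0 : 0 < eps) (oG : open G) (XG : X `<=` G).
Hypothesis Xcl : forall z, G z -> closure X z -> X z.

Local Notation u := (fun z : C => N (f z) - eps).

(** All that is used of the level set near a point. Points off [X] may be good too, as needed for
    transversals and for neighbourhoods of a component. *)
Definition good z := exists2 r : R, 0 < r & holo_ball f z r /\
  forall w, N (w - z) < r -> (X w <-> N (f w) = eps).

Hypothesis Xgood : forall z, X z -> good z.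

Lemma good_near z r w : holo_ball f z r ->
  (forall w, N (w - z) < r -> (X w <-> N (f w) = eps)) -> N (w - z) < r -> good w.
Proof.
move=> hz Xz wz; exists (r - N (w - z)); first by rewrite subr_gt0.
by split=> v vw; [apply: hz|apply: Xz]; have := normc_dist_add v w z; lra.
Qed.

Lemma good_open : open good.
Proof.
rewrite openE => z [r r0 [hz Xz]]; apply/nbhs_normcP; exists r => // w.
exact: good_near.
Qed.

Lemma holo_ball_continuous z r : 0 < r -> holo_ball f z r -> {for z, continuous f}.
Proof.
move=> r0 hz; have [|d] := hz z; first by rewrite subrr normc0.
exact: has_deriv_continuous.
Qed.

Lemma good_u_continuous z : good z -> {for z, continuous u}.
Proof.
move=> [r r0 [hz _]]; apply/continuous_absP => e e0.
have /continuous_normcP /(_ e e0) := holo_ball_continuous r0 hz.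
apply: filterS => w; apply: le_lt_trans.
have -> : N (f w) - eps - (N (f z) - eps) = N (f w) - N (f z) by ring.
exact: normc_dist_le.
Qed.

Lemma good_X z : good z -> (X z <-> u z = 0).
Proof.
move=> [r r0 [_ Xz]]; have -> := Xz z; last by rewrite subrr normc0.
by split=> [->|]; rewrite ?subrr //; lra.
Qed.

Lemma component_self (L : set C) x : is_component X L -> L x ->
  L = connected_component X x.
Proof.
by move=> [y Xy ->] Lx; exact: same_connected_component.
Qed.

(** [U] may contain other components of [X]; it is only asked that the boundary of [U] miss [X]. [U]
    is a thickening of a clopen part [K] of a compact piece of [X] around [L]. *)
Lemma component_separation (L W : set C) : is_component X L -> compact L ->
  open W -> L `<=` W ->
  exists U, [/\ open U, L `<=` U, closure U `<=` W `&` G,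
    exists r : R, forall z, closure U z -> N z <= r &
    forall z, closure U z -> X z -> U z].
Proof.
move=> cL coL oW LW; have [x0 Xx0 LE] := cL.
have Lx0 : L x0 by rewrite LE; exact: connected_component_refl.
have LX : L `<=` X by rewrite LE; exact: connected_component_sub.
have [|d d0 dP] := compact_thicken coL (openI oW oG).
  by move=> z Lz; split; [exact: LW|exact/XG/LX].
have d20 : 0 < d / 2 by rewrite divr_gt0.
pose W0 := thicken L (d / 2); pose V := closure W0.
have d2d : d / 2 < d by lra.
have VW : V `<=` W `&` G by move=> z /(thicken_closure d2d); exact: dP.
have clV : closed V by exact: closed_closure.
have [r r0 rP] := compactC_bounded coL.
have Vb z : V z -> N (z - 0) <= r + d.
  move=> /(thicken_closure d2d)[k /rP kr zk]; rewrite subr0.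
  by have := normc_le_add (z - k) k; rewrite subrK; lra.
have cV : compact V by exact: compact_closed_bounded clV Vb.
(* The component of this set at [x0] lies in [L], hence in [W0]; a clopen part [K] inside [W0] can
   then be thickened without reaching the rest of the set. *)
have cX0 : compact (X `&` V).
  apply: (subclosed_compact _ cV); last by move=> z [].
  move=> z clz; have Vz : V z.
    by apply: clV; move: clz; apply: closure_subset => w [].
  split=> //; apply: Xcl; first by have [] := VW _ Vz.
  by move: clz; apply: closure_subset => w [].
have LW0 : L `<=` W0 by move=> z Lz; exists z => //; rewrite subrr normc0.
have X0x0 : (X `&` V) x0.
  by split => //; apply: subset_closure; exact: LW0.
have LX0 : connected_component (X `&` V) x0 `<=` W0.
  apply: subset_trans LW0; rewrite LE.
  apply: connected_component_max; last exact: component_connected.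
    exact: connected_component_refl.
  by apply: subset_trans (@connected_component_sub _ _ _) _ => z [].
have [K [KX clK clXK Kx0 KW]] :=
  component_clopen_nbhs cX0 X0x0 (@thicken_open _ _ _) LX0.
have cK : compact K by exact: (subclosed_compact clK cX0 KX).
have oXK : open (~` ((X `&` V) `\` K)) by exact: closed_openC.
have [|e e0 eP] := compact_thicken cK (openI (@thicken_open _ L (d / 2)) oXK).
  by move=> z Kz; split; [exact: KW|case].
have e20 : 0 < e / 2 by rewrite divr_gt0.
have e2e : e / 2 < e by lra.
have clU z : closure (thicken K (e / 2)) z -> thicken L (d / 2) z /\
    (~` ((X `&` V) `\` K)) z.
  by move=> /(thicken_closure e2e) /eP.
exists (thicken K (e / 2)); split.
- exact: thicken_open.
- have LK : L `<=` K.
    move=> z Lz; apply: (connected_locally_constant (A := L) (P := K) _ _ Lx0 Lz Kx0).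
      by rewrite LE; exact: component_connected.
    move=> v Lv; have X0v w : L w -> (X `&` V) w.
      by move=> Lw; split; [exact: LX|exact/subset_closure/LW0].
    have [Kv|nKv] := pselect (K v).
      have : nbhs v (~` ((X `&` V) `\` K)).
        by apply: open_nbhs_nbhs; split => // -[].
      apply: filterS => w nw Lw; split=> // _; apply: contrapT => nKw.
      exact: (nw (conj (X0v _ Lw) nKw)).
    have : nbhs v (~` K).
      by apply: open_nbhs_nbhs; split => //; exact: closed_openC.
    by apply: filterS => w nw Lw; split.
  by move=> z /LK Kz; exists z => //; rewrite subrr normc0.
- by move=> z /clU[Wz _]; apply: VW; exact: subset_closure.
- exists (r + d) => z /clU[Wz _].
  by have := Vb z (subset_closure Wz); rewrite subr0.
- move=> z /clU[Wz nz] Xz; apply: contrapT => nU; apply: nz; split.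
    by split => //; exact: subset_closure.
  by move=> Kz; apply: nU; exists z => //; rewrite subrr normc0.
Qed.

(** If [p] and [q] shared a face, [S] and a compact connected set [P] in that face would form the
    closed curve excluded by [no_single_crossing], with [U] taken in the complement of [P]. *)
Lemma crossing_separates (L S : set C) p q : is_component X L -> compact L ->
  compact S -> connected S -> S `<=` good -> S `&` X `<=` L ->
  S p -> S q -> u p < 0 -> 0 < u q -> ~ connected_component (~` L) p q.
Proof.
move=> cL coL coS conS Sg SX Sp Sq up uq pq.
have LX : L `<=` X by have [x _ ->] := cL; exact: connected_component_sub.
have Lu z : L z -> u z = 0 by move=> /LX Xz; apply/good_X => //; exact: Xgood.
have nLp : (~` L) p by move=> /Lu E; move: up; rewrite E ltxx.
have oF := @component_open R L p (compactC_closed coL).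
have [P [cP conP PF Pp Pq]] := connected_open_compact oF
  (@component_connected _ _ _) (connected_component_refl nLp) pq.
have oP : open (~` P) by apply: closed_openC; exact: compactC_closed.
have [|U [oU LU clU [r rP] UX]] :=
    component_separation cL coL (openI good_open oP).
  move=> z Lz; split; first exact/Xgood/LX.
  by move=> /PF /(@connected_component_sub _ _ _).
have [r1 r10 r1P] := compactC_bounded cP.
have [r2 r20 r2P] := compactC_bounded coS.
pose rho := Num.max r (Num.max r1 r2).
have rr : r <= rho by rewrite le_max lexx.
have rr1 : r1 <= rho by rewrite !le_max lexx orbT.
have rr2 : r2 <= rho by rewrite !le_max lexx !orbT.
apply: (@no_single_crossing R u U P S p q rho) => //.
- by move=> z /rP /le_trans; apply.
- by move=> z /clU[[gz _] _]; exact: good_u_continuous.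
- move=> z clz nUz; apply/eqP => uz; apply: nUz; apply: UX => //.
  by have [[gz _] _] := clU _ clz; apply/good_X.
- by move=> z /r1P /lt_le_trans; apply.
- apply/seteqP; split=> z // [Pz Uz].
  by have [[_ nP] _] := clU _ (subset_closure Uz).
- by move=> z /r2P /lt_le_trans; apply.
- by move=> z /Sg; exact: good_u_continuous.
- move=> z Sz nUz; apply/eqP => uz; apply/nUz/LU/SX; split=> //.
  by apply/good_X => //; exact: Sg.
Qed.

(** Used for [x = f v / f z0]. As [Re x >= 3 / 4] and [N x <= 5 / 4], one has [N x <= 2 * Re x],
    which is enough after squaring. *)
Lemma normc_add_pos (x : C) (t : R) : N (x - 1) <= 1 / 4 -> 0 <= t ->
  N x + t / 2 <= N (x + (t%:C)%C).
Proof.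
move=> x1 t0; have rx : 3 / 4 <= complex.Re x.
  have := le_trans (abs_Re_le (x - 1)) x1; rewrite raddfB /= ler_norml.
  by move=> /andP[? ?]; lra.
have nx : N x <= 5 / 4.
  by have := normc_le_add (x - 1) 1; rewrite subrK normc1; lra.
have nx0 := normc_ge0 x.
rewrite -(@ler_pXn2r _ 2) ?nnegrE ?addr_ge0 ?divr_ge0 ?normc_ge0 //.
have sq (v : C) : N v ^+ 2 = complex.Re v ^+ 2 + complex.Im v ^+ 2.
  by case: v => a b /=; rewrite sqr_sqrtr ?addr_ge0 ?sqr_ge0.
rewrite sqrrD !sq.
have -> : complex.Re (x + (t%:C)%C) = complex.Re x + t by rewrite raddfD.
have -> : complex.Im (x + (t%:C)%C) = complex.Im x by rewrite raddfD /= addr0.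
have : t * N x <= t * (2 * complex.Re x) by rewrite ler_wpM2l //; lra.
have : 0 <= t ^+ 2 by exact: sqr_ge0.
rewrite sqrrD; move: (complex.Re x) (complex.Im x) (N x) => a b n.
have -> : (t / 2) ^+ 2 = t ^+ 2 / 4 by field.
have -> : n * (t / 2) *+ 2 = t * n by rewrite mulr2n; field.
have -> : a * t *+ 2 = t * (2 * a) by rewrite mulr2n; ring.
lra.
Qed.

(** [S] is a short transversal through [z0]; [Bm] and [Bp] are the two local sides. The last clause
    speaks of all points near [z0]: every zero of [u] there is a limit of both sides. *)
Definition sides (z0 : C) (p q : C) (S Bm Bp : set C) :=
  [/\ [/\ compact S, connected S, S `<=` good & S `&` X `<=` [set z0]],
      [/\ S p, S q, Bm p & Bp q],
      [/\ connected Bm, connected Bp, forall z, Bm z -> u z < 0 &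
          forall z, Bp z -> 0 < u z] &
      \forall w \near z0, [/\ u w < 0 -> Bm w, 0 < u w -> Bp w &
        u w = 0 -> closure Bm w /\ closure Bp w]].

(** In the coordinates [pt x y], whose unit is [w = c / d], [f] is close to [c * (1 + x + 'i * y)],
    so [|f|] increases strictly with [x] on a small square. *)
Lemma sides_exist z0 d : X z0 -> has_deriv id f z0 d -> d != 0 ->
  exists p q S Bm Bp, sides z0 p q S Bm Bp.
Proof.
move=> Xz0 df d0; have [rho rho0 [hz Xz]] := Xgood Xz0.
set c := f z0; have Nc : N c = eps by apply/Xz => //; rewrite subrr normc0.
have c0 : c != 0 by rewrite -normc_gt0P Nc.
set w := c / d; have w0 : w != 0 by rewrite mulf_neq0 // invr_neq0.
have Nw0 : 0 < N w by rewrite normc_gt0P.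
(* A displacement [w * t] has length [N w * t], so the linearisation error is [eps / 4 * t], below
   the gain [eps / 2 * t] provided by [normc_add_pos]. *)
have e40 : 0 < eps / (4 * N w) by rewrite divr_gt0 // mulr_gt0.
have [r1 /andP[r10 r1rho] r1P] := strict_deriv rho0 hz df d0 e40.
have eps40 : 0 < eps / 4 by rewrite divr_gt0.
have /continuous_normcP /(_ _ eps40) /nbhs_normcP[r2 r20 r2P] :=
  holo_ball_continuous rho0 hz.
set r := Num.min r1 r2; have r0 : 0 < r by rewrite lt_min r10.
pose pt (x y : R) : C := z0 + w * (x +i* y)%C.
set b := r / (3 * N w); have b0 : 0 < b by rewrite divr_gt0 // mulr_gt0.
have ptr x y : `|x| <= b -> `|y| <= b -> N (pt x y - z0) < r.
  move=> xb yb; rewrite /pt addrAC subrr add0r normcM.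
  apply: le_lt_trans (_ : N w * (2 * b) < r).
    rewrite ler_pM2l //; apply: le_trans (normc_le_ReIm _) _ => /=; lra.
  rewrite /b; have -> : N w * (2 * (r / (3 * N w))) = 2 / 3 * r.
    by field; rewrite gt_eqF.
  lra.
have mono x x' y : `|x| <= b -> `|x'| <= b -> `|y| <= b -> x < x' ->
    u (pt x y) < u (pt x' y).
  move=> xb x'b yb xx'; set v := pt x y; set v' := pt x' y.
  have vr := ptr _ _ xb yb; have v'r := ptr _ _ x'b yb.
  rewrite -/v in vr; rewrite -/v' in v'r.
  move: vr v'r; rewrite !lt_min => /andP[vr1 vr2] /andP[v'r1 _].
  set t := x' - x; have t0 : 0 < t by rewrite subr_gt0.
  have vv : v' - v = w * (t%:C)%C.
    rewrite /v' /v /pt opprD addrACA subrr add0r -mulrBr; congr (_ * _).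
    by apply/eqP; rewrite eq_complex /= subrr !eqxx.
  have NE : N (w * (t%:C)%C) = N w * t by rewrite normcM normc_real gtr0_norm.
  have := r1P _ _ v'r1 vr1; rewrite vv NE.
  have -> : d * (w * (t%:C)%C) = c * (t%:C)%C by rewrite /w; field.
  have -> : eps / (4 * N w) * (N w * t) = eps / 4 * t.
    by field; rewrite gt_eqF.
  move=> h1.
  have h2 : N (f v / c - 1) <= 1 / 4.
    have -> : f v / c - 1 = (f v - c) / c by field.
    rewrite normcM normcV Nc ler_pdivrMr //.
    by have := r2P _ vr2; rewrite /= -/c; lra.
  have := normc_add_pos h2 (ltW t0) => h3.
  have h4 : N (f v) + eps * (t / 2) <= N (f v + c * (t%:C)%C).
    have -> : f v + c * (t%:C)%C = c * (f v / c + (t%:C)%C) by field.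
    have -> : N (f v) = eps * N (f v / c).
      by rewrite normcM normcV Nc mulrC divfK // gt_eqF.
    by rewrite [N (c * _)]normcM Nc -mulrDr ler_pM2l.
  have := normc_sub_le (f v + c * (t%:C)%C) (f v').
  have -> : f v + c * (t%:C)%C - f v' = - (f v' - f v - c * (t%:C)%C) by ring.
  rewrite normc_opp => h5.
  have : 0 < eps * t by rewrite mulr_gt0.
  lra.
have good_pt x y : `|x| <= b -> `|y| <= b -> good (pt x y).
  move=> xb yb; apply: (good_near hz Xz).
  by have := ptr _ _ xb yb; rewrite lt_min => /andP[h _]; exact: lt_le_trans r1rho.
have pt00 : pt 0 0 = z0.
  by rewrite /pt [X in w * X](_ : _ = 0) ?mulr0 ?addr0.
have uz0 : u z0 = 0 by rewrite -/c Nc subrr.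
have n0b : `|0 : R| <= b by rewrite normr0 ltW.
have nbb : `|b| <= b by rewrite gtr0_norm.
have nNbb : `|- b| <= b by rewrite normrN gtr0_norm.
have uq : 0 < u (pt b 0).
  by have := mono 0 b 0 n0b nbb n0b b0; rewrite pt00 uz0.
have up : u (pt (- b) 0) < 0.
  have nb0 : - b < 0 by rewrite oppr_lt0.
  by have := mono (- b) 0 0 nNbb n0b n0b nb0; rewrite pt00 uz0.
have pt_dist x y x' y' : N (pt x y - pt x' y') <= N w * (`|x - x'| + `|y - y'|).
  rewrite /pt opprD addrACA subrr add0r -mulrBr normcM ler_pM2l //.
  exact: normc_le_ReIm.
(* The height is reduced until [u] keeps a constant sign on each of the vertical edges [x = b] and
   [x = - b]. *)
have [b2 b20 b2P] : exists2 b2 : R, 0 < b2 <= b & forall y, `|y| < b2 ->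
    0 < u (pt b y) /\ u (pt (- b) y) < 0.
  have /continuous_absP /(_ _ uq) /nbhs_normcP[s1 s10 s1P] :=
    good_u_continuous (good_pt _ _ nbb n0b).
  have nup : 0 < - u (pt (- b) 0) by rewrite oppr_gt0.
  have /continuous_absP /(_ _ nup) /nbhs_normcP[s2 s20 s2P] :=
    good_u_continuous (good_pt _ _ nNbb n0b).
  exists (Num.min b (Num.min (s1 / N w) (s2 / N w))).
    by rewrite !lt_min b0 !divr_gt0 //= ge_min lexx.
  move=> y; rewrite !lt_min => /and3P[_]; rewrite !ltr_pdivlMr // => ys1 ys2.
  split.
    have /s1P /= : N (pt b y - pt b 0) < s1.
      apply: le_lt_trans (pt_dist _ _ _ _) _.
      by rewrite subrr normr0 add0r subr0 mulrC.
    by rewrite ltr_norml => /andP[? ?]; lra.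
  have /s2P /= : N (pt (- b) y - pt (- b) 0) < s2.
    apply: le_lt_trans (pt_dist _ _ _ _) _.
    by rewrite subrr normr0 add0r subr0 mulrC.
  by rewrite ltr_norml => /andP[? ?]; lra.
have /andP[b2_gt0 b2b] := b20.
pose Dm (xy : R * R) := [/\ `|xy.1| <= b, `|xy.2| < b2 & u (pt xy.1 xy.2) < 0].
pose Dp (xy : R * R) := [/\ `|xy.1| <= b, `|xy.2| < b2 & 0 < u (pt xy.1 xy.2)].
pose Bm := [set pt xy.1 xy.2 | xy in Dm]; pose Bp := [set pt xy.1 xy.2 | xy in Dp].
have seg_pt x y x' y' : seg (pt x y) (pt x' y') =
    [set pt (x + t * (x' - x)) (y + t * (y' - y)) | t in `[0, 1]%classic].
  apply: eq_imagel => t _; rewrite /pt.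
  have -> : ((x + t * (x' - x)) +i* (y + t * (y' - y)))%C =
      (x +i* y)%C + (t%:C)%C * ((x' +i* y')%C - (x +i* y)%C) :> C.
    by apply/eqP; rewrite eq_complex /= !mul0r subr0 addr0 !eqxx.
  ring.
have itv_norm (x x' t m : R) : `|x| <= m -> `|x'| <= m -> 0 <= t <= 1 ->
    `|x + t * (x' - x)| <= m.
  move=> /[!ler_norml] /andP[h1 h2] /andP[h3 h4] /andP[t0 t1].
  have -> : x + t * (x' - x) = (1 - t) * x + t * x' by ring.
  have t1' : 0 <= 1 - t by rewrite subr_ge0.
  have k1 := ler_wpM2l t1' h1; have k2 := ler_wpM2l t1' h2.
  have k3 := ler_wpM2l t0 h3; have k4 := ler_wpM2l t0 h4.
  have -> : m = (1 - t) * m + t * m by ring.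
  apply/andP; split; last lra.
  have -> : - ((1 - t) * m + t * m) = (1 - t) * - m + t * - m by ring.
  lra.
have mono_le x x' y : `|x| <= b -> `|x'| <= b -> `|y| <= b -> x <= x' ->
    u (pt x y) <= u (pt x' y).
  move=> xb x'b yb; rewrite le_eqVlt => /orP[/eqP-> //|xx'].
  by apply/ltW/mono.
have y_shrink y t : `|y| < b2 -> 0 <= t <= 1 -> `|y + t * (0 - y)| < b2.
  move=> yb t01; apply: le_lt_trans yb; apply: itv_norm => //.
  by rewrite normr0.
exists (pt (- b) 0), (pt b 0), (seg (pt (- b) 0) (pt b 0)), Bm, Bp; split.
- split; [exact: seg_compact|exact: seg_connected| |].
    rewrite seg_pt => v [t /=]; rewrite in_itv /= => t01 <-.
    apply: good_pt; last by rewrite subrr mulr0 addr0.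
    exact: itv_norm.
  rewrite seg_pt => v [[t /=]]; rewrite in_itv /= => t01 <-.
  have xb := itv_norm _ _ _ _ nNbb nbb t01.
  rewrite subrr mulr0 addr0; set x := - b + _ in xb *.
  have gx := good_pt _ _ xb n0b.
  move=> /(good_X gx) ux.
  have [x0|x0|->] := ltgtP x 0; last by rewrite pt00.
    by have := mono _ _ _ xb n0b n0b x0; rewrite pt00 uz0 ux ltxx.
  by have := mono _ _ _ n0b xb n0b x0; rewrite pt00 uz0 ux ltxx.
- split; [exact: seg_l|exact: seg_r| |].
    by exists (- b, 0) => //; split => //=; rewrite normr0.
  by exists (b, 0) => //; split => //=; rewrite normr0.
- split.
  (* Moving left keeps [u] negative by monotonicity, and the left edge is negative throughout: a
     horizontal and a vertical segment join any point of [Bm] to [pt (- b) 0]. *)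
  + pose A (xy : R * R) := seg (pt xy.1 xy.2) (pt (- b) xy.2) `|`
      seg (pt (- b) xy.2) (pt (- b) 0).
    have -> : Bm = \bigcup_(xy in Dm) A xy.
      apply/seteqP; split=> [_ [xy Dxy <-]|v [[x y] [/= xb yb uxy]]].
        by exists xy => //; left; exact: seg_l.
      have yb' : `|y| <= b by exact: le_trans (ltW yb) b2b.
      rewrite /A /= !seg_pt => -[[t /=]|[t /=]]; rewrite in_itv /= => t01 <-.
        have tb := itv_norm _ _ _ _ xb nNbb t01.
        exists (x + t * (- b - x), y) => /=; last first.
          by rewrite subrr mulr0 addr0.
        split => //=; apply: le_lt_trans uxy; apply: mono_le => //.
        have /andP[t0 _] := t01; have : 0 <= t * (b + x).
          by rewrite mulr_ge0 //; move: xb; rewrite ler_norml => /andP[? _]; lra.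
        have -> : t * (- b - x) = - (t * (b + x)) by ring.
        lra.
      exists (- b, y + t * (0 - y)) => /=; last by rewrite subrr mulr0 addr0.
      by split => //=; [exact: y_shrink|have [] := b2P _ (y_shrink _ _ yb t01)].
    apply: bigcup_connected.
      by exists (pt (- b) 0) => xy _; right; exact: seg_r.
    move=> xy _; apply: connectedU; [|exact: seg_connected|exact: seg_connected].
    by exists (pt (- b) xy.2); split; [exact: seg_r|exact: seg_l].
  + pose A (xy : R * R) := seg (pt xy.1 xy.2) (pt b xy.2) `|`
      seg (pt b xy.2) (pt b 0).
    have -> : Bp = \bigcup_(xy in Dp) A xy.
      apply/seteqP; split=> [_ [xy Dxy <-]|v [[x y] [/= xb yb uxy]]].
        by exists xy => //; left; exact: seg_l.
      have yb' : `|y| <= b by exact: le_trans (ltW yb) b2b.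
      rewrite /A /= !seg_pt => -[[t /=]|[t /=]]; rewrite in_itv /= => t01 <-.
        have tb := itv_norm _ _ _ _ xb nbb t01.
        exists (x + t * (b - x), y) => /=; last first.
          by rewrite subrr mulr0 addr0.
        split => //=; apply: lt_le_trans uxy _; apply: mono_le => //.
        have /andP[t0 _] := t01; have : 0 <= t * (b - x).
          by rewrite mulr_ge0 //; move: xb; rewrite ler_norml => /andP[_ ?]; lra.
        lra.
      exists (b, y + t * (0 - y)) => /=; last by rewrite subrr mulr0 addr0.
      by split => //=; [exact: y_shrink|have [] := b2P _ (y_shrink _ _ yb t01)].
    apply: bigcup_connected.
      by exists (pt b 0) => xy _; right; exact: seg_r.
    move=> xy _; apply: connectedU; [|exact: seg_connected|exact: seg_connected].
    by exists (pt b xy.2); split; [exact: seg_r|exact: seg_l].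
  + by move=> _ [xy [_ _ h] <-].
  + by move=> _ [xy [_ _ h] <-].
- have Nwb : 0 < N w * b2 by rewrite mulr_gt0.
  apply/nbhs_normcP; exists (N w * b2) => // v vz.
  have [x [y [vE xb yb]]] : exists x y, [/\ v = pt x y, `|x| < b2 & `|y| < b2].
    have Nvw : N ((v - z0) / w) < b2.
      by rewrite normcM normcV ltr_pdivrMr // mulrC.
    exists (complex.Re ((v - z0) / w)), (complex.Im ((v - z0) / w)); split.
    - have wE : (complex.Re ((v - z0) / w) +i* complex.Im ((v - z0) / w))%C =
         (v - z0) / w by case: ((v - z0) / w).
      by rewrite /pt wE mulrCA divff // mulr1 addrC subrK.
    - exact: le_lt_trans (abs_Re_le _) Nvw.
    - exact: le_lt_trans (abs_Im_le _) Nvw.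
  have xb' : `|x| < b by exact: lt_le_trans xb b2b.
  have yb' : `|y| < b by exact: lt_le_trans yb b2b.
  have m0 : 0 < b - `|x| by rewrite subr_gt0.
  rewrite vE; split.
  + by move=> h; exists (x, y) => //; split => //=; exact: ltW.
  + by move=> h; exists (x, y) => //; split => //=; exact: ltW.
  (* By monotonicity, an arbitrarily small shift of [x] to the left or to the right enters either
     side. *)
  + move=> uv; split; apply/closure_normcP => e e0.
      set t := Num.min (b - `|x|) (e / (2 * N w)).
      have t0 : 0 < t by rewrite lt_min m0 divr_gt0 // mulr_gt0.
      have xt : `|x - t| <= b.
        apply: le_trans (ler_normB _ _) _; rewrite (gtr0_norm t0).
        have : t <= b - `|x| by rewrite ge_min lexx.
        lra.
      exists (pt (x - t) y).
        exists (x - t, y) => //; split => //=; rewrite -[X in _ < X]uv; apply: mono => //.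
        + exact: ltW.
        + exact: ltW.
        + by rewrite ltrBlDr ltrDl.
      apply: le_lt_trans (pt_dist _ _ _ _) _.
      rewrite subrr normr0 addr0 addrAC subrr add0r normrN (gtr0_norm t0).
      apply: le_lt_trans (_ : N w * (e / (2 * N w)) < e).
        by rewrite ler_pM2l // ge_min lexx orbT.
      have -> : N w * (e / (2 * N w)) = e / 2 by field; rewrite gt_eqF.
      lra.
    set t := Num.min (b - `|x|) (e / (2 * N w)).
    have t0 : 0 < t by rewrite lt_min m0 divr_gt0 // mulr_gt0.
    have xt : `|x + t| <= b.
      apply: le_trans (ler_normD _ _) _; rewrite (gtr0_norm t0).
      have : t <= b - `|x| by rewrite ge_min lexx.
      lra.
    exists (pt (x + t) y).
      exists (x + t, y) => //; split => //=; rewrite -[X in X < _]uv; apply: mono => //.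
      + exact: ltW.
      + exact: ltW.
      + by rewrite ltrDl.
    apply: le_lt_trans (pt_dist _ _ _ _) _.
    rewrite subrr normr0 addr0 addrAC subrr add0r (gtr0_norm t0).
    apply: le_lt_trans (_ : N w * (e / (2 * N w)) < e).
      by rewrite ler_pM2l // ge_min lexx orbT.
    have -> : N w * (e / (2 * N w)) = e / 2 by field; rewrite gt_eqF.
    lra.
Qed.

Lemma face_eq (L F : set C) v : is_face L F -> F v ->
  F = connected_component (~` L) v.
Proof. by move=> [y nLy ->] Fv; exact: same_connected_component. Qed.

Lemma face_open (L F : set C) : closed L -> is_face L F -> open F.
Proof. by move=> clL [y _ ->]; exact: component_open. Qed.

(** Each local side is connected, hence in one face, and the transversal shows that the two faces
    differ. One pair serves all points of [L] near [z0], which makes adjacency locally constant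
    along an edge. *)
Lemma faces_at (L : set C) z0 d : is_component X L -> compact L -> L z0 ->
  has_deriv id f z0 d -> d != 0 ->
  exists F1 F2, [/\ F1 <> F2, is_face L F1, is_face L F2 &
    \forall w \near z0, L w -> forall F, is_face L F ->
      (closure F w <-> F = F1 \/ F = F2)].
Proof.
move=> cL coL Lz0 df d0.
have LX : L `<=` X by have [x _ ->] := cL; exact: connected_component_sub.
have Lu z : L z -> u z = 0 by move=> /LX Xz; apply/good_X => //; exact: Xgood.
have [p [q [S [Bm [Bp [[cS conS Sg SX] [Sp Sq mp pq] [cm cp um upp] nr]]]]]] :=
  sides_exist (LX _ Lz0) df d0.
have mL : Bm `<=` ~` L by move=> z /um uz /Lu E; move: uz; rewrite E ltxx.
have pL : Bp `<=` ~` L by move=> z /upp uz /Lu E; move: uz; rewrite E ltxx.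
have nLp : (~` L) p by exact: mL.
have nLq : (~` L) q by exact: pL.
pose F1 := connected_component (~` L) p.
pose F2 := connected_component (~` L) q.
have m1 : Bm `<=` F1 by exact: connected_component_max.
have p2 : Bp `<=` F2 by exact: connected_component_max.
exists F1, F2; split; [|by exists p|by exists q|].
  move=> F12; apply: (@crossing_separates L S p q) => //.
  - by move=> z /SX ->.
  - exact: um.
  - exact: upp.
  - by rewrite -/F1 F12; exact: connected_component_refl.
have /nbhs_normcP[r r0 rP] := nr.
apply/nbhs_normcP; exists r => // w wz Lw F fF.
have oF : open F by apply: (face_open _ fF); exact: compactC_closed.
split=> [clw|[->|->]].
(* Such a face contains a point [v] near [z0]. Being off [L] does not exclude [u v = 0], but then
   [v] is a limit of [Bm], which the open face must meet. *)
- have rw : 0 < r - N (w - z0) by rewrite subr_gt0.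
  move/closure_normcP : clw => /(_ _ rw)[v Fv vw].
  have vz : N (v - z0) < r by have := normc_dist_add v w z0; lra.
  have [um0 up0 uz0] := rP _ vz.
  have meets B a : B `<=` connected_component (~` L) a -> closure B v ->
      F = connected_component (~` L) a.
    move=> Ba clv; have [y [By Fy]] := clv _ (open_nbhs_nbhs (conj oF Fv)).
    rewrite (face_eq fF Fy); apply/esym; apply: same_connected_component.
    exact: Ba.
  have [uv|uv|uv] := ltgtP (u v) 0.
  + by left; apply: meets m1 _; apply: subset_closure; exact: um0.
  + by right; apply: meets p2 _; apply: subset_closure; exact: up0.
  + by left; apply: meets m1 _; have [] := uz0 uv.
- have [_ _ /(_ (Lu _ Lw))[h _]] := rP _ wz.
  exact: closure_subset m1 _ h.
- have [_ _ /(_ (Lu _ Lw))[_ h]] := rP _ wz.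
  exact: closure_subset p2 _ h.
Qed.

End LevelSet.

(** * Faces and existence of noncritical points *)

Section Faces.
Variable R : realType.
Local Notation C := (Cplane R).
Local Notation N := (@normc R).

Lemma bounded_set_normcP (A : set C) :
  bounded_set A <-> exists r : R, forall z, A z -> N z <= r.
Proof.
split=> [[[m m'] [mr H]]|[r rP]].
  have m'0 : m' = 0 by move: mr; rewrite realE !lecE /= => /orP[] /andP[/eqP].
  exists (m + 1) => z Az.
  have := H ((m + 1)%:C)%C; rewrite ltcE /= m'0 eqxx ltrDl ltr01 => /(_ isT z Az).
  by rewrite /= normrE_normc lecE /= => /andP[].
exists (r%:C)%C; split; first by rewrite realE !lecE /= eqxx /= le_total.
move=> [x x']; rewrite ltcE /= => /andP[/eqP -> rx] z Az.
by rewrite /= normrE_normc lecE /= eqxx /=; apply: le_trans (rP _ Az) (ltW rx).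
Qed.

(** Exterior of a square rather than of a disc, because it is a union of four half-planes. *)
Definition outside (z0 : C) (s : R) : set C :=
  [set z | s < `|complex.Re (z - z0)| \/ s < `|complex.Im (z - z0)|].

Lemma outside_connected z0 s : 0 <= s -> connected (outside z0 s).
Proof.
move=> s0; pose g (z : C) : C := z + z0.
have -> : outside z0 s =
    g @` [set z : C | s < `|complex.Re z| \/ s < `|complex.Im z|].
  apply/seteqP; split=> [z oz|_ [z oz <-]].
    by exists (z - z0) => //; rewrite /g subrK.
  by rewrite /outside /g /= addrK.
apply: connected_continuous_connected; first exact: connected_exterior.
apply: continuous_subspaceT => z.
exact: (continuousC_add (@continuous_idC R z) (@continuousC_cst R _ z0 z)).
Qed.

Lemma not_outside z0 s z : ~ outside z0 s z -> N (z - z0) <= 2 * s.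
Proof.
move=> /not_orP[/negP h1 /negP h2]; rewrite -!leNgt in h1 h2.
by apply: le_trans (normc_le_ReIm _) _; lra.
Qed.

Lemma face_contains (L F E : set C) : is_face L F -> connected E -> E `<=` ~` L ->
  F `&` E !=set0 -> E `<=` F.
Proof.
move=> fF cE EL [v [Fv Ev]]; rewrite (face_eq fF Fv).
exact: connected_component_max.
Qed.

(** Applied to the exterior of a square around [L], this makes at least one of two distinct faces
    bounded. *)
Lemma two_faces_avoid (L F1 F2 E : set C) : is_face L F1 -> is_face L F2 ->
  F1 <> F2 -> connected E -> E `<=` ~` L ->
  F1 `&` E = set0 \/ F2 `&` E = set0.
Proof.
move=> f1 f2 F12 cE EL.
have [->|/set0P n1] := eqVneq (F1 `&` E) set0; first by left.
right; have [//|/set0P[v [F2v Ev]]] := eqVneq (F2 `&` E) set0.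
case: F12; have F1v := face_contains f1 cE EL n1 Ev.
by rewrite (face_eq f1 F1v) (face_eq f2 F2v).
Qed.

Lemma outside_subset_compl (L : set C) z0 s : (forall z, L z -> N (z - z0) <= s) ->
  outside z0 s `<=` ~` L.
Proof.
move=> Ls z [] h /Ls Nz; move: h; rewrite ltNge => /negP; apply.
  exact: le_trans (abs_Re_le _) Nz.
exact: le_trans (abs_Im_le _) Nz.
Qed.

Lemma avoid_outside_bounded (F : set C) z0 s : F `&` outside z0 s = set0 ->
  forall z, F z -> N (z - z0) <= 2 * s.
Proof.
move=> FE z Fz; apply: not_outside => oz.
by have : (F `&` outside z0 s) z by []; rewrite FE.
Qed.

Lemma avoid_outside_bounded_set (F : set C) s :
  F `&` outside 0 s = set0 -> bounded_set F.
Proof.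
move=> FE; apply/bounded_set_normcP; exists (2 * s) => z Fz.
by have := avoid_outside_bounded FE Fz; rewrite subr0.
Qed.

(** The exterior of a large square lies in a single face, and any face that misses it stays in the
    square. *)
Lemma unbounded_face (L : set C) : compact L ->
  exists! F, is_face L F /\ ~ bounded_set F.
Proof.
move=> cL; have [s s0 sP] := compactC_bounded cL.
have Ls z : L z -> N (z - 0) <= s by rewrite subr0 => /sP/ltW.
have EL := outside_subset_compl Ls.
have cE := @outside_connected 0 s (ltW s0).
pose v : C := ((s + 1)%:C)%C.
have Ev : outside 0 s v.
  by left; rewrite subr0 /= gtr0_norm ?ltrDl // addr_gt0.
exists (connected_component (~` L) v); split.
  split; first by exists v => //; exact: EL.
  move=> /bounded_set_normcP[r rP].
  pose m := Num.max r s + 1.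
  have ms : s < m by rewrite /m ltr_pwDr // le_max lexx orbT.
  have m0 : 0 < m by exact: lt_trans s0 ms.
  have : connected_component (~` L) v (m%:C)%C.
    apply: (connected_component_max (B := outside 0 s)) => //.
    by left; rewrite subr0 /= gtr0_norm.
  move=> /rP; rewrite normc_real gtr0_norm //.
  apply/negP; rewrite -ltNge /m ltr_pwDr // le_max lexx //.
move=> F [fF nbF]; have [FE|/set0P[w [Fw Ew]]] := eqVneq (F `&` outside 0 s) set0.
  by case: nbF; exact: avoid_outside_bounded_set FE.
have Fv : F v by apply: (face_contains fF cE EL) => //; exists w.
by rewrite (face_eq fF Fv).
Qed.

Lemma bounded_face (L F1 F2 : set C) : compact L -> is_face L F1 ->
  is_face L F2 -> F1 <> F2 -> exists F, is_face L F /\ bounded_set F.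
Proof.
move=> cL f1 f2 F12; have [s s0 sP] := compactC_bounded cL.
have Ls z : L z -> N (z - 0) <= s by rewrite subr0 => /sP/ltW.
have [FE|FE] := two_faces_avoid f1 f2 F12 (@outside_connected 0 s (ltW s0))
  (outside_subset_compl Ls).
- by exists F1; split => //; exact: avoid_outside_bounded_set FE.
- by exists F2; split => //; exact: avoid_outside_bounded_set FE.
Qed.

Lemma face_closure (L F : set C) z : closed L -> is_face L F -> closure F z ->
  L z \/ F z.
Proof.
move=> clL fF clz; have [Lz|nLz] := pselect (L z); [by left|right].
have oc := @component_open R L z clL.
have nz : nbhs z (connected_component (~` L) z).
  by apply: open_nbhs_nbhs; split => //; exact: connected_component_refl.
have [w [Fw zw]] := clz _ nz.
rewrite (face_eq fF Fw); exact: connected_component_sym.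
Qed.

(** The extrema of [|f|] over the closure are not attained in [F], hence are attained on [L] and
    both equal [eps]; then [|f|] is constant on [F], against the last hypothesis. *)
Lemma extremum_principle (f : C -> C) (eps : R) (L F : set C) : closed L ->
  is_face L F -> compact (closure F) ->
  (forall z, closure F z -> {for z, continuous f}) ->
  (forall z, L z -> N (f z) = eps) ->
  (forall z, F z -> forall e : R, 0 < e ->
     (exists2 w, N (w - z) < e & N (f z) < N (f w)) /\
     (exists2 w, N (w - z) < e & N (f w) < N (f z))) -> False.
Proof.
move=> clL fF cF cf Le ext.
have oF : open F by exact: face_open clL fF.
have [v Fv] : F !=set0.
  by have [y nLy FE] := fF; exists y; rewrite FE; exact: connected_component_refl.
have inF z : F z -> exists2 e : R, 0 < e & forall w, N (w - z) < e -> F w.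
  by move=> Fz; apply/nbhs_normcP; exact: open_nbhs_nbhs.
pose h (z : C) : R := N (f z).
have ch : {within closure F, continuous h}.
  apply: continuous_in_subspaceT => z /set_mem /cf cfz.
  exact: (continuous_comp cfz (@normc_continuous R _)).
have F0 : closure F !=set0 by exists v; exact: subset_closure.
have [m /set_mem clm mP] := compact_EVT_max F0 cF ch.
have [m' /set_mem clm' m'P] := compact_EVT_min F0 cF ch.
have up z : closure F z -> h z <= h m by move=> clz; apply: mP; rewrite inE.
have lo z : closure F z -> h m' <= h z by move=> clz; apply: m'P; rewrite inE.
have Lm : L m.
  have [//|Fm] := face_closure clL fF clm.
  have [e e0 eF] := inF _ Fm; have [[w wm fw] _] := ext _ Fm _ e0.
  by have := up _ (subset_closure (eF _ wm)); rewrite leNgt fw.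
have Lm' : L m'.
  have [//|Fm] := face_closure clL fF clm'.
  have [e e0 eF] := inF _ Fm; have [_ [w wm fw]] := ext _ Fm _ e0.
  by have := lo _ (subset_closure (eF _ wm)); rewrite leNgt fw.
have [e e0 eF] := inF _ Fv; have [[w wv fw] _] := ext _ Fv _ e0.
have := up _ (subset_closure (eF _ wv)); have := lo _ (subset_closure Fv).
rewrite /h (Le _ Lm) (Le _ Lm'); lra.
Qed.

End Faces.

(** * Existence of a noncritical point on a compact component *)

Section NoncriticalPoint.
Variable R : realType.
Local Notation C := (Cplane R).
Local Notation N := (@normc R).
Variables (f : C -> C) (eps : R) (X G : set C).
Hypotheses (eps0 : 0 < eps) (oG : open G) (XG : X `<=` G).
Hypothesis Xcl : forall z, G z -> closure X z -> X z.
Hypothesis Xgood : forall z, X z -> good f eps X z.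

Lemma exists_noncritical (L : set C) : is_component X L -> compact L ->
  (forall z r, L z -> 0 < r -> exists2 w, N (w - z) < r & f w <> f z) ->
  exists z d, [/\ L z, has_deriv id f z d & d != 0].
Proof.
move=> cL coL nconst; apply: contrapT => crit.
have LX : L `<=` X by have [x _ ->] := cL; exact: connected_component_sub.
have conL : connected L by have [x _ ->] := cL; exact: component_connected.
have [z0 Lz0] : L !=set0.
  by have [x Xx ->] := cL; exists x; exact: connected_component_refl.
have fz0 : N (f z0) = eps.
  by have [r r0 [_ /(_ z0)]] := Xgood (LX _ Lz0); rewrite subrr normc0
    => /(_ r0) <-; exact: LX.
have [rho rho0 [hz Xz]] := Xgood (LX _ Lz0).
have [[r r0 rP]|[m [c [K [r [m0 c0 K0 /andP[r0 rrho] Ho]]]]]] := local_form rho0 hz.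
  by have [w /rP wz] := nconst _ _ Lz0 r0; case.
have [r1 r10 r1P] := zeros_deriv_isolated m0 c0 r0 K0 Ho.
have fz00 : f z0 != 0 by rewrite -normc_gt0P fz0.
have ext0 := no_local_extremum m0 c0 r0 K0 Ho fz00.
have /continuous_normcP /(_ _ eps0) /nbhs_normcP[r2 r20 r2P] :=
  holo_ball_continuous rho0 hz.
(* Within [b] of [z0], [f] is holomorphic, has no zero, and has nonzero derivative except possibly
   at [z0]. *)
pose b := Num.min rho (Num.min r1 r2).
have b0 : 0 < b by rewrite !lt_min rho0 r10.
have brho z : N (z - z0) < b -> N (z - z0) < rho.
  by rewrite !lt_min => /and3P[].
have fb0 z : N (z - z0) < b -> f z != 0.
  rewrite !lt_min => /and3P[_ _ /r2P /= h]; rewrite -normc_gt0P.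
  by have := normc_sub_le (f z0) (f z); rewrite (normc_distC (f z0)) fz0; lra.
have extb z : N (z - z0) < b -> forall e : R, 0 < e ->
     (exists2 w, N (w - z) < e & N (f z) < N (f w)) /\
     (exists2 w, N (w - z) < e & N (f w) < N (f z)).
  have [-> _|zz0 zb] := eqVneq z z0; first exact: ext0.
  have Nz0 : 0 < N (z - z0) by rewrite normc_gt0P subr_eq0.
  have s0 : 0 < rho - N (z - z0) by rewrite subr_gt0; exact: brho.
  have hzz : holo_ball f z (rho - N (z - z0)).
    by move=> w wz; apply: hz; have := normc_dist_add w z z0; lra.
  have [[s s0' sP]|[m' [c' [K' [r' [m'0 c'0 K'0 /andP[r'0 _] Ho']]]]]] :=
    local_form s0 hzz.
    have df : has_deriv id f z 0.
      apply: (has_deriv_near s0' _ _ (@has_deriv_cst R _ id (f z) z)) => // h hs.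
      by rewrite sP // addrAC subrr add0r.
    have : (0 : C) != 0.
      apply: r1P df; rewrite Nz0 /=.
      by move: zb; rewrite !lt_min => /and3P[].
    by rewrite eqxx.
  exact: no_local_extremum m'0 c'0 r'0 K'0 Ho' (fb0 _ zb).
have noncrit z : z != z0 -> N (z - z0) < b ->
    exists2 d, has_deriv id f z d & d != 0.
  move=> zz0 zb; have [d df] := hz _ (brho _ zb); exists d => //.
  apply: r1P df; rewrite normc_gt0P subr_eq0 zz0 /=.
  by move: zb; rewrite !lt_min => /and3P[].
have LE z : L z -> z = z0.
  move=> Lz; apply: (connected_locally_constant (P := fun w => w = z0) conL _ Lz0 Lz) => //.
  move=> w Lw; have [->|wz0] := eqVneq w z0.
    apply/nbhs_normcP; exists b => // v vz Lv; split=> // _.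
    have [//|vz0] := eqVneq v z0; exfalso; apply: crit.
    by have [d df d0] := noncrit _ vz0 vz; exists v, d.
  apply/nbhs_normcP; exists (N (w - z0)) => [|v vw _].
    by rewrite normc_gt0P subr_eq0.
  split=> [vz0|/eqP]; last by rewrite (negbTE wz0).
  by move: vw; rewrite vz0 normc_distC ltxx.
(* A face missing the exterior of the square of half-side [s] stays within [2 * s < b] of [z0],
   where the local facts apply. *)
pose s := b / 3; have s0 : 0 < s by rewrite divr_gt0.
have [|U [oU LU clU _ UX]] := component_separation oG XG Xcl cL coL
    (@openN_ball R z0 s).
  by move=> z /LE ->; rewrite /= subrr normc0.
have Us z : closure U z -> N (z - z0) < s by move=> /clU[].
have Uz0 : U z0 by exact: LU.
have [[z1 [Uz1 Xz1 z1z0]]|noX] :=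
    pselect (exists z1, [/\ U z1, X z1 & z1 <> z0]).
(* [L1] cannot leave [U], as the boundary of [U] misses [X], so it is compact. It is noncritical at
   [z1], hence has two faces, one of which is enclosed in the small square. *)
- pose L1 := connected_component X z1.
  have L1z1 : L1 z1 by exact: connected_component_refl.
  have cL1 : is_component X L1 by exists z1.
  have L1X : L1 `<=` X by exact: connected_component_sub.
  have L1U : L1 `<=` U.
    move=> z L1z; apply: (connected_locally_constant (A := L1) (P := U) _ _ L1z1 L1z Uz1).
      exact: component_connected.
    move=> w L1w; have [Uw|nUw] := pselect (U w).
      have : nbhs w U by exact: open_nbhs_nbhs.
      by apply: filterS => v Uv _; split.
    have : nbhs w (~` closure U).
      apply: open_nbhs_nbhs; split; first exact/closed_openC/closed_closure.
      by move=> clw; apply: nUw; apply: UX => //; exact: L1X.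
    by apply: filterS => v nv _; split => // /subset_closure.
  have clL1 : closed L1.
    move=> z clz; suff : closure L1 `<=` L1 by apply.
    apply: connected_component_max.
    - exact: subset_closure.
    - move=> w clw; apply: Xcl; last exact: closure_subset L1X _ clw.
      by have [] := clU _ (closure_subset L1U clw).
    - by apply: connected_closure; exact: component_connected.
  have L1b z : L1 z -> N (z - z0) <= s by move=> /L1U /subset_closure /Us /ltW.
  have coL1 : compact L1 by exact: compact_closed_bounded clL1 L1b.
  have [d df d0] : exists2 d, has_deriv id f z1 d & d != 0.
    apply: noncrit; first exact/eqP.
    by have := Us _ (subset_closure Uz1); rewrite /s; lra.
  have [F1 [F2 [F12 f1 f2 _]]] :=
    faces_at eps0 oG XG Xcl Xgood cL1 coL1 L1z1 df d0.
  have L1e z : L1 z -> N (f z) = eps.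
    move=> L1z; apply/Xz; last exact: L1X.
    by apply: brho; have := L1b _ L1z; rewrite /s; lra.
  have [F [fF FE]] : exists F, is_face L1 F /\ F `&` outside z0 s = set0.
    have [FE|FE] := two_faces_avoid f1 f2 F12 (@outside_connected R z0 s (ltW s0))
      (outside_subset_compl L1b).
    + by exists F1.
    + by exists F2.
  have Fs := avoid_outside_bounded FE.
  have clFs z : closure F z -> N (z - z0) <= 2 * s.
    by move=> clz; apply: (@closedN_ball R z0 (2 * s)); exact: closure_subset Fs _ clz.
  have clFb z : closure F z -> N (z - z0) < b.
    by move=> /clFs; rewrite /s; lra.
  apply: (@extremum_principle R f eps L1 F clL1 fF).
  + by apply: compact_closed_bounded clFs; exact: closed_closure.
  + move=> z /clFb /brho zr; have [d' df'] := hz _ zr.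
    exact: has_deriv_continuous df'.
  + exact: L1e.
  + by move=> z /subset_closure /clFb; exact: extb.
(* Here [|f| - eps] has no zero on a punctured disc; the latter is connected, so the sign is
   constant, although both signs occur near [z0]. *)
- have /nbhs_normcP[r3 r30 r3P] : nbhs z0 U by exact: open_nbhs_nbhs.
  pose t := Num.min r3 b; have t0 : 0 < t by rewrite lt_min r30.
  have [[zp zpt fp] [zm zmt fm]] := ext0 _ t0.
  have neq z : N (f z) != N (f z0) -> z != z0 by apply: contraNneq => ->.
  pose A := [set z : C | N (z - z0) < t /\ z != z0].
  have conA : connected A by exact: connected_punctured_ball.
  have Ap : A zp by split => //; apply: neq; rewrite gt_eqF.
  have Am : A zm by split => //; apply: neq; rewrite lt_eqF.
  have Ab z : A z -> N (z - z0) < b by move=> [+ _]; rewrite lt_min => /andP[].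
  have Ane z : A z -> N (f z) != eps.
    move=> Az; apply/eqP => fe; apply: noX; exists z.
    have [zt zz0] := Az; split; last exact/eqP.
    - by apply: r3P; move: zt; rewrite lt_min => /andP[].
    - by apply/Xz => //; exact/brho/Ab.
  have : eps < N (f zm).
    apply: (connected_locally_constant (A := A) (P := fun z => eps < N (f z)) conA _ Ap Am).
      move=> z Az; have Nz := Ane _ Az.
      have d0 : 0 < `|N (f z) - eps| by rewrite normr_gt0 subr_eq0.
      have [d' /has_deriv_continuous df'] := hz _ (brho _ (Ab _ Az)).
      have cz : {for z, continuous (fun w => N (f w))}.
        exact: (continuous_comp df' (@normc_continuous R _)).
      move/continuous_absP : cz => /(_ _ d0); apply: filterS => w fw _.
      have [ze|ze|ze] := ltgtP (N (f z)) eps.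
      + move: fw; rewrite (@ltr0_norm _ (N (f z) - eps)) ?subr_lt0 //.
        by rewrite ltr_norml => /andP[? ?]; split => //; lra.
      + move: fw; rewrite (@gtr0_norm _ (N (f z) - eps)) ?subr_gt0 //.
        by rewrite ltr_norml => /andP[? ?]; split => //; lra.
      + by rewrite ze eqxx in Nz.
    by rewrite -fz0.
  rewrite -fz0; lra.
Qed.

End NoncriticalPoint.

(** * Meromorphic functions and edges *)

Section Meromorphic.
Variable R : realType.
Local Notation C := (Cplane R).
Local Notation N := (@normc R).
Variables (f : C -> C) (eps : R) (G' : set C).
Hypotheses (oG' : open G') (mf : meromorphic_on G' f).

Lemma derivable_has_deriv z : derivable f z 1 -> has_deriv id f z ('D_1 f z).
Proof. by move=> df; apply/is_derive_has_deriv; exact: derivableP. Qed.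

Lemma has_deriv_derivable z d : has_deriv id f z d -> derivable f z 1.
Proof. by move=> /is_derive_has_deriv[]. Qed.

Lemma pole_large z (M : R) : is_pole f z ->
  exists2 r : R, 0 < r & forall w, N (w - z) < r -> w != z -> M < N (f w).
Proof.
have Moo : pinfty_nbhs R[i] [set x | (M%:C)%C < x].
  exists (M%:C)%C; split => //.
  by rewrite realE !lecE /= eqxx /= le_total.
move=> /(_ _ Moo) /nbhs_normcP[r r0 rP]; exists r => // w wr wz.
by have := rP _ wr wz; rewrite /= normrE_normc ltcE /= eqxx.
Qed.

Lemma has_deriv_not_pole z d : has_deriv id f z d -> ~ is_pole f z.
Proof.
move=> /has_deriv_continuous /continuous_normcP /(_ 1 ltr01) /nbhs_normcP[r r0 rP].
move=> /(pole_large (N (f z) + 1))[r' r'0 r'P].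
pose h := Num.min r r' / 2; have h0 : 0 < h by rewrite divr_gt0 // lt_min r0.
have hr : h < Num.min r r' by move: h0; rewrite /h; lra.
move: hr; rewrite lt_min => /andP[hr hr'].
have hE : z + (h%:C)%C - z = (h%:C)%C by ring.
have Nh : N (z + (h%:C)%C - z) = h by rewrite hE normc_real gtr0_norm.
have := rP (z + (h%:C)%C); rewrite Nh => /(_ hr) h1.
have := r'P (z + (h%:C)%C); rewrite Nh => /(_ hr') h2.
have hz : z + (h%:C)%C != z by rewrite -subr_eq0 -normc_gt0P Nh.
have := h2 hz; have := normc_sub_le (f (z + (h%:C)%C)) (f z); lra.
Qed.

Lemma holo_ball_nonpole z : G' z -> ~ is_pole f z ->
  exists2 r : R, 0 < r & holo_ball f z r /\ forall w, N (w - z) < r -> G' w.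
Proof.
move=> Gz npz; have [nz dz] := mf Gz.
have {}dz : derivable f z 1 by case: dz.
have /nbhs_normcP[r1 r10 r1P] := nz.
have /nbhs_normcP[r2 r20 r2P] : nbhs z G' by exact: open_nbhs_nbhs.
exists (Num.min r1 r2); first by rewrite lt_min r10.
split=> w; rewrite lt_min => /andP[w1 w2]; last exact: r2P.
exists ('D_1 f w); apply: derivable_has_deriv.
by have [->|wz] := eqVneq w z; [exact: dz|exact: r1P].
Qed.

Lemma level_set_good z : level_set G' f eps z -> good f eps (level_set G' f eps) z.
Proof.
move=> [Gz npz fz]; have [r r0 [hz Gr]] := holo_ball_nonpole Gz npz.
exists r; [exact: r0|split; first exact: hz].
move=> w wr; split=> [[_ _]|fw].
  by rewrite normrE_normc => /(congr1 (@complex.Re R)).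
have [d dw] := hz _ wr; split; [exact: Gr|exact: has_deriv_not_pole dw|].
by rewrite normrE_normc fw.
Qed.

Lemma level_set_norm z : level_set G' f eps z -> N (f z) = eps.
Proof. by move=> [_ _]; rewrite normrE_normc => /(congr1 (@complex.Re R)). Qed.

(** Around a pole [|f|] exceeds [eps], so poles are not limits of the level set; at the other points
    of [G'] continuity suffices. *)
Lemma level_set_closed z : G' z -> closure (level_set G' f eps) z ->
  level_set G' f eps z.
Proof.
move=> Gz /closure_normcP clz.
have [pz|npz] := pselect (is_pole f z).
  have [r r0 rP] := pole_large eps pz; have [w Xw wz] := clz _ r0.
  have [<- //|wz'] := eqVneq w z.
  by have := rP _ wz wz'; rewrite (level_set_norm Xw) ltxx.
have [r r0 [hz _]] := holo_ball_nonpole Gz npz.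
split => //; rewrite normrE_normc; congr ((_)%:C)%C.
apply/eqP; rewrite -subr_eq0 -normr_eq0 eq_le normr_ge0 andbT leNgt; apply/negP => d0.
have /continuous_normcP /(_ _ d0) /nbhs_normcP[r' r'0 r'P] :=
  holo_ball_continuous r0 hz.
have [w Xw /r'P /= wz] := clz _ r'0.
have := normc_dist_le (f z) (f w); rewrite (level_set_norm Xw) normc_distC.
by rewrite leNgt wz.
Qed.

(** The points of [L] near which [f] is constant form an open set, since a disc of constancy stays
    in the component, and a closed one, since elsewhere zeros of the derivative are isolated. If
    nonempty, it is the whole plane, while [L] is compact. *)
Lemma component_nonconstant (L : set C) : is_component (level_set G' f eps) L ->
  compact L -> forall z r, L z -> 0 < r -> exists2 w, N (w - z) < r & f w <> f z.
Proof.
move=> cL coL z1 r1 Lz1 r10; apply: contrapT => nw.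
have LX : L `<=` level_set G' f eps.
  by have [x _ ->] := cL; exact: connected_component_sub.
have clL := compactC_closed coL.
pose Y z := exists2 r : R, 0 < r & forall w, N (w - z) < r -> f w = f z.
have allL z : L z /\ Y z.
  have cT : connected [set: C] by apply: convexC_connected.
  apply: (connected_locally_constant (A := setT) (P := fun z => L z /\ Y z) cT _
    (I : setT z1) (I : setT z)); last first.
    split => //; exists r1 => // w wz; apply: contrapT => fw.
    by apply: nw; exists w.
  move=> {}z _; have [Lz|nLz] := pselect (L z); last first.
    have : nbhs z (~` L) by apply: open_nbhs_nbhs; split=> //; exact: closed_openC.
    by apply: filterS => w nLw _; split=> -[].
  have [r r0 [hz Xz]] := level_set_good (LX _ Lz).
  have [[s s0 sP]|[m [c [K [s [m0 c0 K0 /andP[s0 _] Ho]]]]]] := local_form r0 hz.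
    have zY : Y z by exists s.
    apply/nbhs_normcP; exists (Num.min r s); first by rewrite lt_min r0.
    move=> w; rewrite lt_min => /andP[wr ws] _; split=> // _; split; last first.
      exists (s - N (w - z)); first by rewrite subr_gt0.
      move=> v vw; rewrite (sP _ ws) sP //.
      by have := normc_dist_add v w z; lra.
    rewrite (component_self cL Lz).
    apply: (connected_component_max (B := [set w | N (w - z) < Num.min r s])).
    - by rewrite /= subrr normc0 lt_min r0.
    - move=> v; rewrite /= lt_min => /andP[vr vs].
      by apply/Xz => //; rewrite (sP _ vs); exact/level_set_norm/LX.
    - by apply: convexC_connected; exact: convexC_ball.
    - by rewrite /= lt_min wr.
  have [s' s'0 s'P] := zeros_deriv_isolated m0 c0 s0 K0 Ho.
  have noY w : N (w - z) < s' -> w != z -> ~ Y w.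
    move=> ws' wz [t t0 tP].
    have dw : has_deriv id f w 0.
      apply: (has_deriv_near t0 _ _ (@has_deriv_cst R _ id (f w) w)) => // h hs.
      by rewrite tP // addrAC subrr add0r.
    have : (0 : C) != 0 by apply: s'P dw; rewrite normc_gt0P subr_eq0 wz.
    by rewrite eqxx.
  have noYz : ~ Y z.
    move=> [t t0 tP]; pose h := Num.min t s' / 2.
    have h0 : 0 < h by rewrite divr_gt0 // lt_min t0.
    have ht : h < Num.min t s' by move: h0; rewrite /h; lra.
    move: ht; rewrite lt_min => /andP[ht hs].
    have hE : z + (h%:C)%C - z = (h%:C)%C by ring.
    have Nh : N (z + (h%:C)%C - z) = h by rewrite hE normc_real gtr0_norm.
    apply: (noY (z + (h%:C)%C)).
    - by rewrite Nh.
    - by rewrite -subr_eq0 -normc_gt0P Nh.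
    - exists (t - h); first by rewrite subr_gt0.
      move=> v vh; rewrite !tP ?Nh //.
      by have := normc_dist_add v (z + (h%:C)%C) z; rewrite Nh; lra.
  apply/nbhs_normcP; exists s' => // w ws' _; split=> -[_ Yw]; exfalso.
    have [wz|wz] := eqVneq w z; last exact: (noY _ ws' wz).
    by rewrite wz in Yw.
  exact: noYz.
have [r r0 rP] := compactC_bounded coL.
have [/rP + _] := allL (r%:C)%C.
by rewrite normc_real gtr0_norm // ltxx.
Qed.

End Meromorphic.

(** * Edges without their end points, and the theorem *)

Section Edges.
Variable R : realType.
Local Notation C := (Cplane R).

(** Continuity of [g] is relative to the segment, so the values at [0] and [1] are one-sided limits
    along interior points. *)
Lemma path_image_closure (g : R -> C) : {within `[0, 1], continuous g} ->
  connected (g @` `]0, 1[) /\ g @` `[0, 1] `<=` closure (g @` `]0, 1[).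
Proof.
move=> cg; split.
  apply: connected_continuous_connected.
    by apply/connected_intervalP; exact: interval_is_interval.
  by apply: continuous_subspaceW cg; exact: subset_itv_oo_cc.
have [_ g0 g1] := (continuous_within_itvP g (@ltr01 R)).1 cg.
move=> v [t /=]; rewrite in_itv /= => /andP[t0 t1] <-.
have [->|nt0] := eqVneq t 0.
  move=> B /g0 nB; have {}nB : \forall x \near (0 : R)^'+, B (g x) by exact: nB.
  have FF : ProperFilter (0 : R)^'+ by exact: at_right_proper_filter.
  have h1 : \forall x \near (0 : R)^'+, x < 1 by exact: nbhs_right_lt.
  have h0 : \forall x \near (0 : R)^'+, 0 < x by exact: nbhs_right_gt.
  have [x [[Bx x0] x1]] := filter_ex (filterI (filterI nB h0) h1).
  by exists (g x); split => //; exists x => //=; rewrite in_itv /= x0.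
have [->|nt1] := eqVneq t 1.
  move=> B /g1 nB; have {}nB : \forall x \near (1 : R)^'-, B (g x) by exact: nB.
  have FF : ProperFilter (1 : R)^'- by exact: at_left_proper_filter.
  have h1 : \forall x \near (1 : R)^'-, x < 1 by exact: nbhs_left_lt.
  have h0 : \forall x \near (1 : R)^'-, 0 < x by exact: nbhs_left_gt.
  have [x [[Bx x0] x1]] := filter_ex (filterI (filterI nB h0) h1).
  by exists (g x); split => //; exists x => //=; rewrite in_itv /= x0.
apply: subset_closure; exists t => //=; rewrite in_itv /=.
by rewrite !lt_neqAle t0 t1 nt1 eq_sym nt0.
Qed.

(* [T] is the edge without its end points, or all of [L]. *)
Lemma edge_core (f : C -> C) (L E : set C) : connected L -> L !=set0 ->
  is_edge f L E -> exists T, [/\ connected T, T !=set0, T `<=` E,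
    E `<=` closure T & E `<=` L /\ forall z, T z -> 'D_1 f z <> 0].
Proof.
move=> cL L0 [[g [[cg _] EE EL _ nc]]|[nc ->]].
  have [cT clT] := path_image_closure cg.
  exists (g @` `]0, 1[); split => //.
  - exists (g (2^-1)); exists 2^-1 => //=; rewrite in_itv /=.
    by apply/andP; split; lra.
  - by rewrite EE; apply: image_subset; exact: subset_itv_oo_cc.
  - by rewrite EE.
  - split => // _ [t tI <-] Dt; apply: (nc t tI); split => //.
    by apply: EL; rewrite EE; exists t => //; exact: subset_itv_oo_cc tI.
exists L; split => //; first exact: subset_closure.
split => // z Lz Dz; have : critical_points f L z by [].
by rewrite nc.
Qed.

End Edges.

Theorem proposition2p5 (R : realType) (G G' : set (Cplane R))
    (f : Cplane R -> Cplane R) (eps : R) (Lambda : set (Cplane R))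
    (oG : open G) (oG' : open G') (clG : closure G `<=` G')
    (mf : meromorphic_on G' f) (eps_gt0 : 0 < eps)
    (cL : is_component (level_set G' f eps) Lambda)
    (bL : bounded_set Lambda) (LG : Lambda `<=` G) :
  [/\ exists F, is_face Lambda F /\ bounded_set F,
      exists! F, is_face Lambda F /\ ~ bounded_set F &
      forall E, is_edge f Lambda E ->
        exists F1 F2, [/\ F1 <> F2,
          is_face Lambda F1 /\ edge_adjacent E F1,
          is_face Lambda F2 /\ edge_adjacent E F2 &
          forall F, is_face Lambda F -> edge_adjacent E F -> F = F1 \/ F = F2]].
Proof.
pose X := level_set G' f eps.
have XG : X `<=` G' by move=> z [].
have Xcl z : G' z -> closure X z -> X z by exact: level_set_closed.
have Xgood z : X z -> good f eps X z by exact: level_set_good.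
have LX : Lambda `<=` X by have [x _ ->] := cL; exact: connected_component_sub.
have conL : connected Lambda by have [x _ ->] := cL; exact: component_connected.
have L0 : Lambda !=set0.
  by have [x Xx ->] := cL; exists x; exact: connected_component_refl.
have clL : closed Lambda.
  have [x Lx] := L0; rewrite (component_self cL Lx) => z clz.
  suff : closure (connected_component X x) `<=` connected_component X x by apply.
  apply: connected_component_max.
  - by apply: subset_closure; apply: connected_component_refl; exact: LX.
  - move=> w clw; apply: Xcl; last by exact: closure_subset (@connected_component_sub _ _ _) _ clw.
    (* As [Lambda] lies in [G], its closure stays in [G'], where the level set is relatively
       closed. *)
    by apply: clG; apply: closure_subset clw; rewrite -(component_self cL Lx).
  - by apply: connected_closure; exact: component_connected.
have coL : compact Lambda.
  have [r rP] := (bounded_set_normcP Lambda).1 bL.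
  by apply: (@compact_closed_bounded R Lambda 0 r clL) => z /rP /=; rewrite subr0.
have nconst := component_nonconstant oG' mf cL coL.
split.
- have [z0 [d [Lz0 df d0]]] := exists_noncritical eps_gt0 oG' XG Xcl Xgood cL coL nconst.
  have [F1 [F2 [F12 f1 f2 _]]] := faces_at eps_gt0 oG' XG Xcl Xgood cL coL Lz0 df d0.
  exact: bounded_face coL f1 f2 F12.
- exact: unbounded_face.
move=> E /(edge_core conL L0)[T [conT [t0 Tt0] TE EclT [EL ncT]]].
have faces z : T z -> exists F1 F2, [/\ F1 <> F2, is_face Lambda F1,
    is_face Lambda F2 & \forall w \near z, Lambda w -> forall F, is_face Lambda F ->
      (closure F w <-> F = F1 \/ F = F2)].
  move=> Tz; have Lz := EL _ (TE _ Tz).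
  have [r r0 [hz _]] := Xgood _ (LX _ Lz).
  have [|d df] := hz z; first by rewrite subrr normc0.
  apply: (faces_at eps_gt0 oG' XG Xcl Xgood cL coL Lz df).
  apply/eqP => d0; apply: (ncT z Tz); rewrite -d0.
  exact: has_deriv_unique (derivable_has_deriv (has_deriv_derivable df)) df.
(* Nearby points of [T] have the same two faces, so lying in the closure of [F] is locally constant
   on the connected set [T]. *)
have invariant F : is_face Lambda F -> forall a b, T a -> T b ->
    closure F a -> closure F b.
  move=> fF; apply: connected_locally_constant => // z Tz.
  have [F1 [F2 [_ _ _ near_z]]] := faces z Tz.
  have zF := nbhs_singleton near_z (EL _ (TE _ Tz)) F fF.
  apply: filterS near_z => w wF Tw.
  by rewrite (wF (EL _ (TE _ Tw)) F fF) zF.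
(* The closure of [F] contains [T], hence also the critical end points; the edge avoids the interior
   of [F] because [F] misses [Lambda]. *)
have adj F : is_face Lambda F -> closure F t0 -> edge_adjacent E F.
  move=> fF Ft0 z Ez; split.
    have TF : T `<=` closure F by move=> v Tv; exact: invariant Ft0.
    exact: (@closed_closure _ F) (closure_subset TF (EclT _ Ez)).
  move=> /interior_subset Fz; have [y _ FE] := fF.
  by move: Fz; rewrite FE => /(@connected_component_sub _ _ _); apply; exact: EL.
have [F1 [F2 [F12 f1 f2 near_t0]]] := faces t0 Tt0.
have t0F := nbhs_singleton near_t0 (EL _ (TE _ Tt0)).
exists F1, F2; split => //.
- by split => //; apply: adj => //; apply/(t0F _ f1); left.
- by split => //; apply: adj => //; apply/(t0F _ f2); right.
- by move=> F fF /(_ t0 (TE _ Tt0))[clt0 _]; apply/t0F.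
Qed.
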